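(* The Identification problem is W[1]-hard on instances $(G,L)$ where $L$ is a linear forest, when parameterized by the number of connected components of $L$.
   Context: All graphs are finite, simple and undirected. An identification of two distinct vertices $u,v$ replaces them with a new vertex adjacent to every vertex of $(N(u)\cup N(v))\setminus\{u,v\}$. The Identification problem takes as input two graphs $G$ and $H$ and asks whether $G$ can be transformed into a graph isomorphic to $H$ by a (possibly empty) sequence of identifications. A linear forest is a graph each of whose connected components is a path. *)

(* Defs.v *)
From mathcomp Require Import all_boot matrix.

Set Implicit Arguments.
Unset Strict Implicit.
Unset Printing Implicit Defensive.

(* A two-way infinite tape: [tleft] is read from the head outwards, and every *)
(* cell outside of [tleft], [tcur], [tright] is blank.                        *)
Record tape (S : Type) := Tape { tleft : seq S; tcur : S; tright : seq S }.

Inductive direction := MoveL | MoveN | MoveR.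

Definition move_tape (S : Type) (blank : S) (d : direction) (t : tape S) : tape S :=
  match d with
  | MoveL => Tape (behead (tleft t)) (head blank (tleft t)) (tcur t :: tright t)
  | MoveN => t
  | MoveR => Tape (tcur t :: tleft t) (head blank (tright t)) (behead (tright t))
  end.

Definition write_tape (S : Type) (s : S) (t : tape S) : tape S :=
  Tape (tleft t) s (tright t).

(* The tape alphabet consists of the blank [None], the two bits               *)
(* [Some (inl b)], and the machine's own auxiliary letters [Some (inr x)].    *)
(* There are [tm_tapes.+1] tapes.                                             *)
Record tm := TM {
  tm_state : finType;
  tm_aux : finType;
  tm_tapes : nat;
  tm_start : tm_state;
  tm_halt : pred tm_state;
  tm_trans : tm_state ->
    {ffun 'I_tm_tapes.+1 -> option (bool + tm_aux)} ->
    tm_state * {ffun 'I_tm_tapes.+1 -> option (bool + tm_aux) * direction} }.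

Definition tm_symbol (M : tm) : Type := option (bool + tm_aux M).

Record config (M : tm) := Config {
  c_state : tm_state M;
  c_tapes : {ffun 'I_(tm_tapes M).+1 -> tape (tm_symbol M)} }.

Definition tm_step (M : tm) (c : config M) : config M :=
  if tm_halt (c_state c) then c else
  let: (q, act) := tm_trans (c_state c) [ffun i => tcur (c_tapes c i)] in
  Config q [ffun i => move_tape None (act i).2
                        (write_tape (act i).1 (c_tapes c i))].

Definition word_tape (X : Type) (w : seq bool) : tape (option (bool + X)) :=
  let s := [seq Some (inl b) | b <- w] in
  Tape [::] (head None s) (behead s).

Definition tm_init (M : tm) (w : seq bool) : config M :=
  Config (tm_start M)
    [ffun i => word_tape (tm_aux M) (if i == ord0 then w else [::])].

Fixpoint read_bits (X : Type) (s : seq (option (bool + X))) : seq bool :=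
  if s is Some (inl b) :: s' then b :: read_bits s' else [::].

(* The output is the maximal word of bits that starts at the head of tape 0.  *)
Definition tm_output (M : tm) (c : config M) : seq bool :=
  let t := c_tapes c ord0 in read_bits (tcur t :: tright t).

Definition computes_within (M : tm) (w v : seq bool) (time : nat) : Prop :=
  let c := iter time (@tm_step M) (tm_init M w) in
  tm_halt (c_state c) /\ tm_output c = v.

Definition computable (f : nat -> nat) : Prop :=
  exists M : tm, forall n, exists time,
    computes_within M (nseq n true) (nseq (f n) true) time.

(* A problem comes with its own type of instances, so that restricting a      *)
(* problem to a class of instances means restricting this type.  Languages    *)
(* are the case [inst = seq bool] (or [seq bool * nat], with the parameter    *)
(* written in unary).                                                         *)
Record pproblem := PProblem {
  inst : Type;
  enc : inst -> seq bool;
  enc_inj : injective enc;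
  param : inst -> nat;
  yes : inst -> Prop }.

(* [.+1] keeps the time bound meaningful for an instance with an empty code.  *)
Definition fpt_reducible (A B : pproblem) : Prop :=
  exists (r : inst A -> inst B) (M : tm) (f g : nat -> nat) (c : nat),
    [/\ computable f /\ computable g,
        forall x, yes x <-> yes (r x),
        forall x, param (r x) <= g (param x) &
        forall x, computes_within M (enc x) (enc (r x))
                    (f (param x) * (size (enc x)).+1 ^ c)].

Definition unary (n : nat) : seq bool := rcons (nseq n true) false.

Definition bits_of (s : seq nat) : seq bool := flatten [seq unary n | n <- s].

Lemma bits_of_inj : injective bits_of.
Proof.
have unary_cat m n s t : unary m ++ s = unary n ++ t -> m = n /\ s = t.
  rewrite /unary; elim: m n => [|m IHm] [|n] //= => [[->] //|[/IHm[-> ->]] //].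
elim=> [|m s IHs] [|n t] //=; rewrite /bits_of /=.
- by case: n.
- by case: m.
by move/unary_cat=> [-> /IHs->].
Qed.

Inductive gate := GNot of nat | GAnd of seq nat | GOr of seq nat.

Definition gate_args (g : gate) : seq nat :=
  match g with GNot i => [:: i] | GAnd s => s | GOr s => s end.

Definition is_not (g : gate) : bool := if g is GNot _ then true else false.

Definition gate_val (g : gate) (vs : seq bool) : bool :=
  match g with
  | GNot _ => ~~ head false vs
  | GAnd _ => all id vs
  | GOr _ => has id vs
  end.

Definition large (g : gate) : bool := 2 < size (gate_args g).

(* A gate that may only refer to the nodes numbered [0 .. m-1].               *)
Definition wf_gate (m : nat) (g : gate) : bool :=
  [&& uniq (gate_args g), all (fun i => i < m) (gate_args g)
    & is_not g || (1 < size (gate_args g))].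

Fixpoint wf_gates (m : nat) (gs : seq gate) : bool :=
  if gs is g :: gs' then wf_gate m g && wf_gates m.+1 gs' else true.

(* A circuit is a DAG listed in topological order: the nodes                  *)
(* [0 .. cinputs-1] are the input nodes, node [cinputs + j] is the j-th gate, *)
(* and the last node is the output node.                                      *)
Record circuit := Circuit {
  cinputs : nat;
  cgates : seq gate;
  _ : (0 < cinputs) && wf_gates cinputs cgates }.

Definition propagate (T : Type) (x0 : T) (f : gate -> seq T -> T)
    (ini : seq T) (gs : seq gate) : T :=
  last x0 (foldl (fun vs g =>
             rcons vs (f g [seq nth x0 vs i | i <- gate_args g])) ini gs).

Definition circuit_val (C : circuit) (a : seq bool) : bool :=
  propagate false gate_val a (cgates C).

(* Since every gate has a predecessor, these are the maxima, over all paths   *)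
(* from an input node to the output node, of the number of gates and of the   *)
(* number of large gates.                                                     *)
Definition depth (C : circuit) : nat :=
  propagate 0 (fun _ ds => (\max_(d <- ds) d).+1)
    (nseq (cinputs C) 0) (cgates C).

Definition weft (C : circuit) : nat :=
  propagate 0 (fun g ws => large g + \max_(w <- ws) w)
    (nseq (cinputs C) 0) (cgates C).

Definition gate_code (g : gate) : seq nat :=
  match g with
  | GNot i => [:: 0; i]
  | GAnd s => [:: 1, size s & s]
  | GOr s => [:: 2, size s & s]
  end.

Definition circuit_code (C : circuit) : seq nat :=
  cinputs C :: flatten [seq gate_code g | g <- cgates C].

Lemma circuit_code_inj : injective circuit_code.
Proof.
have gate_cat g h s t :
    gate_code g ++ s = gate_code h ++ t -> g = h /\ s = t.
  case: g h => [i|u|u] [j|v|v] //= => [[-> ->] //|[] sz /eqP|[] sz /eqP];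
  by rewrite eqseq_cat // => /andP[/eqP-> /eqP->].
have gates_inj : injective (fun gs => flatten [seq gate_code g | g <- gs]).
  elim=> [|g gs IH] [|h hs] //=; [by case: h|by case: g|].
  by move/gate_cat=> [-> /IH->].
move=> [n gs wf] [m hs wf'] [/= eq_nm /gates_inj eq_gh]; subst m hs.
by congr Circuit; apply: bool_irrelevance.
Qed.

Definition bounded_circuit (t d : nat) : Type :=
  {C : circuit | (weft C <= t) && (depth C <= d)}.

Definition wcs_code (t d : nat) (x : bounded_circuit t d * nat) : seq bool :=
  bits_of (x.2 :: circuit_code (val x.1)).

Lemma wcs_code_inj (t d : nat) : injective (@wcs_code t d).
Proof.
by move=> [C k] [D l] /bits_of_inj[/= -> eqn eqg];
  congr (_, _); apply/val_inj/circuit_code_inj; rewrite /circuit_code eqn eqg.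
Qed.

Definition wcs_yes (t d : nat) (x : bounded_circuit t d * nat) : Prop :=
  exists a : seq bool,
    [/\ size a = cinputs (val x.1), count id a = x.2
      & circuit_val (val x.1) a].

(* Weighted Circuit Satisfiability for circuits of weft at most [t] and depth *)
(* at most [d], parameterized by the weight.                                  *)
Definition WCS (t d : nat) : pproblem :=
  @PProblem (bounded_circuit t d * nat)%type (@wcs_code t d)
    (@wcs_code_inj t d) snd (@wcs_yes t d).

Definition in_W (t : nat) (A : pproblem) : Prop :=
  exists d : nat, fpt_reducible A (WCS t d).

Definition W1_hard (B : pproblem) : Prop :=
  forall A : pproblem, in_W 1 A -> fpt_reducible A B.

Record sgraph := SGraph {
  vertex :> finType;
  adj : rel vertex;
  adj_sym : symmetric adj;
  adj_irrefl : irreflexive adj }.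

Definition isomorphic (G H : sgraph) : Prop :=
  exists f : G -> H, bijective f /\ forall x y, adj (f x) (f y) = adj x y.

(* [None] is the new vertex that replaces u and v.                            *)
Definition id_vertex (G : sgraph) (u v : G) : finType :=
  option {w : G | (w != u) && (w != v)}.

Definition id_adj (G : sgraph) (u v : G) : rel (id_vertex u v) :=
  fun a b => match a, b with
  | Some x, Some y => adj (val x) (val y)
  | Some x, None | None, Some x => adj u (val x) || adj v (val x)
  | None, None => false
  end.

Lemma id_adj_sym (G : sgraph) (u v : G) : symmetric (@id_adj G u v).
Proof. by move=> [x|] [y|] //=; rewrite adj_sym. Qed.

Lemma id_adj_irrefl (G : sgraph) (u v : G) : irreflexive (@id_adj G u v).
Proof. by move=> [x|] //=; rewrite adj_irrefl. Qed.

Definition identify (G : sgraph) (u v : G) : sgraph :=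
  SGraph (@id_adj_sym G u v) (@id_adj_irrefl G u v).

Inductive identifies_to (H : sgraph) : sgraph -> Prop :=
  | id_done (G : sgraph) : isomorphic G H -> identifies_to H G
  | id_step (G : sgraph) (u v : G) :
      u != v -> identifies_to H (identify u v) -> identifies_to H G.

Definition components (G : sgraph) : {set {set G}} :=
  equivalence_partition (connect (@adj G)) [set: G].

(* The subgraph induced by X is a path, whose successive vertices are the     *)
(* entries of p.                                                              *)
Definition induces_path (G : sgraph) (X : {set G}) : bool :=
  [exists p : #|X|.-tuple G, ([set x in p] == X) &&
    [forall i, forall j, adj (tnth p i) (tnth p j) ==
       ((i.+1 == j :> nat) || (j.+1 == i :> nat))]].

Definition linear_forest (G : sgraph) : bool :=
  [forall X in components G, induces_path X].

(* Graphs as input to algorithms: vertex set 'I_n and adjacency matrix.       *)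
Record ograph := OGraph {
  osize : nat;
  adjmx : 'M[bool]_osize;
  ograph_ok : [forall i, forall j, adjmx i j == adjmx j i] &&
              [forall i, ~~ adjmx i i] }.

Lemma ograph_sym (G : ograph) : symmetric (fun i j => adjmx G i j).
Proof.
by move=> i j; case/andP: (ograph_ok G) => /forallP/(_ i)/forallP/(_ j)/eqP.
Qed.

Lemma ograph_irrefl (G : ograph) : irreflexive (fun i j => adjmx G i j).
Proof.
by move=> i; case/andP: (ograph_ok G) => _ /forallP/(_ i)/negbTE.
Qed.

Coercion sgraph_of (G : ograph) : sgraph :=
  SGraph (@ograph_sym G) (@ograph_irrefl G).

Definition ograph_code (G : ograph) : seq nat :=
  osize G :: [seq nat_of_bool (adjmx G i j) |
                i <- enum 'I_(osize G), j <- enum 'I_(osize G)].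

Lemma ograph_code_cat (G H : ograph) (s t : seq nat) :
  ograph_code G ++ s = ograph_code H ++ t -> G = H /\ s = t.
Proof.
case: G H => [n A okA] [m B okB]; rewrite /ograph_code /= => -[eq_nm].
subst m => /eqP; rewrite eqseq_cat ?size_allpairs // => /andP[/eqP eqAB /eqP->].
split=> //.
have eqA : A = B.
  apply/matrixP=> i j.
  have szE (C : 'M[bool]_n) : [seq nat_of_bool (C i' j') | i' <- enum 'I_n,
      j' <- enum 'I_n] = [seq nat_of_bool (C ij.1 ij.2) | ij <-
        [seq (i', j') | i' <- enum 'I_n, j' <- enum 'I_n]].
    by rewrite map_allpairs.
  move: eqAB; rewrite !szE => /eq_in_map/(_ (i, j)).
  rewrite allpairs_f ?mem_enum //= => /(_ isT).
  by case: (A i j) (B i j) => [] [].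
by subst B; congr OGraph; apply: bool_irrelevance.
Qed.

Definition lf_instance : Type :=
  {GL : ograph * ograph | linear_forest GL.2}.

Definition lf_code (x : lf_instance) : seq bool :=
  bits_of (ograph_code (val x).1 ++ ograph_code (val x).2).

Lemma lf_code_inj : injective lf_code.
Proof.
move=> x y /bits_of_inj/ograph_code_cat[eqG eqL]; apply: val_inj.
have /ograph_code_cat[eqH _] :
  ograph_code (val x).2 ++ [::] = ograph_code (val y).2 ++ [::] by rewrite eqL.
by case: (val x) (val y) eqG eqH => [? ?] [? ?] /= -> ->.
Qed.

Definition Identification_linear_forest : pproblem :=
  @PProblem lf_instance lf_code lf_code_inj
    (fun x => #|components (val x).2|)
    (fun x => identifies_to (val x).2 (val x).1).

(* Main.v *)
(* Identifying G to a linear forest L means mapping G onto L so that every    *)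
(* edge is collapsed or sent to an edge and every edge of L is hit. If G too  *)
(* is a disjoint union of paths, this is bin covering: the components of G    *)
(* are items, those of L are bins, and sizes are numbers of edges. So it is   *)
(* enough to reduce weighted satisfiability of weft-1 circuits, in polynomial *)
(* time, to unary bin covering with a number of bins bounded in k.            *)
(*                                                                            *)
(* Let x_0 < ... < x_(k-1) be the true inputs and x_k = n. A weft-0 node of   *)
(* depth e is a polynomial of degree 2^e in the inputs, and the output is     *)
(* true iff T > F for two polynomials T and F of constant degree D: every     *)
(* node has a pair (T, F) one of whose members dwarfs the other, a negation   *)
(* swaps the pair, a conjunction of (T1, F1) and (T2, F2) is                  *)
(* (T1 T2, F1 T2 + T1 F2 + F1 F2), and a large gate sums its children. Hence  *)
(* T - F is the sum over J in {0..k}^D of a coefficient at the tuple x o J.   *)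
(*                                                                            *)
(* The packing instance has, for each J, an item for each candidate tuple,    *)
(* for each J and i < D an item for each candidate value of x_(J_i), and for  *)
(* each j an item for each candidate value of x_j. The bins, a bin U_J for    *)
(* each J, X_j for each j, and Z, have to be filled exactly in the high-order *)
(* digits of the sizes. Comparing weights, first and second moments in a bin, *)
(* this forces exactly one item of each group to be selected, with consistent *)
(* values; Z then holds the selected tuples, and its low-order requirement    *)
(* says that their coefficients sum to at least 1.                            *)
(*                                                                            *)
(* The reduction is computed by counter programs, where each register is the  *)
(* head position on a tape of its own; all numbers are polynomially bounded,  *)
(* so a class of functions closed under bounded recursion suffices. The       *)
(* program runs after the given Turing machine for A, on the latter's output. *)

From Stdlib Require Import FunctionalExtensionality.
From HB Require Import structures.
From mathcomp Require Import all_boot all_order all_algebra zify ring.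
Require Import Defs.

Set Implicit Arguments.
Unset Strict Implicit.
Unset Printing Implicit Defensive.

(** * Counter programs *)

(** Identified vertices may lie anywhere in the graph, so [G] can be turned into [H] exactly if some
    map of [G] onto [H] collapses edges or sends them to edges and hits every edge of [H]
    ([identifies_to_map], [map_identifies_to]). If both graphs are disjoint unions of paths, each
    path of [G] runs inside one component of [H]; conversely, paths whose total length suffices can
    be laid end to end along a component. This is bin covering ([identifies_cover],
    [cover_identifies]).

    In the packing instance the capacities are the loads of a reference filling. The high-order
    loads have the same total in every filling, so a covering has to reproduce them bin by bin and
    digit by digit. The digits record weights and first and second moments, and a vanishing weighted
    variance ([variance0]) makes labels and values constant. Every covering is therefore given by a
    point [x] ([exact_struct], [exact_hsel], [exact_tuple]), and what remains is one inequality on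
    the weights of the tuples [x o J] ([covers_iff]).

    These weights are the coefficients of a polynomial of constant degree that is positive at [x]
    exactly if the circuit accepts the inputs listed by [x] ([EV_tt], [TF_dominates], [EV_qf]). An
    offset makes tuples that contradict [x] being increasing with last value [n] too expensive
    ([thr_valid], [all_valid_inc]), so [x] stands for a choice of exactly [k] true inputs
    ([weights_iff]).

    The number of bins is [(k + 1) ^ D + k + 2] with [D] depending on the depth bound only, and all
    sizes are polynomial in the code of the circuit. [reduction_prog] writes both graphs in
    polynomial time, and [run_after] appends this computation to a given reduction. *)

Inductive test := TZero of nat | TBit | TEnd | TTrue.

Inductive prog :=
  | PSkip
  | PMove of nat & bool
  | PEmit of bool
  | PSeq of prog & prog
  | PIf of test & prog & prog
  | PUntil of test & prog.

Record store := Store { pos : nat -> nat; outp : seq bool }.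

Definition upd (s : store) (t v : nat) : store :=
  Store (fun i => if i == t then v else pos s i) (outp s).

(* Register 0 is the head position on the input tape: position 0 is the left  *)
(* end mark and position [i.+1] holds the i-th bit of the input [w].          *)
Definition holds (w : seq bool) (c : test) (s : store) : bool :=
  match c with
  | TZero t => pos s t == 0
  | TBit => (0 < pos s 0) && nth false w (pos s 0).-1
  | TEnd => size w < pos s 0
  | TTrue => true
  end.

Definition shift_pos (r : bool) (p : nat) : nat := if r then p.+1 else p.-1.

Inductive runs (w : seq bool) : prog -> store -> store -> nat -> Prop :=
  | RSkip s : runs w PSkip s s 0
  | RMove t r s : runs w (PMove t r) s (upd s t (shift_pos r (pos s t))) 1
  | REmit b s : runs w (PEmit b) s (Store (pos s) (rcons (outp s) b)) 1
  | RSeq p q s s1 s2 n m :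
      runs w p s s1 n -> runs w q s1 s2 m -> runs w (PSeq p q) s s2 (n + m)
  | RIfT c p q s s' n :
      holds w c s -> runs w p s s' n -> runs w (PIf c p q) s s' n.+1
  | RIfF c p q s s' n :
      ~~ holds w c s -> runs w q s s' n -> runs w (PIf c p q) s s' n.+2
  | RUntilT c p s : holds w c s -> runs w (PUntil c p) s s 1
  | RUntilF c p s s1 s2 n m :
      ~~ holds w c s -> runs w p s s1 n -> runs w (PUntil c p) s1 s2 m ->
      runs w (PUntil c p) s s2 (n + m).+2.

Inductive instr := IMove of nat & bool | IEmit of bool | IJump of test & nat.

(** Jump targets are absolute, [o] being the address of the first instruction. A conditional lists
    its else branch first and has to jump over the other one at its end, which is why [RIfF] costs
    one step more than [RIfT]. *)
Fixpoint compile (o : nat) (p : prog) : seq instr :=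
  match p with
  | PSkip => [::]
  | PMove t r => [:: IMove t r]
  | PEmit b => [:: IEmit b]
  | PSeq p q => let cp := compile o p in cp ++ compile (o + size cp) q
  | PIf c p q =>
      let cq := compile o.+1 q in
      let o1 := o.+1 + size cq + 1 in
      let cp := compile o1 p in
      IJump c o1 :: cq ++ IJump TTrue (o1 + size cp) :: cp
  | PUntil c p =>
      let cp := compile o.+1 p in
      IJump c (o.+2 + size cp) :: cp ++ [:: IJump TTrue o]
  end.

Definition istep (C : seq instr) (w : seq bool) (x : nat * store) :
    nat * store :=
  match nth (IJump TTrue x.1) C x.1 with
  | IMove t r => (x.1.+1, upd x.2 t (shift_pos r (pos x.2 t)))
  | IEmit b => (x.1.+1, Store (pos x.2) (rcons (outp x.2) b))
  | IJump c l => (if holds w c x.2 then l else x.1.+1, x.2)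
  end.

Inductive exec (C : seq instr) (w : seq bool) :
    nat -> nat * store -> nat * store -> Prop :=
  | Exec0 x : exec C w 0 x x
  | ExecS n x y :
      x.1 < size C -> exec C w n (istep C w x) y -> exec C w n.+1 x y.

Lemma exec_trans C w n m x y z :
  exec C w n x y -> exec C w m y z -> exec C w (n + m) x z.
Proof. by move=> xy yz; elim: xy yz => // {}n {}x {}y lt _ IH /IH; constructor. Qed.

Lemma exec1 C w x : x.1 < size C -> exec C w 1 x (istep C w x).
Proof. by move=> lt; constructor=> //; constructor. Qed.

(** Allowing arbitrary code before and after carries the induction to subprograms. The step counts
    agree exactly because [runs] charges for the jumps. *)
Lemma compile_exec w p s s' n : runs w p s s' n ->
  forall C o post pre, C = pre ++ compile o p ++ post -> o = size pre ->
  exec C w n (o, s) (o + size (compile o p), s').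
Proof.
elim=> {p s s' n} /=.
- by move=> s C o post pre _ _; rewrite addn0; constructor.
- move=> t r s C o post pre -> ->.
  suff -> : (size pre + 1, upd s t (shift_pos r (pos s t))) =
      istep (pre ++ (IMove t r :: post)) w (size pre, s).
    by apply: exec1; rewrite size_cat /=; lia.
  by rewrite /istep /= nth_cat ltnn subnn /= addn1.
- move=> b s C o post pre -> ->.
  suff -> : (size pre + 1, Store (pos s) (rcons (outp s) b)) =
      istep (pre ++ (IEmit b :: post)) w (size pre, s).
    by apply: exec1; rewrite size_cat /=; lia.
  by rewrite /istep /= nth_cat ltnn subnn /= addn1.
- move=> p q s s1 s2 n m _ IHp _ IHq C o post pre eC eo.
  rewrite size_cat addnA; apply: exec_trans.
    by apply: (IHp _ _ (compile (o + size (compile o p)) q ++ post) pre); rewrite // eC -!catA.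
  apply: (IHq _ _ post (pre ++ compile o p)).
    by rewrite eC !catA.
  by rewrite size_cat eo.
- move=> c p q s s' n hc _ IH C o post pre eC eo.
  set cq := compile o.+1 q in eC *; set o1 := o.+1 + size cq + 1 in eC *.
  set cp := compile o1 p in eC *.
  rewrite -add1n; apply: (@exec_trans _ _ _ _ _ (o1, s)).
    have -> : (o1, s) = istep C w (o, s).
      by rewrite /istep eC eo /= nth_cat ltnn subnn /= hc.
    by apply: exec1; rewrite eC !size_cat /= eo; lia.
  have -> : o + (size (cq ++ IJump TTrue (o1 + size cp) :: cp)).+1 = o1 + size cp.
    by rewrite size_cat /= /o1; lia.
  apply: (IH _ _ post (pre ++ IJump c o1 :: cq ++ [:: IJump TTrue (o1 + size cp)])).
    by rewrite eC -!catA /= -?catA.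
  by rewrite !size_cat /= size_cat /= /o1 eo; lia.
- move=> c p q s s' n hc _ IH C o post pre eC eo.
  set cq := compile o.+1 q in eC *; set o1 := o.+1 + size cq + 1 in eC *.
  set cp := compile o1 p in eC *.
  rewrite (_ : n.+2 = 1 + (n + 1)); last by lia.
  apply: (@exec_trans _ _ _ _ _ (o.+1, s)).
    have -> : (o.+1, s) = istep C w (o, s).
      by rewrite /istep eC eo /= nth_cat ltnn subnn /= (negbTE hc).
    by apply: exec1; rewrite eC !size_cat /= eo; lia.
  apply: (@exec_trans _ _ _ _ _ (o.+1 + size cq, s')).
    apply: (IH _ _ (IJump TTrue (o1 + size cp) :: cp ++ post) (rcons pre (IJump c o1))).
      by rewrite eC -cats1 -!catA /= -?catA.
    by rewrite size_rcons eo.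
  have -> : o + (size (cq ++ IJump TTrue (o1 + size cp) :: cp)).+1 = o1 + size cp.
    by rewrite size_cat /= /o1; lia.
  have -> : (o1 + size cp, s') = istep C w (o.+1 + size cq, s').
    rewrite /istep eC eo /= nth_cat ifF; last by lia.
    by rewrite -catA (_ : _ - _ = (size cq).+1) ?[nth _ _ _.+1]/= ?nth_cat ?ltnn ?subnn //; lia.
  apply: exec1; rewrite eC !size_cat /= ?size_cat /=; move: (size cq) (size cp) eo; clear; lia.
- move=> c p s hc C o post pre eC eo.
  have -> : (o + (size (compile o.+1 p ++ [:: IJump TTrue o])).+1, s) = istep C w (o, s).
    rewrite /istep eC eo /= nth_cat ltnn subnn /= hc size_cat /=; congr pair; lia.
  by apply: exec1; rewrite eC !size_cat /= eo; lia.
- move=> c p s s1 s2 n m hc _ IHp _ IHw C o post pre eC eo.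
  rewrite (_ : (n + m).+2 = 1 + (n + (1 + m))); last by lia.
  apply: (@exec_trans _ _ _ _ _ (o.+1, s)).
    have -> : (o.+1, s) = istep C w (o, s).
      by rewrite /istep eC eo /= nth_cat ltnn subnn /= (negbTE hc).
    by apply: exec1; rewrite eC !size_cat /= eo; lia.
  set cp := compile o.+1 p in IHp eC *.
  apply: (@exec_trans _ _ _ _ _ (o.+1 + size cp, s1)).
    apply: (IHp _ _ (IJump TTrue o :: post) (rcons pre (IJump c (o.+2 + size cp)))).
      by rewrite eC -cats1 -!catA /= -?catA.
    by rewrite size_rcons eo.
  apply: exec_trans (IHw C o post pre eC eo).
  have -> : (o, s1) = istep C w (o.+1 + size cp, s1).
    rewrite /istep eC eo /= nth_cat ifF; last by lia.
    by rewrite -catA (_ : _ - _ = (size cp).+1) ?[nth _ _ _.+1]/= ?nth_cat ?ltnn ?subnn //; lia.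
  apply: exec1; rewrite eC !size_cat /= ?size_cat /=; move: (size cp) eo; clear; lia.
Qed.

(** * Running a counter program on a Turing machine *)

(** Phases after the first machine has halted: copy its output word to register tape 0, rewind that
    tape, run the code, return to the start of the new output. *)
Inductive ctl (n : nat) := Copy | Rewind | Run of 'I_n | Back | Halt.

Definition ctl_enc n (c : ctl n) : option (option (option (option 'I_n))) :=
  match c with
  | Copy => None
  | Rewind => Some None
  | Back => Some (Some None)
  | Halt => Some (Some (Some None))
  | Run i => Some (Some (Some (Some i)))
  end.

Definition ctl_dec n (c : option (option (option (option 'I_n)))) : ctl n :=
  match c with
  | None => @Copy n
  | Some None => @Rewind n
  | Some (Some None) => @Back n
  | Some (Some (Some None)) => @Halt n
  | Some (Some (Some (Some i))) => Run i
  end.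

Lemma ctl_encK n : cancel (@ctl_enc n) (@ctl_dec n).
Proof. by case. Qed.

HB.instance Definition _ n := Equality.copy (ctl n) (can_type (@ctl_encK n)).
HB.instance Definition _ n := Choice.copy (ctl n) (can_type (@ctl_encK n)).
HB.instance Definition _ n := Countable.copy (ctl n) (can_type (@ctl_encK n)).
HB.instance Definition _ n := Finite.copy (ctl n) (can_type (@ctl_encK n)).

Definition map_tape (S T : Type) (f : S -> T) (t : tape S) : tape T :=
  Tape (map f (tleft t)) (f (tcur t)) (map f (tright t)).

Lemma map_move_tape (S T : Type) (f : S -> T) b d t :
  map_tape f (move_tape b d t) = move_tape (f b) d (map_tape f t).
Proof. by case: d t => -[[|x l] c [|y r]]. Qed.

Lemma write_keep (S : Type) (b : S) (t : tape S) :
  move_tape b MoveN (write_tape (tcur t) t) = t.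
Proof. by case: t. Qed.

(* [M], and then the code [C] with [R'.+1] registers; tape 0 of [M] is also   *)
(* the output tape, and each register is the head position on a tape of its   *)
(* own whose cell 0 carries a mark.                                           *)
Section Machine.
Variables (M : tm) (C : seq instr) (R' : nat).
Let R := R'.+1.
Let n1 := tm_tapes M.

Definition aux2 : finType := option (tm_aux M).
Local Notation sym := (option (bool + aux2)).
Definition mark : sym := Some (inr None).

Definition emb (s : option (bool + tm_aux M)) : sym :=
  match s with
  | None => None
  | Some (inl b) => Some (inl b)
  | Some (inr x) => Some (inr (Some x))
  end.

Definition proj (s : sym) : option (bool + tm_aux M) :=
  match s with
  | Some (inl b) => Some (inl b)
  | Some (inr (Some x)) => Some (inr x)
  | _ => None
  end.

Lemma embK : cancel emb proj.
Proof. by case=> [[]|]. Qed.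

Definition state2 : finType := (tm_state M + ctl (size C).+1)%type.

Definition testb (c : test) (ar : 'I_R -> sym) : bool :=
  match c with
  | TZero t => ar (inord t) == mark
  | TBit => ar ord0 == Some (inl true)
  | TEnd => ar ord0 == None
  | TTrue => true
  end.

(** The mark that ends [Copy] separates what [M] left on tape 0 from the output of the code; the
    blank written when the code ends cuts off older symbols to the right. A left move on a mark is
    suppressed, which gives the truncated predecessor in [shift_pos]. *)
Definition ctl_step (c : ctl (size C).+1) (a0 : sym)
    (ar : 'I_R -> sym) :
    ctl (size C).+1 * (sym * direction)
      * ('I_R -> sym * direction) :=
  let stay j := (ar j, MoveN) in
  match c with
  | Copy => if a0 is Some (inl b) then
              (@Copy _, (a0, MoveR),
               fun j => if j == ord0 then (a0, MoveR) else stay j)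
            else (@Rewind _, (mark, MoveR),
               fun j => (ar j, if j == ord0 then MoveL else MoveN))
  | Rewind => if ar ord0 == mark then (Run ord0, (a0, MoveN), stay)
              else (@Rewind _, (a0, MoveN),
               fun j => (ar j, if j == ord0 then MoveL else MoveN))
  | Run pc => if pc < size C then
      match nth (IEmit true) C pc with
      | IMove t r => (Run (inord pc.+1), (a0, MoveN),
          fun j => (ar j, if j == inord t then
                            if r then MoveR
                            else if ar j == mark then MoveN else MoveL
                          else MoveN))
      | IEmit b => (Run (inord pc.+1), (Some (inl b), MoveR), stay)
      | IJump c l =>
          (Run (inord (if testb c ar then l else pc.+1)), (a0, MoveN), stay)
      end
      else (@Back _, (None, MoveL), stay)
  | Back => if a0 == mark then (@Halt _, (a0, MoveR), stay)
            else (@Back _, (a0, MoveL), stay)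
  | Halt => (@Halt _, (a0, MoveN), stay)
  end.

Definition lsh (i : 'I_n1.+1) : 'I_(n1 + R).+1 := lshift R i.
Definition rsh (j : 'I_R) : 'I_(n1 + R).+1 := rshift n1.+1 j.

Definition trans2 (q : state2)
    (a : {ffun 'I_(n1 + R).+1 -> sym}) :
    state2 * {ffun 'I_(n1 + R).+1 -> sym * direction} :=
  match q with
  | inl q1 =>
      if tm_halt q1 then
        (inr (@Copy _), [ffun i => match split (i : 'I_(n1.+1 + R)) with
           | inl _ => (a i, MoveN)
           | inr j => (mark, if j == ord0 then MoveR else MoveN) end])
      else let: (q', act) := tm_trans q1 [ffun i => proj (a (lsh i))] in
        (inl q', [ffun i => match split (i : 'I_(n1.+1 + R)) with
           | inl j => (emb (act j).1, (act j).2)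
           | inr _ => (a i, MoveN) end])
  | inr c =>
      let: (c', f0, fr) := ctl_step c (a (lsh ord0))
                                      (fun j => a (rsh j)) in
      (inr c', [ffun i => match split (i : 'I_(n1.+1 + R)) with
           | inl j => if j == ord0 then f0 else (a i, MoveN)
           | inr j => fr j end])
  end.

Definition is_halt n (c : ctl n) : bool := if c is Halt then true else false.

Definition halt2 (q : state2) : bool :=
  if q is inr c then is_halt c else false.

Definition machine : tm :=
  @TM state2 aux2 (n1 + R) (inl (tm_start M)) halt2 trans2.

Definition T1 (c : config machine) (i : 'I_n1.+1) := c_tapes c (lsh i).
Definition Tr (c : config machine) (j : 'I_R) := c_tapes c (rsh j).

Lemma split_l (i : 'I_n1.+1) : split (lsh i : 'I_(n1.+1 + R)) = inl i.
Proof. exact: (unsplitK (inl i)). Qed.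

Lemma split_r (j : 'I_R) : split (rsh j : 'I_(n1.+1 + R)) = inr j.
Proof. exact: (unsplitK (inr j)). Qed.

Lemma step_run (c : config machine) x c' f0 fr :
  c_state c = inr x -> ~~ is_halt x ->
  ctl_step x (tcur (T1 c ord0)) (fun j => tcur (Tr c j)) = (c', f0, fr) ->
  [/\ c_state (tm_step c) = inr c',
      T1 (tm_step c) ord0 = move_tape None f0.2 (write_tape f0.1 (T1 c ord0))
    & forall j, Tr (tm_step c) j = move_tape None (fr j).2 (write_tape (fr j).1 (Tr c j))].
Proof.
move=> cx xh cs.
have -> : tm_step c = let: (q, act) := trans2 (inr x) [ffun i => tcur (c_tapes c i)] in
    @Config machine q [ffun i => move_tape None (act i).2
                        (write_tape (act i).1 (c_tapes c i))].
  by rewrite /tm_step cx /= (negbTE xh).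
rewrite /trans2 ffunE (_ : (fun j => _) = fun j => tcur (Tr c j)); last first.
  by apply: functional_extensionality => j; rewrite ffunE.
rewrite -/(T1 c ord0) cs; split=> //=.
  by rewrite /T1 /= !ffunE split_l eqxx.
by move=> j; rewrite /Tr /= !ffunE split_r.
Qed.

(** Comparing through [nth] with a blank default ignores trailing blanks. *)
Definition trep (w : seq (sym)) (t : tape (sym)) (p : nat) :=
  size (tleft t) = p /\
  forall i, nth None (rev (tleft t) ++ tcur t :: tright t) i = nth None (mark :: w) i.

Lemma trep_cur w t p : trep w t p -> tcur t = nth None (mark :: w) p.
Proof. by case=> sz /(_ p) <-; rewrite nth_cat size_rev sz ltnn subnn. Qed.

Lemma trep_right w t p : trep w t p ->
  trep w (move_tape None MoveR (write_tape (tcur t) t)) p.+1.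
Proof.
case: t => l c r [/= sz ec]; split=> /=; first by rewrite sz.
move=> i; rewrite -{}ec rev_cons -cats1 -catA /= !nth_cat.
case: ifP => // _; by case: (i - _) => [|[|j]] //=; case: r => [|y r] //=; rewrite ?nth_nil.
Qed.

Lemma trep_left w t p : 0 < p -> trep w t p ->
  trep w (move_tape None MoveL (write_tape (tcur t) t)) p.-1.
Proof.
case: t => [[|x l] c r] p0 [/= sz ec]; first by rewrite -sz in p0.
split=> /=; first by rewrite -sz.
by move=> i; rewrite -ec rev_cons -cats1 -catA.
Qed.

Definition bits (w : seq bool) : seq (sym) := [seq Some (inl b) | b <- w].

Lemma nth_bits w i : nth None (bits w) i = if i < size w then Some (inl (nth false w i)) else None.
Proof.
case: ltnP => h; first by rewrite (nth_map false).
by rewrite nth_default // size_map.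
Qed.

Lemma trep_write u b t : trep (bits u) t (size u).+1 ->
  trep (bits (rcons u b)) (move_tape None MoveR (write_tape (Some (inl b)) t)) (size u).+2.
Proof.
case: t => l cu r [/= sz ec]; split=> /=; first by rewrite sz.
have szu : size (mark :: bits u) = size (rev l) by rewrite size_rev sz /= size_map.
move=> i; rewrite rev_cons -cats1 -catA /= /bits map_rcons -cats1 -cat_cons.
rewrite !nth_cat -/(bits u) szu; have := ec i; rewrite nth_cat.
case: ltnP => lt //; rewrite (nth_default None (s := mark :: bits u)) ?szu //.
case: (i - _) => [|i'] //=; case: r {ec} => [|y r] /=; rewrite ?nth_nil //;
by case: i' => [|i'] //=; rewrite ?nth_nil.
Qed.

Lemma cur_mark w p : (nth None (mark :: bits w) p == mark) = (p == 0).
Proof. by case: p => [|p] //=; rewrite nth_bits; case: ifP. Qed.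

Lemma cur_bit w p :
  (nth None (mark :: bits w) p == Some (inl true)) = (0 < p) && nth false w p.-1.
Proof.
case: p => [|p] //=; rewrite nth_bits; case: ltnP => h; last by rewrite nth_default.
by case: (nth false w p).
Qed.

Lemma cur_end w p : (nth None (mark :: bits w) p == None) = (size w < p).
Proof. by case: p => [|p] //=; rewrite nth_bits ltnS; case: ltnP. Qed.

Definition regs_lt (i : instr) : bool :=
  match i with
  | IMove t _ | IJump (TZero t) _ => t < R
  | _ => true
  end.

Hypothesis C_regs : all regs_lt C.
Variable v : seq bool.

Definition cont (j : 'I_R) : seq bool := if j == ord0 then v else [::].

(** The head stands just after the output; the cells under it and to its right are arbitrary. *)
Definition out_rep (o : seq bool) (t : tape (sym)) :=
  exists junk, tleft t = rev (bits o) ++ mark :: junk.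

Definition regs_rep (s : store) (c : config machine) :=
  forall j : 'I_R, trep (bits (cont j)) (Tr c j) (pos s j).

Definition sim (x : nat * store) (c : config machine) :=
  [/\ x.1 <= size C, c_state c = inr (Run (inord x.1)),
      out_rep (outp x.2) (T1 c ord0) & regs_rep x.2 c].

Lemma testbE c t s :
  (if t is TZero r then r < R else true) -> regs_rep s c ->
  testb t (fun j => tcur (Tr c j)) = holds v t s.
Proof.
move=> tR rc; case: t tR => [t tR|_|_|_] //=; last 1 first.
- by rewrite (trep_cur (rc ord0)) /cont eqxx cur_end.
- by rewrite (trep_cur (rc (inord t))) cur_mark inordK.
by rewrite (trep_cur (rc ord0)) /cont eqxx cur_bit.
Qed.

Lemma sim_step x c : x.1 < size C -> (istep C v x).1 <= size C ->
  sim x c -> sim (istep C v x) (tm_step c).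
Proof.
case: x => pc s /= lt lt' [_ /= cs [junk orep] rrep].
have inK i : i <= size C -> (inord i : 'I_(size C).+1) = i :> nat by move=> h; rewrite inordK.
move: lt'; rewrite /istep /= (set_nth_default (IEmit true)) //.
have /(all_nthP (IEmit true))/(_ _ lt) := C_regs.
have := step_run cs isT; rewrite /= (inK _ (ltnW lt)) lt.
case: (nth (IEmit true) C pc) => [t r|b|tst l] /= => /(_ _ _ _ erefl) [cs' t0' tr'].
- move=> tR _; split=> //=.
  + by exists junk; rewrite t0' write_keep.
  + move=> j; rewrite tr' /=; case: ifP => [/eqP ->|jt].
      have h := rrep (inord t); rewrite inordK // in h.
      rewrite inordK // eqxx; case: r {cs' tr'} => /=; first exact: trep_right h.
      case: eqP => [e0|e0].
        have p0 : pos s t = 0.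
          by apply/eqP; rewrite -(cur_mark (cont (inord t))) -(trep_cur h) e0.
        by rewrite write_keep p0 /= -p0.
      apply: (trep_left _ h); rewrite lt0n -(cur_mark (cont (inord t))) -(trep_cur h).
      exact/eqP.
    rewrite write_keep ifF; first exact: rrep.
    by apply: contraFF jt => /eqP jt; apply/eqP/val_inj; rewrite /= inordK // -jt.
- move=> _ _; split=> //=; last by move=> j; rewrite tr' write_keep; apply: rrep.
  by exists junk; rewrite t0' /= orep /bits map_rcons rev_rcons.
move=> tR le; split=> //=; last by move=> j; rewrite tr' write_keep; apply: rrep.
  by rewrite cs'; congr (inr (Run (inord _))); rewrite (testbE _ rrep) //; case: (tst) tR.
by exists junk; rewrite t0' write_keep.
Qed.

Lemma exec_le n x y : y.1 <= size C -> exec C v n x y -> x.1 <= size C.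
Proof. by move=> le ex; case: ex le => // *; apply: ltnW. Qed.

Lemma sim_exec n x y c : y.1 <= size C -> exec C v n x y -> sim x c ->
  sim y (iter n (@tm_step machine) c).
Proof.
move=> le ex; elim: ex le c => // {}n {}x {}y lt ex IH le c sc.
rewrite iterSr; apply: IH => //; apply: sim_step => //.
exact: exec_le ex.
Qed.

(** Invariant: [u] is already on register tape 0, and [t0] is still to be read from tape 0. *)
Lemma copy_phase : forall u t0 (c : config machine), u ++ t0 = v ->
  c_state c = inr (@Copy _) ->
  read_bits (tcur (T1 c ord0) :: tright (T1 c ord0)) = t0 ->
  (forall j, if j == ord0 then trep (bits u) (Tr c j) (size u).+1 else trep [::] (Tr c j) 0) ->
  exists c', [/\ c' = iter (size t0).+1 (@tm_step machine) c,
    c_state c' = inr (@Rewind _), out_rep [::] (T1 c' ord0) &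
    forall j, trep (bits (cont j)) (Tr c' j) (if j == ord0 then size v else 0)].
Proof.
move=> u t0; elim: t0 u => [|b t0 IH] u c ev cs rd regs.
- rewrite cats0 in ev; subst u.
  have [cs' t0' tr'] : [/\ c_state (tm_step c) = inr (@Rewind _),
      T1 (tm_step c) ord0 = move_tape None MoveR (write_tape mark (T1 c ord0))
    & forall j, Tr (tm_step c) j = move_tape None (if j == ord0 then MoveL else MoveN)
                                     (write_tape (tcur (Tr c j)) (Tr c j))].
    have := step_run cs isT; move: rd; rewrite /=.
    by case: (tcur (T1 c ord0)) => [[b|y]|] //= _ /(_ _ _ _ erefl).
  exists (tm_step c); split=> //.
    by exists (tleft (T1 c ord0)); rewrite t0'.
  move=> j; rewrite tr' /=; have := regs j; rewrite /cont; case: eqP => _ //.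
    by move=> h; apply: (trep_left (p := (size v).+1)).
have [c1 [c1E cs1 rd1 regs1]] : exists c1, [/\ c1 = tm_step c, c_state c1 = inr (@Copy _),
    read_bits (tcur (T1 c1 ord0) :: tright (T1 c1 ord0)) = t0 &
    forall j, if j == ord0 then trep (bits (rcons u b)) (Tr c1 j) (size (rcons u b)).+1 else trep [::] (Tr c1 j) 0].
  have := step_run cs isT; move: rd; rewrite /=.
  case ea0: (tcur (T1 c ord0)) => [[b'|]|] //= [<- rd] /(_ _ _ _ erefl) [cs' t0' tr'].
  exists (tm_step c); split=> //.
    rewrite t0' /=; move: rd {ea0 t0'}; case: (tright _) => [|x r] //= <-.
  move=> j; rewrite tr' /=; have := regs j; case: eqP => // _.
    by rewrite size_rcons; apply: trep_write.
case: (IH (rcons u b) c1 _ cs1 rd1 regs1); first by rewrite cat_rcons.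
by move=> c' [-> ? ? ?]; exists (iter (size t0).+1 (@tm_step machine) c1); split=> //; rewrite c1E -iterSr.
Qed.

Lemma rewind_phase : forall p (c : config machine), c_state c = inr (@Rewind _) ->
  out_rep [::] (T1 c ord0) ->
  (forall j, trep (bits (cont j)) (Tr c j) (if j == ord0 then p else 0)) ->
  sim (0, Store (fun=> 0) [::]) (iter p.+1 (@tm_step machine) c).
Proof.
elim=> [|p IH] c cs orep regs.
  have := step_run cs isT; rewrite /= (trep_cur (regs ord0)) /=.
  move=> /(_ _ _ _ erefl) [cs' t0' tr']; split=> //=.
  - by rewrite cs'; congr (inr (Run _)); apply/val_inj; rewrite /= inordK.
  - by rewrite t0' write_keep.
  by move=> j; rewrite tr' write_keep; have := regs j; case: ifP.
rewrite iterSr; have := step_run cs isT.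
rewrite /= (trep_cur (regs ord0)) /cont eqxx cur_mark /=.
move=> /(_ _ _ _ erefl) [cs' t0' tr']; apply: IH => //.
  by rewrite t0' write_keep.
move=> j; rewrite tr' /=; have := regs j; case: ifP => _; last by rewrite write_keep.
by move=> h; apply: (trep_left (p := p.+1)).
Qed.

(** The head walks left over the output, so the induction takes letters from the right end of [l]
    and hands them to [r]. *)
Lemma back_phase : forall l r z (c : config machine) junk, c_state c = inr (@Back _) ->
  tcur (T1 c ord0) :: tleft (T1 c ord0) = rev (bits l) ++ mark :: junk ->
  tright (T1 c ord0) = bits r ++ None :: z ->
  let c' := iter (size l).+1 (@tm_step machine) c in
  tm_halt (c_state c') /\ tm_output c' = l ++ r.
Proof.
apply: last_ind => [|l b IH] r z c junk cs tl tr /=.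
  case: tl => cur lft; have := step_run cs isT; rewrite /= cur eqxx.
  move=> /(_ _ _ _ erefl) [cs' t0' _]; split; first by rewrite cs' /=.
  rewrite /tm_output (_ : c_tapes _ _ = T1 (tm_step c) ord0); last first.
    by rewrite /T1; congr (c_tapes _ _); apply: val_inj.
  rewrite t0' /= tr; case: r {tr} => [|b r] //=; congr cons.
  by elim: r => //= a r ->.
rewrite size_rcons iterSr.
have := step_run cs isT; move: tl; rewrite /bits map_rcons rev_rcons /=.
case=> cur lft; rewrite cur /= => /(_ _ _ _ erefl) [cs' t0' _].
rewrite cat_rcons; apply: (IH _ z _ junk) => //; rewrite t0' /= ?tr // lft.
by rewrite -/(bits l); case: (rev (bits l)).
Qed.

Definition sim1 (c1 : config M) (c : config machine) :=
  [/\ c_state c = inl (c_state c1),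
      forall i, T1 c i = map_tape emb (c_tapes c1 i)
    & forall j, Tr c j = Tape [::] None [::]].

Lemma sim1_init w : sim1 (tm_init M w) (tm_init machine w).
Proof.
split=> //= [i|j]; rewrite /T1 /Tr !ffunE.
  rewrite (_ : (lsh i == ord0) = (i == ord0)); last first.
    by apply/eqP/eqP => [/(congr1 val) /= h|->]; apply: val_inj.
  by case: ifP => _ //; case: w => [|b w] //; rewrite /map_tape /= -map_comp.
by rewrite (_ : (rsh j == ord0) = false).
Qed.

Lemma sim1_step c1 c : ~~ tm_halt (c_state c1) -> sim1 c1 c ->
  sim1 (tm_step c1) (tm_step c).
Proof.
move=> nh [cs t1 tr].
have eA : [ffun i => proj ([ffun i => tcur (c_tapes c i)] (lsh i))] =
    [ffun i => tcur (c_tapes c1 i)].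
  by apply/ffunP => i; rewrite !ffunE -/(T1 c i) t1 /= embK.
rewrite /tm_step cs /= (negbTE nh) eA.
case: (tm_trans _ _) => q act; split=> //= [i|j]; rewrite /T1 /Tr /= !ffunE.
  by rewrite split_l -/(T1 c i) t1 map_move_tape.
by rewrite split_r -/(Tr c j) write_keep.
Qed.

Lemma halted_iter (N : tm) (c : config N) n : tm_halt (c_state c) ->
  iter n (@tm_step N) c = c.
Proof. by move=> h; elim: n => //= n ->; rewrite /tm_step h. Qed.

(** The new machine leaves the simulation once [M] has halted, possibly before step [n]; hence only
    [m <= n]. *)
Lemma sim1_iter n c1 c : sim1 c1 c ->
  tm_halt (c_state (iter n (@tm_step M) c1)) ->
  exists2 m, m <= n & sim1 (iter n (@tm_step M) c1) (iter m (@tm_step machine) c).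
Proof.
elim: n c1 c => [|n IH] c1 c s1 hl; first by exists 0.
case hc: (tm_halt (c_state c1)).
  by exists 0 => //; rewrite (halted_iter _ hc).
rewrite iterSr in hl *; case: (IH _ _ (sim1_step (negbT hc) s1) hl) => m le sm.
by exists m.+1; rewrite ?iterSr.
Qed.

Lemma sim1_halt c1 c : sim1 c1 c -> tm_halt (c_state c1) ->
  [/\ c_state (tm_step c) = inr (@Copy _),
      T1 (tm_step c) ord0 = map_tape emb (c_tapes c1 ord0) &
      forall j, if j == ord0 then trep (bits [::]) (Tr (tm_step c) j) 1
                else trep [::] (Tr (tm_step c) j) 0].
Proof.
move=> [cs t1 tr] hl; rewrite /tm_step cs /= hl; split=> //=.
  by rewrite /T1 /= !ffunE split_l -/(T1 c ord0) write_keep t1.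
move=> j; rewrite /Tr /= !ffunE split_r -/(Tr c j) tr /=.
by case: (j == ord0); split=> // -[|[|i]] //=; rewrite ?nth_nil.
Qed.

Lemma read_bits_emb s : read_bits (map emb s) = read_bits s.
Proof. by elim: s => [|[[b|x]|] s IH] //=; rewrite IH. Qed.

Lemma machine_computes w n m s : computes_within M w v n ->
  exec C v m (0, Store (fun=> 0) [::]) (size C, s) ->
  computes_within machine w (outp s) (n + 2 * size v + m + size (outp s) + 5).
Proof.
move=> [hl out] ex.
have [n' len s1] := sim1_iter (sim1_init w) hl.
set c1 := iter n _ _ in hl out s1; set c2 := iter n' _ _ in s1.
have [cs3 t3 r3] := sim1_halt s1 hl.
have rd : read_bits (tcur (T1 (tm_step c2) ord0) :: tright (T1 (tm_step c2) ord0)) = v.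
  by rewrite t3 -out /tm_output -[RHS]read_bits_emb.
have [c4 [c4E cs4 o4 r4]] := copy_phase (u := [::]) (t0 := v) erefl cs3 rd r3.
have s5 := @sim_exec m (0, Store (fun=> 0) [::]) (size C, s) _ (leqnn (size C)) ex (rewind_phase cs4 o4 r4).
set c5 := iter m _ _ in s5; case: s5 => _ cs5 [junk o5] _.
have := step_run cs5 isT; rewrite /= inordK // ltnn.
move=> /(_ _ _ _ erefl) [cs6 t6 _].
have [|||hl7 out7] := @back_phase (outp s) [::] (tright (T1 c5 ord0)) (tm_step c5) junk.
- by [].
- by rewrite t6 /= o5 /bits; case: (rev _).
- by rewrite t6.
rewrite cats0 in out7.
set c7 := iter _ _ _ in hl7 out7.
(* Read from the inside: [M], the switch to [Copy], copying, rewinding, the code, the closing blank,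
   the walk back. The other [n - n'] steps are spent halted. *)
pose k := (size (outp s)).+1 + (1 + (m + ((size v).+1 + ((size v).+1 + (1 + n'))))).
have ec7 : c7 = iter k (@tm_step machine) (tm_init machine w).
  by rewrite /k !iterD -[iter n' _ _]/c2 -[iter 1 _ c2]/(tm_step c2) -c4E.
have ek : n + 2 * size v + m + size (outp s) + 5 = (n - n') + k by rewrite /k; lia.
by split; rewrite ek iterD -ec7 halted_iter.
Qed.

End Machine.

Definition instr_reg (i : instr) : nat :=
  match i with IMove t _ | IJump (TZero t) _ => t | _ => 0 end.

Lemma run_after (M : tm) (p : prog) : exists M' : tm, forall w v n m s,
  computes_within M w v n -> runs v p (Store (fun=> 0) [::]) s m ->
  computes_within M' w (outp s) (n + 2 * size v + m + size (outp s) + 5).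
Proof.
exists (machine M (compile 0 p) (\max_(i <- compile 0 p) instr_reg i)).
move=> w v n m s cM rp; apply: machine_computes => //; last first.
  have := compile_exec rp (C := compile 0 p) (o := 0) (post := [::]) (pre := [::]).
  by rewrite cats0; apply.
elim: (compile 0 p) => //= i c IH; rewrite big_cons; apply/andP; split.
  by case: i => [t r|b|[t|||] l] //=; rewrite ltnS leq_maxl.
by apply: sub_all IH => -[t r|b|[t|||] l] //= /leq_trans -> //; rewrite ltnS leq_maxr.
Qed.

Lemma computes_within_mono (M : tm) w v n m :
  n <= m -> computes_within M w v n -> computes_within M w v m.
Proof. by move=> le [h o]; rewrite /computes_within -(subnK le) iterD halted_iter. Qed.

(** Each step lengthens the stored right part of tape 0 by at most one cell. *)
Lemma output_size (M : tm) w v n : computes_within M w v n -> size v <= size w + n + 1.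
Proof.
case=> _ <-; rewrite /tm_output.
have rb (X : Type) (s : seq (option (bool + X))) : size (read_bits s) <= size s.
  by elim: s => [|[[b|x]|] s IH].
apply: leq_trans (rb _ _) _ => /=.
elim: n => [|n IH] /=.
  by rewrite ffunE /= size_behead size_map; lia.
have tr (c : config M) : size (tright (c_tapes (tm_step c) ord0)) <= (size (tright (c_tapes c ord0))).+1.
  rewrite /tm_step; case: ifP => _ //; case: (tm_trans _ _) => q act /=.
  rewrite ffunE; case: (act ord0).2 => //=; rewrite size_behead.
  by apply: leq_trans (leq_pred _) _.
by move: (tr (iter n (@tm_step M) (tm_init M w))) IH; rewrite /=; move: (size _) (size _) (size _) => a b c; clear; lia.
Qed.

(** * Polynomial-time functions *)

(** The summand 2 lets sums and constants be absorbed into a larger exponent. *)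
Definition mz (w : seq bool) (e : seq nat) : nat := 2 + size w + sumn e.

Definition pbd (h : seq bool -> seq nat -> nat) : Prop :=
  exists c, forall w e, h w e <= mz w e ^ c.

Lemma mz_gt1 w e : 1 < mz w e. Proof. by []. Qed.

Lemma leq_exp m n c : m <= n -> m ^ c <= n ^ c.
Proof. by case: c => [|c] // le; rewrite leq_exp2r. Qed.

Lemma mz_exp_mono w e a b : a <= b -> mz w e ^ a <= mz w e ^ b.
Proof. by move=> ab; rewrite leq_exp2l. Qed.

Lemma pbd_le h h' : pbd h' -> (forall w e, h w e <= h' w e) -> pbd h.
Proof. by move=> [c hc] le; exists c => w e; apply: leq_trans (le w e) (hc w e). Qed.

Lemma pbd_const n : pbd (fun _ _ => n).
Proof. by exists n => w e; apply: ltnW; apply: ltn_expl. Qed.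

Lemma pbd_mz : pbd mz. Proof. by exists 1 => w e; rewrite expn1. Qed.

Lemma pbd_mul g h : pbd g -> pbd h -> pbd (fun w e => g w e * h w e).
Proof. by move=> [a ga] [b hb]; exists (a + b) => w e; rewrite expnD leq_mul. Qed.

Lemma pbd_exp g c : pbd g -> pbd (fun w e => g w e ^ c).
Proof. by move=> [a ga]; exists (a * c) => w e; rewrite expnM; apply: leq_exp. Qed.

Lemma pbd_add g h : pbd g -> pbd h -> pbd (fun w e => g w e + h w e).
Proof.
move=> [a ga] [b hb]; exists (maxn a b).+1 => w e.
apply: leq_trans (leq_add (ga w e) (hb w e)) _.
rewrite expnS; apply: leq_trans (_ : 2 * mz w e ^ maxn a b <= _).
  by rewrite mul2n -addnn leq_add // mz_exp_mono // ?leq_maxl ?leq_maxr.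
by rewrite leq_mul2r mz_gt1 orbT.
Qed.

Ltac pb := repeat first [exact: pbd_mz | exact: pbd_const | eassumption
  | apply: pbd_add | apply: pbd_mul | apply: pbd_exp].

(* Domination under every extension of the environment whose total is at      *)
(* most [k].                                                                  *)
Lemma pbd_ext h k : pbd h -> pbd k -> exists2 h', pbd h' &
  forall w e e', sumn e' <= k w e -> h w e' <= h' w e.
Proof.
move=> [c hc] pk; exists (fun w e => (mz w e + k w e) ^ c).
  by apply: pbd_exp; apply: pbd_add pk; apply: pbd_mz.
move=> w e e' le; apply: leq_trans (hc w _) _; apply: leq_exp.
by rewrite /mz; lia.
Qed.

(** * Elementary counter programs *)

Lemma store_ext s s' : pos s =1 pos s' -> outp s = outp s' -> s = s'.
Proof.
by case: s s' => [p o] [p' o'] /= ep ->; congr Store; apply: functional_extensionality.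
Qed.

Definition wrun w p s s' h := exists2 n, n <= h & runs w p s s' n.

Lemma wrun_le w p s s' h h' : h <= h' -> wrun w p s s' h -> wrun w p s s' h'.
Proof. by move=> le [n nh r]; exists n => //; apply: leq_trans le. Qed.

Lemma wrun_seq w p q s s1 s2 h h' :
  wrun w p s s1 h -> wrun w q s1 s2 h' -> wrun w (PSeq p q) s s2 (h + h').
Proof.
by move=> [n nh r] [m mh r']; exists (n + m); rewrite ?leq_add //; apply: RSeq r r'.
Qed.

Lemma wrun_move w t r s : wrun w (PMove t r) s (upd s t (shift_pos r (pos s t))) 1.
Proof. by exists 1 => //; constructor. Qed.

Lemma wrun_until w c p (S : nat -> store) N h :
  (forall i, i < N -> ~~ holds w c (S i) /\ wrun w p (S i) (S i.+1) h) ->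
  holds w c (S N) -> wrun w (PUntil c p) (S 0) (S N) (N * h.+2 + 1).
Proof.
elim: N S => [|N IH] S st fin; first by exists 1 => //; constructor.
have [i lt|//|m mh rm] := IH (fun i => S i.+1).
  by apply: st.
have [nh [n nle rn]] := st 0 isT.
by exists (n + m).+2; [rewrite mulSn; lia | apply: RUntilF rn rm].
Qed.

Ltac steq := apply: store_ext => //= ?; repeat (case: eqP => //= ?); try lia.

Definition clear t := PUntil (TZero t) (PMove t false).

Lemma wrun_clear w t s : wrun w (clear t) s (upd s t 0) (pos s t * 3 + 1).
Proof.
have := @wrun_until w (TZero t) (PMove t false) (fun i => upd s t (pos s t - i)) (pos s t) 1.
rewrite subn0 subnn (_ : upd s t (pos s t) = s); last by steq; congr pos.
apply=> /= [i lt|]; rewrite ?eqxx //; split; first lia.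
rewrite (_ : upd s t (pos s t - i.+1) = upd (upd s t (pos s t - i)) t (shift_pos false (pos (upd s t (pos s t - i)) t))).
  exact: wrun_move.
by steq; rewrite eqxx; lia.
Qed.

Definition transfer a b := PUntil (TZero a) (PSeq (PMove a false) (PMove b true)).

Lemma wrun_transfer w a b s : a != b ->
  wrun w (transfer a b) s (upd (upd s a 0) b (pos s b + pos s a)) (pos s a * 4 + 1).
Proof.
move=> nab; have /eqP ab := nab; have {}nab := negbTE nab.
pose S i := upd (upd s a (pos s a - i)) b (pos s b + i).
have := @wrun_until w (TZero a) (PSeq (PMove a false) (PMove b true)) S (pos s a) 2.
have -> : S (pos s a) = upd (upd s a 0) b (pos s b + pos s a) by rewrite /S subnn.
rewrite (_ : S 0 = s); last by rewrite /S; steq; subst; lia.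
apply=> /= [i lt|]; rewrite /S /= nab eqxx ?subnn //.
split; first by lia.
apply: wrun_le (wrun_seq (wrun_move _ _ _ _) (_ : wrun _ _ _ _ 1)) => //.
set s1 := upd _ a _; rewrite (_ : upd _ b _ = upd s1 b (shift_pos true (pos s1 b))).
  exact: wrun_move.
by rewrite /s1; steq; subst; rewrite ?eqxx //=; do ?case: eqP => // ?; lia.
Qed.

Definition assign a b := PSeq (clear b) (transfer a b).

Lemma wrun_assign w a b s : a != b ->
  wrun w (assign a b) s (upd (upd s a 0) b (pos s a)) (pos s b * 3 + pos s a * 4 + 2).
Proof.
move=> ab; have := wrun_seq (wrun_clear w b s) (wrun_transfer w (upd s b 0) ab).
rewrite /= eqxx (negbTE ab) => h.
apply: wrun_le (_ : _ <= _) _; last first.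
  rewrite (_ : upd (upd s a 0) b _ = upd (upd (upd s b 0) a 0) b (0 + pos s a)); first exact: h.
  by steq.
by lia.
Qed.

Definition ready (rho : seq nat) (d : nat) (s : store) : Prop :=
  [/\ 0 < d, all (fun r => 0 < r < d) rho, pos s 0 = 0
    & forall i, d <= i -> pos s i = 0].

(** Arguments sit in the registers [rho], below [d]; registers from [d] on are empty scratch space.
    A call changes nothing but register [d], which receives the result, so calls can be nested. *)
Definition realizes (P : seq nat -> nat -> prog) (h f : seq bool -> seq nat -> nat) :=
  forall w rho d s, ready rho d s ->
    let e := map (pos s) rho in wrun w (P rho d) s (upd s d (f w e)) (h w e).

Definition polyf (f : seq bool -> seq nat -> nat) : Prop :=
  exists P h, pbd h /\ realizes P h f.

Lemma polyf_ext f g : polyf f -> (forall w e, f w e = g w e) -> polyf g.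
Proof.
move=> [P [h [ph re]]] fg; exists P, h; split=> // w rho d s r e.
by rewrite -fg; apply: re.
Qed.

Lemma runs_pos w p s s' n : runs w p s s' n -> forall i, pos s' i <= pos s i + n.
Proof.
elim=> {p s s' n} /=.
- by move=> s i; rewrite addn0.
- by move=> t r s i; rewrite /shift_pos; case: eqP => [->|_]; case: r; lia.
- by move=> b s i; rewrite leq_addr.
- by move=> p q s s1 s2 n m _ IH1 _ IH2 i; have := IH1 i; have := IH2 i; lia.
- by move=> c p q s s' n _ _ IH i; have := IH i; lia.
- by move=> c p q s s' n _ _ IH i; have := IH i; lia.
- by move=> c p s _ i; lia.
- by move=> c p s s1 s2 n m _ _ IH1 _ IH2 i; have := IH1 i; have := IH2 i; lia.
Qed.

(** A register grows by at most one per step, so a value computed in an empty register is at most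
    the running time. *)
Lemma polyf_pbd f : polyf f -> pbd f.
Proof.
move=> [P [h [ph re]]]; apply: pbd_le ph _ => w e.
pose s := Store (fun i => if i is i'.+1 then nth 0 e i' else 0) [::].
pose rho := iota 1 (size e).
have es : map (pos s) rho = e.
  rewrite /rho (iotaDl 1 0) -map_comp -[RHS](mkseq_nth 0) /mkseq.
  exact: eq_map.
have r : ready rho (size e).+1 s.
  split=> //.
    by apply/allP=> i; rewrite mem_iota; lia.
  by case=> // i; rewrite ltnS => le; rewrite /= nth_default.
have [n nh /runs_pos/(_ (size e).+1)] := re w rho _ s r.
rewrite es /= eqxx nth_default // => le; move: nh; rewrite es.
exact: leq_trans le.
Qed.

Lemma all_ltW rho d d' : d <= d' -> all (fun r => 0 < r < d) rho ->
  all (fun r => 0 < r < d') rho.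
Proof. by move=> le; apply: sub_all => i; lia. Qed.

Lemma map_upd rho d t v s : all (fun r => 0 < r < d) rho -> d <= t ->
  map (pos (upd s t v)) rho = map (pos s) rho.
Proof.
move=> /allP al le; apply/eq_in_map => i /al /= lt.
by case: eqP => // ?; lia.
Qed.

Lemma all_behead k (T : Type) (a : pred T) s : all a s -> all a (iter k behead s).
Proof. by move=> h; elim: k => //= k; case: (iter _ _ _) => //= x l /andP[]. Qed.

Lemma map_behead k (S T : Type) (f : S -> T) s :
  map f (iter k behead s) = iter k behead (map f s).
Proof. by elim: k => //= k; case: (iter k behead s) => [|x l] /= <-. Qed.

Lemma sumn_behead k s : sumn (iter k behead s) <= sumn s.
Proof.
elim: k => //= k; apply: leq_trans.
by case: (iter k behead s) => //= x l; apply: leq_addl.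
Qed.

Lemma polyf_wk k f : polyf f -> polyf (fun w e => f w (iter k behead e)).
Proof.
move=> [P [h [ph re]]].
have [h' ph' hh'] := pbd_ext ph pbd_mz.
exists (fun rho d => P (iter k behead rho) d), h'; split=> //.
move=> w rho d s [d0 al p0 z]; rewrite /= -map_behead.
apply: wrun_le (re w _ d s _); last by split=> //; apply: all_behead.
by apply: hh'; rewrite map_behead; apply: leq_trans (sumn_behead _ _) _; rewrite /mz; lia.
Qed.

(** The value of [g] stays in register [d] and becomes the first argument of [f], whose scratch
    space starts at [d.+1]. *)
Lemma polyf_let k f g : polyf f -> polyf g ->
  polyf (fun w e => f w (g w e :: iter k behead e)).
Proof.
move=> pf pg; have pbf := polyf_pbd pf; have pbg := polyf_pbd pg.
case: pf pg => [Pf [hf [phf rf]]] [Pg [hg [phg rg]]].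
have pk := pbd_add pbd_mz pbg.
have [hf' phf' hhf] := pbd_ext phf pk; have [bf' pbf' bbf] := pbd_ext pbf pk.
exists (fun rho d => PSeq (Pg rho d) (PSeq (Pf (d :: iter k behead rho) d.+1) (assign d.+1 d))).
exists (fun w e => hg w e + (hf' w e + (g w e * 3 + bf' w e * 4 + 2))); split.
  by pb.
move=> w rho d s [d0 al p0 z] /=.
set e := map _ _; set gv := g w e.
have le : sumn (gv :: iter k behead e) <= mz w e + g w e.
  by rewrite /= /mz -/gv; have := sumn_behead k e; lia.
apply: wrun_seq (rg _ _ _ _ _) _; first by split.
set s1 := upd s d gv.
have r1 : ready (d :: iter k behead rho) d.+1 s1.
  split=> //=; first by rewrite ltnSn d0 /=; apply: all_behead; apply: all_ltW al.
    by case: eqP => // ?; lia.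
  by move=> i lt; case: eqP => [?|_]; [lia | apply: z; lia].
have e1 : map (pos s1) (d :: iter k behead rho) = gv :: iter k behead e.
  by rewrite map_cons /= eqxx map_behead (map_upd _ _ al).
have := rf w _ _ _ r1; rewrite e1 => run2.
apply: wrun_seq (wrun_le _ run2) _; first exact: hhf.
have dd : d.+1 != d by lia.
have := wrun_assign w (upd s1 d.+1 (f w (gv :: iter k behead e))) dd.
rewrite /= !eqxx (negbTE (_ : d != d.+1)) ?eqxx; last by lia.
set fv := f _ _ => run3.
rewrite (_ : upd s d fv = upd (upd (upd s1 d.+1 fv) d.+1 0) d fv); last first.
  by rewrite /s1; steq; subst; apply: z; lia.
apply: wrun_le run3.
by have := bbf w e _ le; rewrite -/fv; lia.
Qed.

Lemma polyf_zero : polyf (fun _ _ => 0).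
Proof.
exists (fun _ _ => PSkip), (fun _ _ => 0); split; first exact: pbd_const.
move=> w rho d s [_ _ _ z] /=; exists 0 => //.
rewrite (_ : upd s d 0 = s); first by constructor.
by steq; subst; rewrite z.
Qed.

Lemma polyf_succ f : polyf f -> polyf (fun w e => (f w e).+1).
Proof.
move=> [P [h [ph re]]].
exists (fun rho d => PSeq (P rho d) (PMove d true)), (fun w e => h w e + 1); split.
  by apply: pbd_add (pbd_const 1).
move=> w rho d s r /=; apply: wrun_seq (re _ _ _ _ r) _.
set s1 := upd s d _.
rewrite (_ : upd s d _ = upd s1 d (shift_pos true (pos s1 d))); first exact: wrun_move.
by rewrite /s1; steq; rewrite eqxx.
Qed.

Lemma polyf_const n : polyf (fun _ _ => n).
Proof. by elim: n => [|n IH]; [apply: polyf_zero | apply: polyf_succ]. Qed.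

(** Reading a register empties it, so it is poured into [d] and [d.+1] simultaneously and restored
    from [d.+1]. *)
Lemma polyf_v0 : polyf (fun _ e => head 0 e).
Proof.
exists (fun rho d => if rho is r :: _ then
  PSeq (PUntil (TZero r) (PSeq (PMove r false) (PSeq (PMove d true) (PMove d.+1 true))))
       (transfer d.+1 r) else PSkip).
exists (fun w e => mz w e * 9 + 2); split.
  by pb.
move=> w [|r rho] d s [d0 al p0 z] /=.
  exists 0; first lia.
  rewrite (_ : upd s d 0 = s); first by constructor.
  by steq; subst; rewrite z.
have /andP[/andP[r0 rd] _] := al.
have n1 : (r == d.+1) = false by lia.
have n2 : (r == d) = false by lia.
have zd := z d (leqnn _); have zd1 := z d.+1 (leqnSn _).
pose S i := upd (upd (upd s r (pos s r - i)) d i) d.+1 i.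
have S0 : S 0 = s by rewrite /S; steq; subst; rewrite ?subn0.
have L : wrun w (PUntil (TZero r) (PSeq (PMove r false) (PSeq (PMove d true) (PMove d.+1 true)))) s (S (pos s r)) (pos s r * 5 + 1).
  rewrite -{1}S0; apply: wrun_until => [i lt|]; rewrite /S /=; last first.
    by rewrite n1 n2 eqxx subnn.
  rewrite n1 n2 eqxx; split; first by lia.
  apply: (wrun_le (h := 1 + (1 + 1))) => //.
  apply: wrun_seq (wrun_move _ _ _ _) (wrun_seq (wrun_move _ _ _ _) _).
  set s1 := upd (upd _ r _) d _.
  set s2 := (X in wrun _ _ _ X _).
  rewrite (_ : s2 = upd s1 d.+1 (shift_pos true (pos s1 d.+1))); first exact: wrun_move.
  by rewrite /s1 /s2; steq; subst; rewrite ?eqxx /=; do ?[case: eqP => // ?]; lia.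
apply: wrun_le (wrun_seq L (_ : wrun _ _ _ _ (pos s r * 4 + 1))).
  by rewrite /mz /=; lia.
have nr : d.+1 != r by lia.
have := wrun_transfer w (S (pos s r)) nr.
rewrite /S /= eqxx n1 n2 eqxx.
rewrite subnn add0n; set s2 := (X in wrun _ _ _ X _).
suff -> : s2 = upd s d (pos s r) by [].
by rewrite /s2; clear S0 L; steq; subst=> //; lia.
Qed.

(** Bounded recursion: the bound [B] on the intermediate values keeps the running time polynomial.
    Registers [d] to [d.+3] hold the rounds left, the round index, the accumulator and its next
    value. *)
Lemma polyf_iteri N Z (S : seq bool -> seq nat -> nat -> nat -> nat) B :
  polyf N -> polyf Z ->
  polyf (fun w e => S w (behead (behead e)) (head 0 e) (head 0 (behead e))) ->
  pbd B -> (forall w e i, i <= N w e -> iteri i (S w e) (Z w e) <= B w e) ->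
  polyf (fun w e => iteri (N w e) (S w e) (Z w e)).
Proof.
move=> pN pZ pS pB leB.
have bN := polyf_pbd pN.
case: pN pZ pS => [PN [hN [phN rN]]] [PZ [hZ [phZ rZ]]] [PS [hS [phS rS]]].
have [hS' phS' hhS] := pbd_ext phS (pbd_add pbd_mz (pbd_add bN pB)).
pose body rho d := PSeq (PMove d false) (PSeq (PS [:: d.+1, d.+2 & rho] d.+3)
   (PSeq (assign d.+3 d.+2) (PMove d.+1 true))).
exists (fun rho d => PSeq (PN rho d) (PSeq (PZ rho d.+2) (PSeq
   (PUntil (TZero d) (body rho d)) (PSeq (clear d.+1) (transfer d.+2 d))))).
exists (fun w e => hN w e + (hZ w e + ((N w e * (hS' w e + B w e * 7 + 6) + 1)
   + ((N w e * 3 + 1) + (B w e * 4 + 1))))); split; first by pb.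
move=> w rho d s [d0 al p0 z] /=; set e := map _ _.
pose acc i := iteri i (S w e) (Z w e).
have zd := z d (leqnn _); have zd1 := z d.+1 (leqnSn _).
have zd2 : pos s d.+2 = 0 by apply: z; lia.
have zd3 : pos s d.+3 = 0 by apply: z; lia.
apply: wrun_seq (rN _ _ _ _ _) _; first by split.
rewrite -/e; set s1 := upd s d _.
have e1 : map (pos s1) rho = e by rewrite /s1 (map_upd _ _ al).
apply: wrun_seq (_ : wrun _ _ _ (upd s1 d.+2 (Z w e)) (hZ w e)) _.
  have := rZ w rho d.+2 s1; rewrite e1; apply; split=> //=; first by apply: all_ltW al; lia.
    by case: eqP => // ?; lia.
  by move=> i lt; case: eqP => [?|_]; [lia | apply: z; lia].
have m1 : (d == d.+1) = false by lia.
have m2 : (d == d.+2) = false by lia.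
pose T i := upd (upd (upd s d (N w e - i)) d.+1 i) d.+2 (acc i).
have T0 : upd s1 d.+2 (Z w e) = T 0 by rewrite /T /s1; steq; subst.
rewrite T0; apply: wrun_seq (_ : wrun _ _ _ (T (N w e)) _) _.
  apply: wrun_le (wrun_until (h := hS' w e + B w e * 7 + 4) _ _) => [|i lt|]; first by lia.
    split; first by rewrite /T /= m1 m2 eqxx; lia.
    set s2 := upd (T i) d (N w e - i.+1).
    apply: (wrun_le (h := 1 + (hS' w e + (B w e * 7 + 2 + 1)))); first by lia.
    apply: wrun_seq (_ : wrun _ _ _ s2 _) _.
      rewrite /s2 (_ : N w e - i.+1 = shift_pos false (pos (T i) d)); first exact: wrun_move.
      by rewrite /T /= m1 m2 eqxx; lia.
    have e2 : map (pos s2) [:: d.+1, d.+2 & rho] = [:: i, acc i & e].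
      have em : map (pos s2) rho = e by rewrite /s2 /T !(map_upd _ _ al) //; lia.
      by rewrite !map_cons em /= !eqxx; do ![case: eqP => [?|_]; first by lia].
    have r2 : ready [:: d.+1, d.+2 & rho] d.+3 s2.
      split=> //=.
      - by rewrite !ltnS leqnn leqnSn /=; apply: all_ltW al; lia.
      - by do ![case: eqP => [?|_]; first by lia].
      by move=> j lj; do ![case: eqP => [?|_]; first by lia]; apply: z; lia.
    have := rS w _ _ _ r2; rewrite e2 /= => run2.
    apply: wrun_seq (wrun_le _ run2) _.
      apply: hhS; rewrite /= /mz; have := leB w e i (ltnW lt); rewrite -/(acc i).
      by lia.
    set s3 := upd s2 d.+3 _.
    have n3 : d.+3 != d.+2 by lia.
    apply: wrun_seq (wrun_le _ (wrun_assign w s3 n3)) _.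
      rewrite /s3 /s2 /T /= !eqxx; do ![case: eqP => [?|_]; first by lia].
      by have := leB w e i (ltnW lt); have := leB w e i.+1 lt; rewrite /= -/(acc i); lia.
    set s4 := upd (upd s3 _ _) _ _.
    rewrite (_ : T i.+1 = upd s4 d.+1 (shift_pos true (pos s4 d.+1))); first exact: wrun_move.
    rewrite /s4 /s3 /s2 /T /= !eqxx; do ![case: eqP => [?|_]; first by lia].
    by steq; subst; rewrite ?zd3.
  by rewrite /T /= m1 m2 eqxx subnn.
have n1 : (d.+1 == d.+2) = false by lia.
apply: wrun_seq (wrun_le _ (wrun_clear _ _ _)) _.
  by rewrite /T /= n1 eqxx.
set s5 := upd _ d.+1 0.
have n2 : d.+2 != d by lia.
have := wrun_transfer w s5 n2.
rewrite (_ : pos s5 d.+2 = acc (N w e)); last first.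
  by rewrite /s5 /T /= eqxx; case: eqP => // ?; lia.
rewrite (_ : pos s5 d = 0); last first.
  by rewrite /s5 /T /= m1 m2 eqxx subnn.
move=> run; rewrite (_ : upd s d _ = upd (upd s5 d.+2 0) d (0 + acc (N w e))).
  by apply: wrun_le run; have := leB w e (N w e) (leqnn _); rewrite -/(acc _); lia.
by rewrite /s5 /T; clear T0 run; steq; subst; rewrite ?zd1 ?zd2.
Qed.

Lemma polyf_size : polyf (fun w _ => size w).
Proof.
exists (fun _ d => PSeq (PMove 0 true) (PSeq
  (PUntil TEnd (PSeq (PMove 0 true) (PMove d true))) (clear 0))).
exists (fun w e => 1 + ((size w * 4 + 1) + ((size w).+1 * 3 + 1))); split.
  by apply: (@pbd_le _ (fun w e => mz w e * 20)); [pb | rewrite /mz; lia].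
move=> w rho d s [d0 al p0 z] /=.
have zd := z d (leqnn _).
have n1 : (0 == d) = false by lia.
have n2 : (d == 0) = false by lia.
pose T i := upd (upd s d i) 0 i.+1.
apply: wrun_seq (_ : wrun _ _ _ (T 0) _) _.
  rewrite (_ : T 0 = upd s 0 (shift_pos true (pos s 0))); first exact: wrun_move.
  by rewrite /T p0; steq; subst.
apply: wrun_seq (_ : wrun _ _ _ (T (size w)) _) _.
  apply: wrun_until => [i lt|]; rewrite /T //=.
  split; first by lia.
  apply: (wrun_le (h := 1 + 1)) => //; apply: wrun_seq (wrun_move _ _ _ _) _.
  set s1 := upd _ 0 _; set s2 := (X in wrun _ _ _ X _).
  rewrite (_ : s2 = upd s1 d (shift_pos true (pos s1 d))); first exact: wrun_move.
  by rewrite /s1 /s2 /= n2 eqxx; steq.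
rewrite (_ : upd s d (size w) = upd (T (size w)) 0 0); first exact: wrun_clear.
by rewrite /T; steq; subst.
Qed.

Lemma polyf_bit f : polyf f -> polyf (fun w e => nth false w (f w e)).
Proof.
move=> pf; have bf := polyf_pbd pf; case: pf => [P [h [ph re]]].
exists (fun rho d => PSeq (P rho d) (PSeq
  (PUntil (TZero d) (PSeq (PMove d false) (PMove 0 true)))
  (PSeq (PMove 0 true) (PSeq (PIf TBit (PMove d true) PSkip) (clear 0))))).
exists (fun w e => h w e + ((f w e * 4 + 1) + (1 + (2 + ((f w e + 1) * 3 + 1))))).
split; first by pb.
move=> w rho d s [d0 al p0 z] /=; set e := map _ _.
have zd := z d (leqnn _).
have n1 : (0 == d) = false by lia.
have n2 : (d == 0) = false by lia.
apply: wrun_seq (re _ _ _ _ _) _; first by split.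
rewrite -/e; set v := f w e.
pose T i := upd (upd s d (v - i)) 0 i.
have -> : upd s d v = T 0 by rewrite /T subn0; steq; subst.
apply: wrun_seq (_ : wrun _ _ _ (T v) _) _.
  apply: wrun_until => [i lt|]; rewrite /T /= n2 eqxx ?subnn //.
  split; first by lia.
  apply: (wrun_le (h := 1 + 1)) => //; apply: wrun_seq (wrun_move _ _ _ _) _.
  set s1 := upd _ d _; set s2 := (X in wrun _ _ _ X _).
  rewrite (_ : s2 = upd s1 0 (shift_pos true (pos s1 0))); first exact: wrun_move.
  by rewrite /s1 /s2 /= n1; steq; rewrite n2 eqxx; lia.
apply: wrun_seq (wrun_move _ _ _ _) _; set s3 := upd _ 0 _.
have p3 : pos s3 0 = v.+1 by [].
have d3 : pos s3 d = 0 by rewrite /s3 /T /= n2 eqxx subnn.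
pose s4 := upd s3 d (nth false w v).
apply: wrun_seq (_ : wrun _ _ _ s4 _) _.
  case hb: (nth false w v).
    exists 2 => //; apply: RIfT; first by rewrite /holds p3.
    rewrite /s4 hb (_ : upd s3 d _ = upd s3 d (shift_pos true (pos s3 d))).
      by constructor.
    by rewrite d3.
  exists 2 => //; apply: RIfF; first by rewrite /holds p3 /= hb.
  rewrite (_ : s4 = s3); first by constructor.
  by rewrite /s4 hb; apply: store_ext => // i; rewrite [LHS](_ : _ = if i == d then 0 else pos s3 i) //; case: (i =P d) => // ->.
apply: wrun_le (_ : _ <= _) _; last first.
  rewrite (_ : upd s d _ = upd s4 0 0); first exact: wrun_clear.
  by rewrite /s4 /s3 /T; clear p3 d3; steq; subst.
by rewrite /s4 /= n1; lia.
Qed.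

Lemma emit_runs N a sep : polyf N -> polyf a ->
  exists p h, pbd h /\ forall w, exists2 s', wrun w p (Store (fun=> 0) [::]) s' (h w [::])
    & outp s' = flatten [seq nseq (a w [:: i]) true ++ nseq (sep : bool) false
                        | i <- iota 0 (N w [::])].
Proof.
move=> pN pa; have bN := polyf_pbd pN; have ba := polyf_pbd pa.
case: pN pa => [PN [hN [phN rN]]] [Pa [ha [pha ra]]].
have pk := pbd_add pbd_mz bN.
have [ha' pha' hha] := pbd_ext pha pk; have [ba' pba' bba] := pbd_ext ba pk.
pose esep := if sep then PEmit false else PSkip.
pose body := PSeq (PMove 1 false) (PSeq (Pa [:: 2] 3)
   (PSeq (PUntil (TZero 3) (PSeq (PMove 3 false) (PEmit true))) (PSeq esep (PMove 2 true)))).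
exists (PSeq (PN [::] 1) (PUntil (TZero 1) body)).
exists (fun w e => hN w e + (N w e * (1 + (ha' w e + ((ba' w e * 4 + 1) + (1 + 1))) + 2) + 1)).
split; first by pb.
move=> w; set n := N w [::].
pose out i := flatten [seq nseq (a w [:: i]) true ++ nseq sep false | i <- iota 0 i].
pose T i := Store (fun j => if j == 1 then n - i else if j == 2 then i else 0) (out i).
exists (T n) => //.
apply: wrun_seq (_ : wrun _ _ _ (T 0) _) _.
  rewrite (_ : T 0 = upd (Store (fun=> 0) [::]) 1 n).
    by apply: (rN w [::] 1 (Store (fun=> 0) [::])); split.
  by rewrite /T /n subn0; steq.
apply: wrun_le (wrun_until (h := (1 + (ha' w [::] + ((ba' w [::] * 4 + 1) + (1 + 1))))) _ _) => [|i lt|]; first by lia.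
  split; first by rewrite /T /=; lia.
  set s1 := upd (T i) 1 (n - i.+1).
  apply: wrun_seq (_ : wrun _ _ _ s1 _) _.
    rewrite /s1 (_ : n - i.+1 = shift_pos false (pos (T i) 1)); first exact: wrun_move.
    by rewrite /T /=; lia.
  have r1 : ready [:: 2] 3 s1.
    by split=> // j; rewrite /s1 /=; do ![case: eqP => [?|_]; first by lia].
  have le : sumn [:: i] <= mz w [::] + N w [::] by rewrite /= /mz -/n; lia.
  have := ra w _ _ _ r1; rewrite /= => run1.
  apply: wrun_seq (wrun_le _ run1) _; first exact: hha.
  set v := a w _.
  pose U j := Store (pos (upd s1 3 (v - j))) (out i ++ nseq j true).
  have -> : upd s1 3 v = U 0 by rewrite /U subn0 cats0.
  apply: wrun_seq (_ : wrun _ _ _ (U v) _) _.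
    apply: (wrun_le (h := v * 4 + 1)); first by have := bba w [::] _ le; rewrite -/v; lia.
    apply: wrun_until => [j lj|]; rewrite /U /= ?subnn //.
    split; first by lia.
    apply: (wrun_le (h := 1 + 1)) => //; apply: wrun_seq (wrun_move _ _ _ _) _.
    exists 1 => //; set s2 := upd _ _ _; set s3 := (X in runs _ _ _ X _).
    rewrite (_ : s3 = Store (pos s2) (rcons (outp s2) true)); first by constructor.
    rewrite /s2 /s3; apply: store_ext => /= [k|].
      by case: eqP => // _; lia.
    by rewrite -cats1 -catA; congr cat; rewrite -[true :: _]/(nseq j.+1 true) -addn1 nseqD.
  set s4 := Store (pos (U v)) (out i.+1).
  apply: wrun_seq (_ : wrun _ _ _ s4 _) _.
    have eo : out i.+1 = outp (U v) ++ nseq sep false.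
      by rewrite /out -addn1 iotaD /= add0n map_cat flatten_cat /= cats0 -catA.
    rewrite /s4 eo /esep; case: (sep).
      by exists 1 => //; rewrite cats1; constructor.
    by exists 0 => //; rewrite cats0; constructor.
  rewrite (_ : T i.+1 = upd s4 2 (shift_pos true (pos s4 2))); first exact: wrun_move.
  rewrite /s4 /U /T subnn; apply: store_ext => //= k.
  by repeat (case: eqP => //= ?); lia.
by rewrite /T /= subnn.
Qed.

Lemma polyf_v1 : polyf (fun _ e => head 0 (behead e)).
Proof. exact: (polyf_wk 1 polyf_v0). Qed.

Lemma polyf_v2 : polyf (fun _ e => head 0 (behead (behead e))).
Proof. exact: (polyf_wk 2 polyf_v0). Qed.

Lemma polyf_v3 : polyf (fun _ e => head 0 (behead (behead (behead e)))).
Proof. exact: (polyf_wk 3 polyf_v0). Qed.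

Lemma polyf_v4 : polyf (fun _ e => head 0 (behead (behead (behead (behead e))))).
Proof. exact: (polyf_wk 4 polyf_v0). Qed.

Lemma polyf_app1 (F : seq bool -> nat -> nat) x :
  polyf (fun w e => F w (head 0 e)) -> polyf x -> polyf (fun w e => F w (x w e)).
Proof. by move=> pF px; apply: (polyf_let 0 pF px). Qed.

Lemma polyf_app2 (F : seq bool -> nat -> nat -> nat) x y :
  polyf (fun w e => F w (head 0 e) (head 0 (behead e))) -> polyf x -> polyf y ->
  polyf (fun w e => F w (x w e) (y w e)).
Proof.
move=> pF px py; apply: (polyf_let 0 (f := fun w e => F w (x w (behead e)) (head 0 e))) py.
exact: (polyf_let 0 pF (polyf_wk 1 px)).
Qed.

Lemma iteri_succ n a : iteri n (fun _ x => x.+1) a = n + a.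
Proof. by elim: n => //= n ->. Qed.

Lemma polyf_add f g : polyf f -> polyf g -> polyf (fun w e => f w e + g w e).
Proof.
move=> pf pg.
apply: (polyf_ext (f := fun w e => iteri (f w e) (fun _ a => a.+1) (g w e))) => [|w e].
  apply: (polyf_iteri (S := fun _ _ _ a => a.+1) (B := fun w e => f w e + g w e)) => //.
  - exact: polyf_succ polyf_v1.
  - by apply: pbd_add; apply: polyf_pbd.
  by move=> w e i le; rewrite iteri_succ leq_add2r.
by rewrite iteri_succ.
Qed.

(** The index of the last round of a loop is one less than the number of rounds. *)
Lemma polyf_pred f : polyf f -> polyf (fun w e => (f w e).-1).
Proof.
move=> pf; apply: (polyf_ext (f := fun w e => iteri (f w e) (fun i _ => i) 0)) => [|w e].
  apply: (polyf_iteri (S := fun _ _ i _ => i) (Z := fun _ _ => 0) (B := f)) => //.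
  - exact: polyf_zero.
  - exact: polyf_v0.
  - exact: polyf_pbd.
  by move=> w e [|i] //= lt; apply: ltnW.
by case: (f w e).
Qed.

Lemma iteri_pred n a : iteri n (fun _ x => x.-1) a = a - n.
Proof. by elim: n => [|n IH] /=; rewrite ?subn0 // IH subnS. Qed.

Lemma polyf_sub f g : polyf f -> polyf g -> polyf (fun w e => f w e - g w e).
Proof.
move=> pf pg.
apply: (polyf_ext (f := fun w e => iteri (g w e) (fun _ a => a.-1) (f w e))) => [|w e].
  apply: (polyf_iteri (S := fun _ _ _ a => a.-1) (B := f)) => //.
  - exact: polyf_pred polyf_v1.
  - exact: polyf_pbd.
  by move=> w e i le; rewrite iteri_pred leq_subr.
by rewrite iteri_pred.
Qed.

Definition sumf (n : nat) (F : nat -> nat) : nat := \sum_(i < n) F i.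

Lemma sumf_iteri n F : sumf n F = iteri n (fun i a => a + F i) 0.
Proof. by rewrite /sumf; elim: n => [|n IH]; rewrite ?big_ord0 // big_ord_recr IH. Qed.

Lemma polyf_sumf N (F : seq bool -> seq nat -> nat -> nat) : polyf N ->
  polyf (fun w e => F w (behead e) (head 0 e)) ->
  polyf (fun w e => sumf (N w e) (F w e)).
Proof.
move=> pN pF; have bN := polyf_pbd pN.
have [h' ph' hh] := pbd_ext (polyf_pbd pF) (pbd_add pbd_mz bN).
apply: (polyf_ext (f := fun w e => iteri (N w e) (fun i a => a + F w e i) 0)) => [|w e]; last by rewrite sumf_iteri.
apply: (polyf_iteri (S := fun w e i a => a + F w e i) (Z := fun _ _ => 0)
  (B := fun w e => N w e * h' w e)) => //.
- exact: polyf_zero.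
- apply: polyf_add polyf_v1 _.
  exact: (polyf_let 2 pF polyf_v0).
- by pb.
move=> w e i le; rewrite -sumf_iteri.
apply: leq_trans (_ : i * h' w e <= _); last by rewrite leq_mul2r le orbT.
rewrite -{2}(card_ord i) -sum_nat_const; apply: leq_sum => j _.
by apply: (hh w e (nat_of_ord j :: e)); rewrite /mz /=; case: j => j /= lt; lia.
Qed.

Lemma sumf_const n a : sumf n (fun _ => a) = n * a.
Proof. by rewrite /sumf sum_nat_const card_ord. Qed.

Lemma polyf_mul f g : polyf f -> polyf g -> polyf (fun w e => f w e * g w e).
Proof.
move=> pf pg; apply: (polyf_ext (f := fun w e => sumf (f w e) (fun _ => g w e))) => [|w e].
  by apply: (polyf_sumf (F := fun w e _ => g w e)) => //; apply: (polyf_wk 1).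
by rewrite sumf_const.
Qed.

Lemma polyf_exp c f : polyf f -> polyf (fun w e => f w e ^ c).
Proof.
move=> pf; elim: c => [|c IH]; first exact: (polyf_const 1).
by apply: (polyf_ext (polyf_mul pf IH)) => w e; rewrite expnS.
Qed.

Lemma polyf_if (b : seq bool -> seq nat -> bool) f g :
  polyf (fun w e => b w e) -> polyf f -> polyf g ->
  polyf (fun w e => if b w e then f w e else g w e).
Proof.
move=> pb pf pg; apply: (polyf_ext (f := fun w e => b w e * f w e + (1 - b w e) * g w e)).
  by do ![apply: polyf_add | apply: polyf_mul | apply: polyf_sub | apply: polyf_const | assumption].
by move=> w e; case: (b w e); rewrite /= ?mul1n ?mul0n ?addn0.
Qed.

Lemma polyf_leq f g : polyf f -> polyf g -> polyf (fun w e => f w e <= g w e).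
Proof.
move=> pf pg; apply: (polyf_ext (f := fun w e => 1 - (f w e - g w e))) => [|w e].
  by do ![apply: polyf_sub | apply: polyf_const | assumption].
by case: leqP; lia.
Qed.

Lemma polyf_eq f g : polyf f -> polyf g -> polyf (fun w e => f w e == g w e).
Proof.
move=> pf pg; apply: (polyf_ext (f := fun w e => (f w e <= g w e) * (g w e <= f w e))) => [|w e].
  by do ![apply: polyf_mul | apply: polyf_leq | assumption].
by rewrite eqn_leq; case: (_ <= _); case: (_ <= _).
Qed.

Lemma polyf_andb (b c : seq bool -> seq nat -> bool) :
  polyf (fun w e => b w e) -> polyf (fun w e => c w e) -> polyf (fun w e => b w e && c w e).
Proof.
move=> pb pc; apply: (polyf_ext (polyf_mul pb pc)) => w e.
by case: (b w e); case: (c w e).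
Qed.

Lemma polyf_negb (b : seq bool -> seq nat -> bool) :
  polyf (fun w e => b w e) -> polyf (fun w e => ~~ b w e).
Proof.
move=> pb; apply: (polyf_ext (polyf_sub (polyf_const 1) pb)) => w e.
by case: (b w e).
Qed.

Lemma polyf_orb (b c : seq bool -> seq nat -> bool) :
  polyf (fun w e => b w e) -> polyf (fun w e => c w e) -> polyf (fun w e => b w e || c w e).
Proof.
move=> pb pc; apply: (polyf_ext (polyf_negb (polyf_andb (polyf_negb pb) (polyf_negb pc)))) => w e.
by case: (b w e); case: (c w e).
Qed.

Definition allf (n : nat) (p : nat -> bool) : bool := all p (iota 0 n).

Lemma allfP n (p : nat -> bool) : reflect (forall i, i < n -> p i) (allf n p).
Proof.
by apply: (iffP allP) => h i; [move=> lt; apply: h|move=> lt; apply: h];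
  rewrite ?mem_iota in lt *.
Qed.

Lemma polyf_allf N (p : seq bool -> seq nat -> nat -> bool) : polyf N ->
  polyf (fun w e => p w (behead e) (head 0 e)) ->
  polyf (fun w e => allf (N w e) (p w e)).
Proof.
move=> pN pp; apply: (polyf_ext (f := fun w e => sumf (N w e) (fun i => ~~ p w e i) == 0)).
  apply: polyf_eq (polyf_const 0).
  apply: (polyf_sumf (F := fun w e i => ~~ p w e i)) => //.
  exact: (polyf_negb (b := fun w e => p w (behead e) (head 0 e))).
move=> w e; congr nat_of_bool; rewrite /sumf sum_nat_eq0.
apply/forallP/allfP => h i; first by move=> lt; have := h (Ordinal lt); rewrite /=; case: (p _ _ _).
by rewrite h.
Qed.

(** The quotient counts the positive multiples of the divisor up to the dividend; the test [0 < _]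
    accounts for division by 0. *)
Lemma polyf_div f g : polyf f -> polyf g -> polyf (fun w e => f w e %/ g w e).
Proof.
apply: polyf_app2 (fun _ a b => a %/ b) _ _ _.
apply: (polyf_ext (f := fun _ e => sumf (head 0 e) (fun i => (0 < head 0 (behead e)) &&
   (i.+1 * head 0 (behead e) <= head 0 e)))) => [|w e].
  apply: (polyf_sumf (F := fun _ e i => (0 < head 0 (behead e)) &&
   (i.+1 * head 0 (behead e) <= head 0 e))); first exact: polyf_v0.
  apply: polyf_andb; apply: polyf_leq.
  - exact: polyf_const.
  - exact: polyf_v2.
  - by apply: polyf_mul polyf_v2; apply: polyf_succ polyf_v0.
  exact: polyf_v1.
move: (head 0 e) (head 0 (behead e)) => a b; case: b => [|b]; first by rewrite divn0 /sumf big1.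
rewrite /sumf /= -big_mkcond /= sum1_card.
have le := leq_div a b.+1; rewrite -[RHS](card_ord (a %/ b.+1)).
rewrite -(card_image (f := widen_ord le)); last first.
  by move=> i j /(congr1 val) /= /val_inj.
apply: eq_card => i; rewrite unfold_in; apply/idP/imageP => [lt|[j _ ->]].
  have lt' : i < a %/ b.+1 by rewrite leq_divRL //; apply: lt.
  by exists (Ordinal lt') => //; apply: val_inj.
by have := ltn_ord j; rewrite leq_divRL.
Qed.

Lemma polyf_mod f g : polyf f -> polyf g -> polyf (fun w e => f w e %% g w e).
Proof.
move=> pf pg; apply: (polyf_ext (polyf_sub pf (polyf_mul (polyf_div pf pg) pg))) => w e.
by rewrite {1}(divn_eq (f w e) (g w e)) addKn.
Qed.

(** Hook for named functions, redefined as more of them are shown to be polynomial-time. *)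
Ltac pf_named := fail.

Ltac pf_step := cbv beta; lazymatch goal with
  | |- polyf (fun _ e => head 0 e) => exact: polyf_v0
  | |- polyf (fun _ e => head 0 (behead e)) => exact: polyf_v1
  | |- polyf (fun _ e => head 0 (behead (behead e))) => exact: polyf_v2
  | |- polyf (fun _ e => head 0 (behead (behead (behead e)))) => exact: polyf_v3
  | |- polyf (fun _ e => head 0 (behead (behead (behead (behead e))))) => exact: polyf_v4
  | |- polyf (fun w _ => size w) => exact: polyf_size
  | |- polyf (fun _ _ => ?c) => exact: polyf_const
  | |- polyf (fun w e => nat_of_bool (nth false w (@?f w e))) => apply: (@polyf_bit f)
  | |- polyf (fun w e => addn (@?f w e) (@?g w e)) => apply: (@polyf_add f g)
  | |- polyf (fun w e => subn (@?f w e) (@?g w e)) => apply: (@polyf_sub f g)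
  | |- polyf (fun w e => muln (@?f w e) (@?g w e)) => apply: (@polyf_mul f g)
  | |- polyf (fun w e => divn (@?f w e) (@?g w e)) => apply: (@polyf_div f g)
  | |- polyf (fun w e => modn (@?f w e) (@?g w e)) => apply: (@polyf_mod f g)
  | |- polyf (fun w e => expn (@?f w e) ?c) => apply: (@polyf_exp c f)
  | |- polyf (fun w e => S (@?f w e)) => apply: (@polyf_succ f)
  | |- polyf (fun w e => predn (@?f w e)) => apply: (@polyf_pred f)
  | |- polyf (fun w e => sumf (@?N w e) (@?F w e)) => apply: (@polyf_sumf N F)
  | |- polyf (fun w e => nat_of_bool (leq (@?f w e) (@?g w e))) => apply: (@polyf_leq f g)
  | |- polyf (fun w e => nat_of_bool (@eq_op _ (@?f w e) (@?g w e))) => apply: (@polyf_eq f g)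
  | |- polyf (fun w e => nat_of_bool (andb (@?f w e) (@?g w e))) => apply: (@polyf_andb f g)
  | |- polyf (fun w e => nat_of_bool (orb (@?f w e) (@?g w e))) => apply: (@polyf_orb f g)
  | |- polyf (fun w e => nat_of_bool (negb (@?f w e))) => apply: (@polyf_negb f)
  | |- polyf (fun w e => nat_of_bool (allf (@?N w e) (@?F w e))) => apply: (@polyf_allf N F)
  | |- polyf _ => first [pf_named | apply: polyf_if]
  end.

Ltac pf := repeat pf_step.

(** * Integer-valued polynomial-time functions *)

Local Open Scope ring_scope.
Import GRing.Theory.

Definition polyz (f : seq bool -> seq nat -> int) : Prop :=
  exists p n, [/\ polyf p, polyf n & forall w e, f w e = (p w e)%:Z - (n w e)%:Z].

Lemma polyz_nat f : polyf f -> polyz (fun w e => (f w e)%:Z).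
Proof.
by move=> pf; exists f, (fun _ _ => 0%N); split=> //; [apply: polyf_const | move=> w e; rewrite subr0].
Qed.

Lemma polyz_const (c : nat) : polyz (fun _ _ => c%:Z).
Proof. exact: polyz_nat (polyf_const c). Qed.

Lemma polyz_add f g : polyz f -> polyz g -> polyz (fun w e => f w e + g w e).
Proof.
move=> [p [n [pp pn ef]]] [p' [n' [pp' pn' eg]]].
exists (fun w e => p w e + p' w e)%N, (fun w e => n w e + n' w e)%N.
by split; [apply: polyf_add|apply: polyf_add|move=> w e; rewrite ef eg; lia].
Qed.

Lemma polyz_opp f : polyz f -> polyz (fun w e => - f w e).
Proof.
by move=> [p [n [pp pn ef]]]; exists n, p; split=> // w e; rewrite ef opprB.
Qed.

Lemma polyz_mul f g : polyz f -> polyz g -> polyz (fun w e => f w e * g w e).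
Proof.
move=> [p [n [pp pn ef]]] [p' [n' [pp' pn' eg]]].
exists (fun w e => p w e * p' w e + n w e * n' w e)%N.
exists (fun w e => p w e * n' w e + n w e * p' w e)%N.
split; try by do ![apply: polyf_add | apply: polyf_mul].
by move=> w e; rewrite ef eg !PoszD !PoszM; ring.
Qed.

Lemma polyz_if (b : seq bool -> seq nat -> bool) f g :
  polyf (fun w e => b w e) -> polyz f -> polyz g ->
  polyz (fun w e => if b w e then f w e else g w e).
Proof.
move=> pb [p [n [pp pn ef]]] [p' [n' [pp' pn' eg]]].
exists (fun w e => if b w e then p w e else p' w e), (fun w e => if b w e then n w e else n' w e).
by split; try exact: polyf_if; move=> w e; case: (b w e).
Qed.

Definition sumz (n : nat) (F : nat -> int) : int := \sum_(i < n) F i.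

Lemma polyz_sumz N (F : seq bool -> seq nat -> nat -> int) : polyf N ->
  polyz (fun w e => F w (behead e) (head 0%N e)) ->
  polyz (fun w e => sumz (N w e) (F w e)).
Proof.
move=> pN [p [n [pp pn ef]]].
exists (fun w e => sumf (N w e) (fun i => p w (i :: e))), (fun w e => sumf (N w e) (fun i => n w (i :: e))).
split; try by apply: polyf_sumf => //; apply: (polyf_let 1 _ polyf_v0).
move=> w e; rewrite /sumz /sumf !(big_morph Posz PoszD (erefl 0%:Z)) -sumrB.
by apply: eq_bigr => i _; rewrite (ef w (nat_of_ord i :: e)).
Qed.

Lemma polyz_let k f g : polyz f -> polyf g ->
  polyz (fun w e => f w (g w e :: iter k behead e)).
Proof.
move=> [p [n [pp pn ef]]] pg.
exists (fun w e => p w (g w e :: iter k behead e)), (fun w e => n w (g w e :: iter k behead e)).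
by split; try exact: polyf_let.
Qed.

Lemma polyz_app2 (F : seq bool -> nat -> nat -> int) x y :
  polyz (fun w e => F w (head 0%N e) (head 0%N (behead e))) -> polyf x -> polyf y ->
  polyz (fun w e => F w (x w e) (y w e)).
Proof.
move=> pF px py; apply: (polyz_let 0 (f := fun w e => F w (x w (behead e)) (head 0%N e))) py.
exact: (polyz_let 0 pF (polyf_wk 1 px)).
Qed.

Lemma polyf_absz f : polyz f -> polyf (fun w e => `|f w e|%N).
Proof.
move=> [p [n [pp pn ef]]].
apply: (polyf_ext (polyf_add (polyf_sub pp pn) (polyf_sub pn pp))) => w e.
by rewrite ef; lia.
Qed.

Ltac pz_named := fail.

Ltac pz_step := cbv beta; lazymatch goal with
  | |- polyz (fun _ _ => Posz ?c) => exact: polyz_const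
  | |- polyz (fun w e => Posz (@?f w e)) => apply: (@polyz_nat f)
  | |- polyz (fun w e => GRing.add (@?f w e) (@?g w e)) => apply: (@polyz_add f g)
  | |- polyz (fun w e => GRing.opp (@?f w e)) => apply: (@polyz_opp f)
  | |- polyz (fun w e => GRing.mul (@?f w e) (@?g w e)) => apply: (@polyz_mul f g)
  | |- polyz (fun w e => sumz (@?N w e) (@?F w e)) => apply: (@polyz_sumz N F)
  | |- polyz _ => first [pz_named | apply: polyz_if]
  | |- _ => pf_step
  end.

Ltac pz := repeat pz_step.

(** * Reading circuits *)

Local Close Scope ring_scope.
Local Open Scope nat_scope.

(** In a list of unary numbers a one belongs to number [i] exactly if [i] zeros precede it, so
    numbers are read by counting bits. *)
Definition tok (w : seq bool) (i : nat) : nat :=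
  sumf (size w) (fun p => nth false w p && (sumf p (fun q => ~~ nth false w q) == i)).

Definition ntok (w : seq bool) : nat := sumf (size w) (fun p => ~~ nth false w p).

Lemma eq_sumf n F G : (forall i, i < n -> F i = G i) -> sumf n F = sumf n G.
Proof. by move=> eFG; apply: eq_bigr => i _; apply: eFG. Qed.

Lemma sumfD m n F : sumf (m + n) F = sumf m F + sumf n (fun i => F (m + i)).
Proof. by rewrite /sumf big_split_ord. Qed.

Lemma sumf0 n F : (forall i, i < n -> F i = 0) -> sumf n F = 0.
Proof. by move=> F0; rewrite (eq_sumf F0) sumf_const muln0. Qed.

Lemma sumf1 F : sumf 1 F = F 0.
Proof. by rewrite /sumf big_ord_recl big_ord0 addn0. Qed.

Lemma bits_of_cons m s : bits_of (m :: s) = nseq m true ++ false :: bits_of s.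
Proof. by rewrite /bits_of /= /unary -cats1 -catA. Qed.

Lemma nth_unary1 m w p : p < m -> nth false (nseq m true ++ false :: w) p = true.
Proof. by move=> lt; rewrite nth_cat size_nseq lt nth_nseq lt. Qed.

Lemma nth_unary2 m w p : nth false (nseq m true ++ false :: w) (m.+1 + p) = nth false w p.
Proof.
rewrite nth_cat size_nseq ifF; last by lia.
by rewrite (_ : m.+1 + p - m = p.+1) //; lia.
Qed.

Lemma nth_unary0 m w : nth false (nseq m true ++ false :: w) m = false.
Proof. by rewrite nth_cat size_nseq ltnn subnn. Qed.

Lemma zeros_unary m w p : p <= m ->
  sumf p (fun q => ~~ nth false (nseq m true ++ false :: w) q) = 0.
Proof. by move=> le; apply: sumf0 => i lt; rewrite nth_unary1 //; lia. Qed.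

Lemma zeros_unary2 m w p :
  sumf (m.+1 + p) (fun q => ~~ nth false (nseq m true ++ false :: w) q) =
  (sumf p (fun q => ~~ nth false w q)).+1.
Proof.
rewrite sumfD -addn1 sumfD zeros_unary // add0n sumf1 [m + 0]addn0.
rewrite nth_unary0 /= add1n; congr _.+1.
by apply: eq_bigr => i _; rewrite addn1 nth_unary2.
Qed.

Lemma size_unary m w : size (nseq m true ++ false :: w) = m.+1 + size w.
Proof. by rewrite size_cat size_nseq /= addnS. Qed.

Lemma ntok_bits_of s : ntok (bits_of s) = size s.
Proof.
elim: s => [|m s IH]; first by rewrite /ntok /sumf big_ord0.
by rewrite bits_of_cons /ntok size_unary zeros_unary2 -/(ntok (bits_of s)) IH.
Qed.

Lemma tok_bits_of s i : tok (bits_of s) i = nth 0 s i.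
Proof.
elim: s i => [|m s IH] i; first by rewrite /tok /sumf big_ord0 nth_nil.
rewrite bits_of_cons /tok size_unary sumfD -addn1 sumfD.
rewrite sumf1 [m + 0]addn0 nth_unary0 /= addn0.
rewrite (eq_sumf (G := fun _ => (0 == i : nat))); last first.
  by move=> p lt; rewrite nth_unary1 // zeros_unary //; lia.
rewrite sumf_const; under eq_sumf => p lt do rewrite addn1 nth_unary2 zeros_unary2.
case: i => [|i] /=.
  by rewrite muln1 sumf0 ?addn0 // => p _; rewrite andbF.
by rewrite muln0 add0n -IH /tok; apply: eq_sumf => p _; rewrite eqSS.
Qed.

Definition kk w := tok w 0.
Definition nn w := tok w 1.

(** The tokens are the weight, the number of inputs, and then the gates: a negation takes two
    tokens, any other gate a tag, an arity and its arguments. *)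
Definition gpos w j :=
  iteri j (fun _ p => p + (if tok w p == 0 then 2 else 2 + tok w p.+1)) 2.

Definition kind w j := tok w (gpos w j).
Definition nargs w j := if kind w j == 0 then 1 else tok w (gpos w j).+1.
Definition garg w j a :=
  if kind w j == 0 then tok w (gpos w j).+1 else tok w (gpos w j + 2 + a).
Definition ng w := sumf (ntok w) (fun j => gpos w j < ntok w).

Lemma tok_size w i : tok w i <= size w.
Proof.
rewrite /tok -[X in _ <= X]muln1 -sumf_const; apply: leq_sum => p _.
by case: (_ && _).
Qed.

Lemma tok_poly x : polyf x -> polyf (fun w e => tok w (x w e)).
Proof. by apply: polyf_app1; rewrite /tok; pf. Qed.

Lemma ntok_poly : polyf (fun w _ => ntok w).
Proof. by rewrite /ntok; pf. Qed.

Lemma gpos_poly x : polyf x -> polyf (fun w e => gpos w (x w e)).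
Proof.
apply: polyf_app1; rewrite /gpos.
apply: (polyf_iteri (N := fun _ e => head 0 e) (Z := fun _ _ => 2)
  (S := fun w _ _ p => p + (if tok w p == 0 then 2 else 2 + tok w p.+1))
  (B := fun w e => 2 + mz w e * (mz w e))).
- by pf.
- by pf.
- by pf; do ?apply: tok_poly; pf.
- by pb.
move=> w e i le; apply: leq_trans (_ : 2 + i * (2 + size w) <= _).
  elim: i le => //= i IH lt; have := IH (ltnW lt); set p := iteri _ _ _ => le.
  by have := tok_size w p.+1; case: ifP => _; rewrite mulSn; lia.
rewrite leq_add2l; apply: leq_mul; rewrite /mz; last by lia.
by case: e le => [|a e] /=; lia.
Qed.

Lemma kk_poly : polyf (fun w _ => kk w).
Proof. by rewrite /kk; apply: tok_poly; pf. Qed.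

Lemma nn_poly : polyf (fun w _ => nn w).
Proof. by rewrite /nn; apply: tok_poly; pf. Qed.

Lemma kind_poly x : polyf x -> polyf (fun w e => kind w (x w e)).
Proof. by move=> px; rewrite /kind; apply: tok_poly; apply: gpos_poly. Qed.

Ltac pf_named ::= first [apply: tok_poly | exact: ntok_poly | apply: gpos_poly
  | exact: kk_poly | exact: nn_poly | apply: kind_poly].

Lemma nargs_poly x : polyf x -> polyf (fun w e => nargs w (x w e)).
Proof. by apply: polyf_app1; rewrite /nargs; pf. Qed.

Lemma garg_poly x y : polyf x -> polyf y -> polyf (fun w e => garg w (x w e) (y w e)).
Proof. by apply: polyf_app2; rewrite /garg; pf. Qed.

Lemma ng_poly : polyf (fun w _ => ng w).
Proof. by rewrite /ng; pf. Qed.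

Ltac pf_circuit := first [apply: tok_poly | exact: ntok_poly | apply: gpos_poly
  | exact: kk_poly | exact: nn_poly | apply: kind_poly | apply: nargs_poly
  | apply: garg_poly | exact: ng_poly].

Ltac pf_named ::= pf_circuit.

Section Decode.
Variables (k n : nat) (gs : seq gate).
Let s := [:: k, n & flatten [seq gate_code g | g <- gs]].
Let w := bits_of s.
Let g0 := GNot 0.

Lemma kkE : kk w = k. Proof. by rewrite /kk tok_bits_of. Qed.
Lemma nnE : nn w = n. Proof. by rewrite /nn tok_bits_of. Qed.

Let pre j := 2 + size (flatten [seq gate_code g | g <- take j gs]).

Lemma nth_pre j i : j < size gs -> i < size (gate_code (nth g0 gs j)) ->
  nth 0 s (pre j + i) = nth 0 (gate_code (nth g0 gs j)) i.
Proof.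
move=> lj li; rewrite /pre /s -[_ + _]/((_ + _).+2) /=.
rewrite -{1}(cat_take_drop j gs) map_cat flatten_cat (drop_nth g0 lj) /=.
by rewrite nth_cat ltnNge leq_addr /= addKn nth_cat li.
Qed.

Lemma gposE j : j <= size gs -> gpos w j = pre j.
Proof.
elim: j => [|j IH] lt; first by rewrite /pre take0.
rewrite /gpos /= -/(gpos w j) IH ?(ltnW lt) //.
rewrite {4}/pre (take_nth g0) // map_rcons -cats1 flatten_cat size_cat /= cats0.
rewrite addnA -/(pre j); congr (_ + _).
rewrite !tok_bits_of -[X in nth 0 s X]addn0 -[in (pre j).+1]addn1.
have := nth_pre lt.
by case: (nth g0 gs j) => [i|l|l] /= np; rewrite !np.
Qed.

(** A gate takes at least two tokens, so all gates have an index below [ntok w]; positions computed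
    for larger indices lie at or beyond the end. *)
Lemma ngE : ng w = size gs.
Proof.
have szs : ntok w = size s by rewrite ntok_bits_of.
have sz2 j : j <= size gs -> pre j + 2 * (size gs - j) <= size s.
  move=> le; rewrite /s /= /pre -size_drop.
  have -> : size (flatten [seq gate_code g | g <- gs]) =
    size (flatten [seq gate_code g | g <- take j gs]) +
    size (flatten [seq gate_code g | g <- drop j gs]).
    by rewrite -size_cat -flatten_cat -map_cat cat_take_drop.
  suff : 2 * size (drop j gs) <= size (flatten [seq gate_code g | g <- drop j gs]) by lia.
  by elim: (drop j gs) => //= -[i|l|l] l' IH; rewrite ?size_cat /=; lia.
have lep : size gs <= size s by have := sz2 0 isT; rewrite /pre take0 /=; lia.
have pm : pre (size gs) = size s by rewrite /pre take_size.
rewrite /ng szs -(subnKC lep) sumfD (eq_sumf (G := fun _ => 1)); last first.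
  by move=> j lt; rewrite gposE ?(ltnW lt) //; have := sz2 _ (ltnW lt); rewrite subnKC //; lia.
rewrite sumf_const muln1 sumf0 ?addn0 // => i _.
rewrite subnKC // ltnNge; apply/eqP; rewrite eqb0 negbK -pm -gposE //.
by elim: i => [|i IH]; rewrite ?addn0 // addnS; apply: leq_trans IH _; apply: leq_addr.
Qed.

Lemma tok_gate j i : j < size gs -> i < size (gate_code (nth g0 gs j)) ->
  tok w (gpos w j + i) = nth 0 (gate_code (nth g0 gs j)) i.
Proof. by move=> lj li; rewrite gposE ?(ltnW lj) // tok_bits_of nth_pre. Qed.

Lemma kindE j : j < size gs -> kind w j =
  match nth g0 gs j with GNot _ => 0 | GAnd _ => 1 | GOr _ => 2 end.
Proof.
by move=> lt; rewrite /kind -[gpos w j]addn0 tok_gate //; case: (nth g0 gs j).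
Qed.

Lemma nargsE j : j < size gs -> nargs w j = size (gate_args (nth g0 gs j)).
Proof.
by move=> lt; rewrite /nargs kindE // -[(gpos w j).+1]addn1 tok_gate //; case: (nth g0 gs j).
Qed.

Lemma gargE j a : j < size gs -> a < size (gate_args (nth g0 gs j)) ->
  garg w j a = nth 0 (gate_args (nth g0 gs j)) a.
Proof.
move=> lt; rewrite /garg kindE // -[(gpos w j).+1]addn1 -addnA; have := tok_gate lt.
by case: (nth g0 gs j) => [i|l|l] tg /= la; rewrite tg //=; case: a la.
Qed.

End Decode.

(** * Circuits as polynomials *)

(** The number of tuples of [2 ^ e] digits; [lo] and [hi] are the two halves of a tuple of twice
    that length. *)
Definition bs e w := (nn w).+1 ^ (2 ^ e).
Definition lo e w y := y %% bs e w.
Definition hi e w y := y %/ bs e w.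

Definition gi w v := v - nn w.

(** The constant 1 as the monomial with all digits [nn w]: since [x k = n], it evaluates to 1. It
    pads polynomials to a higher degree. *)
Fixpoint onec e w (y : nat) : int :=
  if e is e'.+1 then (onec e' w (lo e' w y) * onec e' w (hi e' w y))%R
  else Posz (y == nn w).

(* [ttc e w v y] is the coefficient of the monomial [y] (a tuple of [2 ^ e]    *)
(* digits in base [nn w + 1]) in the polynomial that evaluates the node [v].  *)
Fixpoint ttc e w (v y : nat) : int :=
  if e is e'.+1 then
    (if (v < nn w)%N then ttc e' w v (lo e' w y) * onec e' w (hi e' w y)
     else if kind w (gi w v) == 0%N then
       (onec e' w (lo e' w y) - ttc e' w (garg w (gi w v) 0) (lo e' w y)) * onec e' w (hi e' w y)
     else if kind w (gi w v) == 1%N then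
       ttc e' w (garg w (gi w v) 0) (lo e' w y) * ttc e' w (garg w (gi w v) 1) (hi e' w y)
     else ttc e' w (garg w (gi w v) 0) (lo e' w y) * onec e' w (hi e' w y)
        + onec e' w (lo e' w y) * ttc e' w (garg w (gi w v) 1) (hi e' w y)
        - ttc e' w (garg w (gi w v) 0) (lo e' w y) * ttc e' w (garg w (gi w v) 1) (hi e' w y))%R
  else Posz ((v < nn w) && (y == v)).

(* [TF d e true] and [TF d e false] are the coefficients of two polynomials   *)
(* [T] and [F]: the node [v] is true exactly if [T] is much larger than [F],  *)
(* and false exactly if [F] is much larger than [T].                          *)
Fixpoint TF d e (s : bool) w (v y : nat) : int :=
  if e is e'.+1 then
    (if ((v < nn w) || (2 < nargs w (gi w v)))%N then
       TF d e' s w v (lo (d + e') w y) * onec (d + e') w (hi (d + e') w y)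
     else if kind w (gi w v) == 0%N then
       TF d e' (~~ s) w (garg w (gi w v) 0) (lo (d + e') w y) * onec (d + e') w (hi (d + e') w y)
     else if (if s then kind w (gi w v) == 1%N else kind w (gi w v) != 1%N) then
       TF d e' s w (garg w (gi w v) 0) (lo (d + e') w y) *
       TF d e' s w (garg w (gi w v) 1) (hi (d + e') w y)
     else
       TF d e' s w (garg w (gi w v) 0) (lo (d + e') w y) *
       TF d e' (~~ s) w (garg w (gi w v) 1) (hi (d + e') w y)
     + TF d e' (~~ s) w (garg w (gi w v) 0) (lo (d + e') w y) *
       TF d e' s w (garg w (gi w v) 1) (hi (d + e') w y)
     + TF d e' s w (garg w (gi w v) 0) (lo (d + e') w y) *
       TF d e' s w (garg w (gi w v) 1) (hi (d + e') w y))%R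
  else
    (if (v < nn w)%N then
       if s then Posz (3 ^ d.+2)%N * ttc d w v y else onec d w y
     else if kind w (gi w v) == 1%N then
       if s then onec d w y else
       Posz (3 ^ d.+2)%N * sumz (nargs w (gi w v)) (fun a => onec d w y - ttc d w (garg w (gi w v) a) y)
     else
       if s then Posz (3 ^ d.+2)%N * sumz (nargs w (gi w v)) (fun a => ttc d w (garg w (gi w v) a) y)
       else onec d w y)%R.

Definition outn w := (nn w + ng w).-1.

Definition qf d w y : int := (TF d d.+1 true w (outn w) y - TF d d.+1 false w (outn w) y)%R.

Lemma bs_poly e : polyf (fun w _ => bs e w).
Proof. by rewrite /bs; apply: polyf_exp; pf. Qed.

Lemma gi_poly x : polyf x -> polyf (fun w E => gi w (x w E)).
Proof. by move=> px; rewrite /gi; apply: polyf_sub => //; apply: nn_poly. Qed.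

Lemma lo_poly e x : polyf x -> polyf (fun w E => lo e w (x w E)).
Proof. by move=> px; rewrite /lo; apply: polyf_mod => //; apply: bs_poly. Qed.

Lemma hi_poly e x : polyf x -> polyf (fun w E => hi e w (x w E)).
Proof. by move=> px; rewrite /hi; apply: polyf_div => //; apply: bs_poly. Qed.

Ltac pf_named ::= first [apply: gi_poly | apply: lo_poly | apply: hi_poly | exact: bs_poly
  | pf_circuit].

Lemma onec_poly e x : polyf x -> polyz (fun w E => onec e w (x w E)).
Proof.
move=> px; apply: (polyz_app2 (F := fun w a _ => onec e w a) _ px px) => {x px}.
elim: e => [|e IH] /=; first by pz.
have onec_app z : polyf z -> polyz (fun w E => onec e w (z w E)).
  by move=> pz; apply: (polyz_app2 (F := fun w a _ => onec e w a) _ pz pz).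
by pz; apply: onec_app; pf.
Qed.

Ltac pz_named ::= apply: onec_poly.

Lemma tt_poly e x y : polyf x -> polyf y -> polyz (fun w E => ttc e w (x w E) (y w E)).
Proof.
move: x y; suff h : polyz (fun w E => ttc e w (head 0 E) (head 0 (behead E))).
  by move=> x y px py; apply: polyz_app2.
elim: e => [|e IH] /=; first by pz.
have ttc_app x y : polyf x -> polyf y -> polyz (fun w E => ttc e w (x w E) (y w E)).
  by move=> px py; apply: polyz_app2.
by do ![pz_step | apply: ttc_app].
Qed.

Ltac pz_named ::= first [apply: onec_poly | apply: tt_poly].

Lemma TF_poly d e s x y : polyf x -> polyf y -> polyz (fun w E => TF d e s w (x w E) (y w E)).
Proof.
move: x y; suff h : polyz (fun w E => TF d e s w (head 0 E) (head 0 (behead E))).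
  by move=> x y px py; apply: polyz_app2.
elim: e s => [|e IH] s.
  by case: s => /=; do ![pz_step].
have TF_app r x y : polyf x -> polyf y -> polyz (fun w E => TF d e r w (x w E) (y w E)).
  by move=> px py; apply: polyz_app2.
by case: s => /=; do ![pz_step | apply: TF_app].
Qed.

Lemma qf_poly d y : polyf y -> polyz (fun w E => qf d w (y w E)).
Proof. by move=> py; rewrite /qf /outn; do ![pz_step | apply: TF_poly]. Qed.

(** * Values at the nodes of a circuit *)

Section Propagate.
Variables (T : Type) (x0 : T) (f : gate -> seq T -> T).

Definition vals (ini : seq T) (gs : seq gate) : seq T :=
  foldl (fun vs g => rcons vs (f g [seq nth x0 vs i | i <- gate_args g])) ini gs.

Lemma size_vals ini gs : size (vals ini gs) = size ini + size gs.
Proof.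
elim: gs ini => [|g gs IH] ini /=; first by rewrite addn0.
by rewrite /vals /= -/(vals _ gs) IH size_rcons addnS.
Qed.

Lemma vals_ini ini gs i : i < size ini -> nth x0 (vals ini gs) i = nth x0 ini i.
Proof.
elim: gs ini => [|g gs IH] ini //= lt.
by rewrite /vals /= -/(vals _ gs) IH ?size_rcons ?ltnS ?(ltnW lt) // nth_rcons lt.
Qed.

Lemma vals_gate ini gs j : wf_gates (size ini) gs -> j < size gs ->
  nth x0 (vals ini gs) (size ini + j) =
  f (nth (GNot 0) gs j) [seq nth x0 (vals ini gs) i | i <- gate_args (nth (GNot 0) gs j)].
Proof.
elim: gs ini j => // g gs IH ini j /= /andP[wg wgs].
rewrite /vals /= -/(vals _ gs); set ini' := rcons _ _.
have sz : size ini' = (size ini).+1 by rewrite size_rcons.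
case: j => [_|j lt] /=; last by rewrite -IH ?sz ?addSnnS.
rewrite addn0 vals_ini ?sz // {1}/ini' nth_rcons ltnn eqxx; congr f.
apply/eq_in_map => i ia; case/and3P: wg => _ /allP/(_ i ia) lt _.
by rewrite vals_ini ?sz ?ltnS ?(ltnW lt) // nth_rcons lt.
Qed.

Lemma propagateE ini gs : 0 < size ini ->
  propagate x0 f ini gs = nth x0 (vals ini gs) (size ini + size gs).-1.
Proof. by move=> lt; rewrite /propagate -/(vals ini gs) -nth_last size_vals. Qed.

End Propagate.

Lemma big_divmod (R : nmodType) K m (G : nat -> R) :
  (\sum_(J < m * K) G J = \sum_(c < m) \sum_(a < K) G (c * K + a)%N)%R.
Proof.
elim: m => [|m IH]; first by rewrite mul0n !big_ord0.
by rewrite mulSnr big_split_ord /= IH big_ord_recr.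
Qed.

(** * Evaluating coefficients at a point *)

Section Xmap.
Variables (K b : nat) (x : nat -> nat).
Hypothesis K0 : 0 < K.
Hypothesis xb : forall j, j < K -> x j < b.

Definition dig B y i := y %/ B ^ i %% B.

(** The tuple [x o J] as a number: [J] is read in base [K], the result in base [b]. *)
Definition Xmap m J := \sum_(i < m) x (dig K J i) * b ^ i.

Lemma Xmap_split m m' J :
  Xmap (m + m') J = Xmap m (J %% K ^ m) + b ^ m * Xmap m' (J %/ K ^ m).
Proof.
rewrite /Xmap big_split_ord /= big_distrr /=; congr (_ + _); apply: eq_bigr => i _.
  congr (x _ * _); rewrite /dig {1}(divn_eq J (K ^ m)).
  have -> : K ^ m = K ^ (m - i.+1) * K * K ^ i.
    by rewrite -expnSr -expnD; congr (_ ^ _); case: i => i /=; lia.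
  by rewrite mulnA divnMDl ?expn_gt0 ?K0 // mulnA modnMDl.
by rewrite [RHS]mulnCA -expnD; congr (x _ * _); rewrite /dig expnD divnMA.
Qed.

Lemma Xmap_lt m J : Xmap m J < b ^ m.
Proof.
elim: m J => [|m IH] J; first by rewrite /Xmap big_ord0.
rewrite -[m.+1]addn1 Xmap_split /Xmap big_ord1 expn0 muln1.
have := IH (J %% K ^ m); have := xb (ltn_pmod (J %/ K ^ m %/ K ^ 0) K0).
rewrite -/(Xmap m _) /dig; set u := x _; set v := Xmap _ _ => h1 h2.
by rewrite addn1 expnS; nia.
Qed.

Local Open Scope ring_scope.

(** For [x] injective on the indices below [K], a tuple of its values is [x o J] for exactly one
    [J]. So this is the value of the polynomial with coefficients [q] when the variables are the
    indicators of the values of [x]. *)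
Definition ev e (q : nat -> int) : int := \sum_(J < (K ^ (2 ^ e))%N) q (Xmap (2 ^ e) J).

(** Halving the digits of [J] halves the tuple [x o J], so the sum factors. *)
Lemma ev_mul e q1 q2 :
  ev e.+1 (fun y => q1 (y %% b ^ (2 ^ e))%N * q2 (y %/ b ^ (2 ^ e))%N) = ev e q1 * ev e q2.
Proof.
rewrite /ev expnS mul2n -addnn expnD; set m := (2 ^ e)%N.
rewrite (big_divmod _ _ (fun J => q1 (Xmap (m + m) J %% b ^ m)%N * q2 (Xmap (m + m) J %/ b ^ m)%N)).
rewrite mulr_suml exchange_big /=; apply: eq_bigr => a _.
rewrite mulr_sumr; apply: eq_bigr => c _.
have lta : (a < K ^ m)%N by []; have ltx := Xmap_lt m a.
rewrite Xmap_split modnMDl divnMDl ?expn_gt0 ?K0 // (modn_small lta) (divn_small lta) addn0.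
by rewrite addnC mulnC modnMDl divnMDl ?(leq_ltn_trans _ ltx) // (modn_small ltx) (divn_small ltx) addn0.
Qed.

Lemma ev_add e q1 q2 : ev e (fun y => q1 y + q2 y) = ev e q1 + ev e q2.
Proof. exact: big_split. Qed.

Lemma ev_opp e q : ev e (fun y => - q y) = - ev e q.
Proof. exact: sumrN. Qed.

Lemma ev_scale e c q : ev e (fun y => c * q y) = c * ev e q.
Proof. by rewrite /ev mulr_sumr. Qed.

Lemma ev_sum e n q : ev e (fun y => sumz n (q^~ y)) = sumz n (fun a => ev e (q a)).
Proof. by rewrite /ev /sumz exchange_big. Qed.

Lemma eq_ev e q1 q2 : q1 =1 q2 -> ev e q1 = ev e q2.
Proof. by move=> eq; apply: eq_bigr => J _. Qed.

End Xmap.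

Lemma eq_sumz n F G : (forall i, i < n -> F i = G i) -> sumz n F = sumz n G.
Proof. by move=> eFG; apply: eq_bigr => i _; apply: eFG. Qed.

(** An approximate truth value; [0 < T + F] makes it unambiguous once [c] exceeds 1. *)
Definition dominates (c : nat) (T F : int) (beta : bool) : Prop :=
  [/\ (0 <= T)%R, (0 <= F)%R, (0 < T + F)%R &
      if beta then (c%:Z * F <= T)%R else (c%:Z * T <= F)%R].

Lemma dominates_neg c T F beta : dominates c T F beta -> dominates c F T (~~ beta).
Proof. by case=> h1 h2 h3 h4; split=> //; [rewrite addrC | case: beta h4]. Qed.

(** If both conjuncts are true, each of the three terms is at most [T1 T2 / (3 c)], which is where
    the factor 3 is spent. If one is false, a single term suffices. *)
Lemma dominates_and c T1 F1 b1 T2 F2 b2 : 0 < c ->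
  dominates (3 * c) T1 F1 b1 -> dominates (3 * c) T2 F2 b2 ->
  dominates c (T1 * T2)%R (F1 * T2 + T1 * F2 + F1 * F2)%R (b1 && b2).
Proof.
move=> c0 [t1 f1 s1 r1] [t2 f2 s2 r2].
have p1 := Num.Theory.mulr_ge0 t1 t2; have p2 := Num.Theory.mulr_ge0 f1 t2.
have p3 := Num.Theory.mulr_ge0 t1 f2; have p4 := Num.Theory.mulr_ge0 f1 f2.
have cz : (0 <= c%:Z)%R by lia.
have c1 : (1 <= c%:Z)%R by lia.
rewrite !PoszM in r1 r2; split=> //; try by lia.
  have := Num.Theory.mulr_gt0 s1 s2.
  by rewrite mulrDl !mulrDr; lia.
case: b1 r1 => /= r1; last first.
  have q1 := Num.Theory.ler_wpM2r t2 r1; have q2 := Num.Theory.mulr_ge0 cz p1.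
  move: q1 q2; rewrite -!mulrA [(T1 * T2)%R]lock; move: (locked _); nia.
case: b2 r2 => /= r2; last first.
  have q1 := Num.Theory.ler_wpM2l t1 r2; have q2 := Num.Theory.mulr_ge0 cz p1.
  have e1 : (T1 * (3 * c%:Z * T2) = 3 * (c%:Z * (T1 * T2)))%R by ring.
  by rewrite e1 in q1; lia.
have q1 := Num.Theory.ler_wpM2r t2 r1.
have q2 := Num.Theory.ler_wpM2l t1 r2.
have q3 := Num.Theory.ler_wpM2r f2 r1.
have e1 : (3 * c%:Z * F1 * T2 = 3 * (c%:Z * (F1 * T2)))%R by ring.
have e2 : (T1 * (3 * c%:Z * F2) = 3 * (c%:Z * (T1 * F2)))%R by ring.
have e3 : (3 * c%:Z * F1 * F2 = 3 * (c%:Z * (F1 * F2)))%R by ring.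
have q4 := Num.Theory.ler_wpM2r p3 c1.
rewrite e1 in q1; rewrite e2 in q2; rewrite e3 in q3; rewrite mul1r in q4.
by rewrite !mulrDr; lia.
Qed.

Lemma dominates_or c T1 F1 b1 T2 F2 b2 : 0 < c ->
  dominates (3 * c) T1 F1 b1 -> dominates (3 * c) T2 F2 b2 ->
  dominates c (F1 * T2 + T1 * F2 + T1 * T2)%R (F1 * F2)%R (b1 || b2).
Proof.
move=> c0 /dominates_neg r1 /dominates_neg r2; have /dominates_neg := dominates_and c0 r1 r2.
rewrite negb_and !negbK.
by rewrite [(T1 * F2 + _)%R]addrC.
Qed.

Lemma wf_gates_nth m gs j : wf_gates m gs -> j < size gs ->
  wf_gate (m + j) (nth (GNot 0) gs j).
Proof.
elim: gs m j => // g gs IH m [|j] /= /andP[wg wgs] lt; first by rewrite addn0.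
by rewrite -addSnnS; apply: IH.
Qed.

Section Semantics.
Variables (n : nat) (gs : seq gate) (k : nat) (x : nat -> nat).
Hypothesis n0 : 0 < n.
Hypothesis wf : wf_gates n gs.
Hypothesis x_inc : forall i j, i < j -> j <= k -> x i < x j.
Hypothesis x_last : x k = n.

Let w := bits_of [:: k, n & flatten [seq gate_code g | g <- gs]].
Let g0 := GNot 0.

Definition asg : seq bool := mkseq (fun v => has (fun j => x j == v) (iota 0 k)) n.

Definition nval v := nth false (vals false gate_val asg gs) v.
Definition dep v :=
  nth 0 (vals 0 (fun _ ds => (\max_(d <- ds) d).+1) (nseq n 0) gs) v.
Definition wft v :=
  nth 0 (vals 0 (fun g ws => large g + \max_(c <- ws) c) (nseq n 0) gs) v.

Lemma x_inj i j : i <= k -> j <= k -> x i = x j -> i = j.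
Proof.
move=> ik jk e; case: (ltngtP i j) => // lt.
  by have := x_inc lt jk; rewrite e ltnn.
by have := x_inc lt ik; rewrite e ltnn.
Qed.

Lemma x_le j : j < k.+1 -> x j < n.+1.
Proof.
rewrite ltnS leq_eqVlt => /orP[/eqP->|lt]; first by rewrite x_last.
by rewrite ltnS -x_last ltnW // x_inc.
Qed.

Let EV := ev k.+1 n.+1 x.

Lemma EV_mul e q1 q2 :
  EV e.+1 (fun y => (q1 (lo e w y) * q2 (hi e w y))%R) = (EV e q1 * EV e q2)%R.
Proof. by rewrite /EV -(ev_mul (ltn0Sn k) x_le) /lo /hi /bs nnE. Qed.

Lemma EV0 v : v <= n ->
  EV 0 (fun y => Posz (y == v)) = Posz (has (fun j => x j == v) (iota 0 k.+1)).
Proof.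
move=> vn; rewrite /EV /ev expn0 expn1.
under eq_bigr => J _ do rewrite /Xmap big_ord1 expn0 muln1 /dig expn0 divn1 modn_small //.
rewrite -(big_morph Posz PoszD (erefl (Posz 0))); congr Posz.
case: hasP => [[j]|nj].
  rewrite mem_iota add0n => /andP[_ lt] /eqP <-.
  rewrite (bigD1 (Ordinal lt)) //= eqxx big1 // => i /eqP ni.
  case: eqP => // /x_inj e; case: ni; apply: ord_inj => /=.
  by apply: e; rewrite -ltnS.
rewrite big1 // => i _; case: eqP => // e; case: nj; exists (nat_of_ord i).
  by rewrite mem_iota /=.
exact/eqP.
Qed.

Lemma EV_one e : EV e (onec e w) = 1%R.
Proof.
elim: e => [|e IH]; last first.
  by rewrite [LHS](_ : _ = (EV e (onec e w) * EV e (onec e w))%R); [rewrite IH | rewrite -EV_mul].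
rewrite [LHS](_ : _ = EV 0 (fun y => Posz (y == n))); last first.
  by apply: eq_ev => y; rewrite /= nnE.
by rewrite EV0 // (_ : has _ _) //; apply/hasP; exists k; rewrite ?x_last // mem_iota add0n /=.
Qed.

Lemma size_asg : size asg = n. Proof. by rewrite size_mkseq. Qed.

Lemma nval_input v : v < n -> nval v = has (fun j => x j == v) (iota 0 k).
Proof. by move=> lt; rewrite /nval vals_ini ?size_asg // nth_mkseq. Qed.

Lemma EV_input v : v < n -> EV 0 (ttc 0 w v) = Posz (nval v).
Proof.
move=> lt; rewrite [LHS](_ : _ = EV 0 (fun y => Posz (y == v))); last first.
  by apply: eq_ev => y; rewrite /= nnE lt.
rewrite EV0 ?(ltnW lt) // nval_input // -[k.+1]addn1 iotaD has_cat /= x_last.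
by rewrite [n == v]eq_sym (ltn_eqF lt) !orbF.
Qed.

Lemma nval_gate j : j < size gs ->
  nval (n + j) = gate_val (nth g0 gs j) [seq nval i | i <- gate_args (nth g0 gs j)].
Proof. by move=> lt; rewrite /nval -{1}size_asg vals_gate ?size_asg. Qed.

Lemma dep_gate j : j < size gs ->
  dep (n + j) = (\max_(d <- [seq dep i | i <- gate_args (nth g0 gs j)]) d).+1.
Proof.
move=> lt; have := @vals_gate _ 0 (fun _ ds => (\max_(d <- ds) d).+1) (nseq n 0) gs j.
by rewrite size_nseq; apply.
Qed.

Lemma wft_gate j : j < size gs ->
  wft (n + j) = large (nth g0 gs j) + \max_(d <- [seq wft i | i <- gate_args (nth g0 gs j)]) d.
Proof.
move=> lt; have := @vals_gate _ 0 (fun g ws => large g + \max_(c <- ws) c) (nseq n 0) gs j.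
by rewrite size_nseq; apply.
Qed.

Lemma arg_below j i : j < size gs -> i \in gate_args (nth g0 gs j) ->
  [/\ i < n + size gs, dep i < dep (n + j) & wft i + (2 < nargs w j) <= wft (n + j)].
Proof.
move=> lt ia; split.
- have /and3P[_ /allP/(_ i ia) h _] := wf_gates_nth wf lt.
  by apply: leq_trans h _; rewrite leq_add2l ltnW.
- by rewrite dep_gate // ltnS big_map (leq_bigmax_seq i).
by rewrite wft_gate // nargsE // addnC leq_add2l big_map (leq_bigmax_seq i).
Qed.

Lemma node_case v : v < n + size gs ->
  v < n \/ exists2 j, j < size gs & [/\ v = n + j, (v < n) = false & gi w v = j].
Proof.
move=> lt; case: (ltnP v n) => h; [by left | right].
by exists (v - n); [lia | rewrite /gi nnE; split; lia].
Qed.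

Variant small_spec j : nat -> Prop :=
  | SmallNot u of garg w j 0 = u & nval (n + j) = ~~ nval u
      & u \in gate_args (nth g0 gs j) : small_spec j 0
  | SmallAnd u1 u2 of garg w j 0 = u1 & garg w j 1 = u2 & nval (n + j) = nval u1 && nval u2
      & u1 \in gate_args (nth g0 gs j) & u2 \in gate_args (nth g0 gs j) : small_spec j 1
  | SmallOr u1 u2 of garg w j 0 = u1 & garg w j 1 = u2 & nval (n + j) = nval u1 || nval u2
      & u1 \in gate_args (nth g0 gs j) & u2 \in gate_args (nth g0 gs j) : small_spec j 2.

Lemma smallP j : j < size gs -> (2 < nargs w j) = false -> small_spec j (kind w j).
Proof.
move=> lt; rewrite nargsE // kindE //; have := wf_gates_nth wf lt.
have := nval_gate lt; have gE := gargE k n lt.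
case e: (nth g0 gs j) gE => [i|l|l] /= gE vE /and3P[_ _ sz] small.
- by apply: SmallNot vE _; rewrite ?gE // e inE.
- case: l e gE vE sz small => [|u1 [|u2 [|u3 l]]] //= e gE vE _ _; rewrite andbT in vE.
  by apply: SmallAnd vE _ _; rewrite ?gE // e !inE eqxx ?orbT.
case: l e gE vE sz small => [|u1 [|u2 [|u3 l]]] //= e gE vE _ _; rewrite orbF in vE.
by apply: SmallOr vE _ _; rewrite ?gE // e !inE eqxx ?orbT.
Qed.

(** At weft 0 all gates below are small, and [1 - a], [a b] and [a + b - a b] compute them exactly
    on 0 and 1; each level doubles the degree. *)
Lemma EV_tt e v : v < n + size gs -> dep v <= e -> wft v = 0 ->
  EV e (ttc e w v) = Posz (nval v).
Proof.
elim: e v => [|e IH] v lt de wv.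
  case: (node_case lt) => [/EV_input //|[j lj [vE _ _]]].
  by move: de; rewrite vE dep_gate.
case: (node_case lt) => [vn|[j lj [vE nv gv]]].
  rewrite [LHS](_ : _ = (EV e (ttc e w v) * EV e (onec e w))%R).
    by rewrite EV_one mulr1 IH // /dep vals_ini ?size_nseq // nth_nseq vn.
  by rewrite -EV_mul; apply: eq_ev => y /=; rewrite nnE vn.
have sm : (2 < nargs w j) = false.
  by move: wv; rewrite vE wft_gate // nargsE // /large; case: (2 < _).
have IHu u : u \in gate_args (nth g0 gs j) -> EV e (ttc e w u) = Posz (nval u).
  move=> /(arg_below lj)[h1 h2 h3]; apply: IH => //; first by rewrite vE in de; lia.
  by rewrite -vE wv in h3; lia.
case E: (kind w j) / (smallP lj sm) => [u ga vu ua|u1 u2 ga gb vu ua ub|u1 u2 ga gb vu ua ub].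
- rewrite [LHS](_ : _ = (EV e (fun y => onec e w y - ttc e w u y)%R * EV e (onec e w))%R).
    rewrite /EV ev_add ev_opp -/EV !EV_one mulr1 IHu // vE vu.
    by case: (nval u).
  by rewrite -EV_mul; apply: eq_ev => y /=; rewrite nnE nv gv E ga.
- rewrite [LHS](_ : _ = (EV e (ttc e w u1) * EV e (ttc e w u2))%R).
    by rewrite !IHu // vE vu; case: (nval u1); case: (nval u2).
  by rewrite -EV_mul; apply: eq_ev => y /=; rewrite nnE nv gv E ga gb.
rewrite [LHS](_ : _ = (EV e (ttc e w u1) * EV e (onec e w) + EV e (onec e w) * EV e (ttc e w u2)
    - EV e (ttc e w u1) * EV e (ttc e w u2))%R).
  by rewrite !IHu // EV_one vE vu; case: (nval u1); case: (nval u2).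
rewrite -!EV_mul /EV -ev_add -ev_opp -ev_add; apply: eq_ev => y /=.
by rewrite nnE nv gv E ga gb.
Qed.

Lemma sumz_ge0 m (F : nat -> int) : (forall a, a < m -> (0 <= F a)%R) -> (0 <= sumz m F)%R.
Proof. by move=> h; apply: Num.Theory.sumr_ge0 => i _; apply: h. Qed.

Lemma sumz_ge1 m (F : nat -> int) a : (forall a, a < m -> (0 <= F a)%R) ->
  a < m -> (1 <= F a)%R -> (1 <= sumz m F)%R.
Proof.
move=> h lt h1; rewrite /sumz (bigD1 (Ordinal lt)) //=.
apply: Order.POrderTheory.le_trans h1 _; rewrite Num.Theory.lerDl.
by apply: Num.Theory.sumr_ge0 => i _; apply: h.
Qed.

(** The number of witnesses times [c] is either 0 or at least [c], to be compared with 1. *)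
Lemma dominates_exists c m (p : nat -> bool) beta : 0 < c ->
  reflect (exists2 a, a < m & p a) beta ->
  dominates c (Posz c * sumz m (fun a => Posz (p a)))%R 1%R beta.
Proof.
move=> c0 pP; have s0 : (0 <= sumz m (fun a => Posz (p a)))%R by apply: sumz_ge0.
have cs := Num.Theory.mulr_ge0 (isT : 0 <= Posz c)%R s0.
split=> //; first by lia.
case: pP => [[a la pa]|np].
  by apply: Num.Theory.ler_wpM2l => //; apply: (@sumz_ge1 _ _ a) => //; rewrite pa.
rewrite (_ : sumz _ _ = 0%R) ?mulr0 // /sumz big1 // => a _.
by case: (boolP (p a)) => // pa; case: np; exists (nat_of_ord a).
Qed.

(** The children of a large gate of weft at most 1 have weft 0, so [EV_tt] gives their values. A
    disjunction counts its true children, a conjunction its false ones. *)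
Lemma TF0_large d j : j < size gs -> 2 < nargs w j -> dep (n + j) <= d.+1 -> wft (n + j) <= 1 ->
  dominates (3 ^ d.+2) (EV d (TF d 0 true w (n + j))) (EV d (TF d 0 false w (n + j))) (nval (n + j)).
Proof.
move=> lj lg dj wj.
have nv : (n + j < n) = false by lia.
have gv : gi w (n + j) = j by rewrite /gi nnE; lia.
set g := nth g0 gs j.
have sz : nargs w j = size (gate_args g) by rewrite nargsE.
have ga a : a < nargs w j -> garg w j a \in gate_args g.
  by move=> la; rewrite gargE -?sz // mem_nth -?sz.
have IHa a : a < nargs w j -> EV d (ttc d w (garg w j a)) = Posz (nval (garg w j a)).
  move=> la; have [h1 h2 h3] := arg_below lj (ga a la).
  by rewrite lg in h3; apply: EV_tt => //; lia.
have c0 : 0 < 3 ^ d.+2 by rewrite expn_gt0.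
have hasE (p : pred nat) : reflect (exists2 a, a < nargs w j & p (garg w j a)) (has p (gate_args g)).
  have gaE a : a < nargs w j -> garg w j a = nth 0 (gate_args g) a.
    by move=> la; rewrite gargE -?sz.
  apply: (iffP (has_nthP 0)) => -[a la pa]; exists a.
  - by rewrite sz.
  - by rewrite gaE // sz.
  - by rewrite -sz.
  by rewrite -gaE.
have [kE|kE] : (kind w j == 1) = true /\ nval (n + j) = all nval (gate_args g) \/
               (kind w j == 1) = false /\ nval (n + j) = has nval (gate_args g).
- have := lg; rewrite sz kindE // nval_gate // -/g.
  by case: g {sz ga hasE} => [i|l|l] //= _; [left|right]; rewrite ?all_map ?has_map.
- case: kE => kE ->.
  have -> : EV d (TF d 0 true w (n + j)) = 1%R.
    by rewrite -(EV_one d); apply: eq_ev => y; rewrite /= nnE nv gv kE.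
  have -> : EV d (TF d 0 false w (n + j)) =
      (Posz (3 ^ d.+2)%N * sumz (nargs w j) (fun a => Posz (~~ nval (garg w j a))))%R.
    rewrite [LHS](_ : _ = EV d (fun y => Posz (3 ^ d.+2)%N * sumz (nargs w j) (fun a => onec d w y - ttc d w (garg w j a) y))%R); last first.
      by apply: eq_ev => y; rewrite [LHS]/= nnE nv gv kE.
    rewrite /EV ev_scale (ev_sum _ _ _ _ _ (fun a y => onec d w y - ttc d w (garg w j a) y)%R).
    congr (_ * _)%R; apply: eq_sumz => a la.
    by rewrite ev_add ev_opp -/EV EV_one IHa //; case: (nval _).
  rewrite -[all _ _]negbK -has_predC; apply: dominates_neg.
  exact: dominates_exists (hasE (predC nval)).
case: kE => kE ->.
have -> : EV d (TF d 0 false w (n + j)) = 1%R.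
  by rewrite -(EV_one d); apply: eq_ev => y; rewrite /= nnE nv gv kE.
have -> : EV d (TF d 0 true w (n + j)) =
    (Posz (3 ^ d.+2)%N * sumz (nargs w j) (fun a => Posz (nval (garg w j a))))%R.
  rewrite [LHS](_ : _ = EV d (fun y => Posz (3 ^ d.+2)%N * sumz (nargs w j) (fun a => ttc d w (garg w j a) y))%R); last first.
    by apply: eq_ev => y; rewrite [LHS]/= nnE nv gv kE.
  rewrite /EV ev_scale (ev_sum _ _ _ _ _ (fun a y => ttc d w (garg w j a) y)%R).
  by congr (_ * _)%R; apply: eq_sumz => a la; apply: IHa.
exact: dominates_exists (hasE nval).
Qed.

Local Notation ET d e s v := (EV (d + e) (TF d e s w v)).
Local Notation ET1 d e s v := (EV (d + e).+1 (TF d e.+1 s w v)).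

(** Inputs and large gates start with gap [3 ^ d.+2] and are only padded to higher degrees; each
    level of small gates costs at most a factor 3. *)
Lemma TF_dominates d e v : v < n + size gs -> dep v <= d.+1 -> wft v <= 1 -> e <= d.+1 ->
  [|| v < n, 2 < nargs w (v - n) | dep v <= e] ->
  dominates (3 ^ (d.+2 - e)) (ET d e true v) (ET d e false v) (nval v).
Proof.
elim: e v => [|e IH] v lt dv wv le.
  rewrite addn0 subn0; case: (node_case lt) => [vn _|[j lj [vE nv gv]]]; last first.
    by move: dv wv; rewrite vE addKn => dv wv; case/or3P=> h; [lia| exact: TF0_large | move: h; rewrite dep_gate].
  have -> : EV d (TF d 0 false w v) = 1%R.
    by rewrite -(EV_one d); apply: eq_ev => y; rewrite /= nnE vn.
  rewrite [EV d _](_ : _ = (Posz (3 ^ d.+2)%N * EV d (ttc d w v))%R); last first.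
    by rewrite /EV -ev_scale; apply: eq_ev => y; rewrite [LHS]/= nnE vn.
  rewrite EV_tt //; try by rewrite /dep /wft vals_ini ?size_nseq // nth_nseq vn.
  have : 0 < 3 ^ d.+2 by rewrite expn_gt0.
  by split; case: (nval v); lia.
move=> cond; rewrite addnS.
have lift s u : EV (d + e).+1 (fun y => (TF d e s w u (lo (d + e) w y) * onec (d + e) w (hi (d + e) w y))%R)
    = ET d e s u.
  by rewrite EV_mul EV_one mulr1.
have weak T F beta : dominates (3 ^ (d.+2 - e)) T F beta -> dominates (3 ^ (d.+2 - e.+1)) T F beta.
  move=> [h1 h2 h3 h4]; split=> //.
  have lep : (Posz (3 ^ (d.+2 - e.+1)) <= Posz (3 ^ (d.+2 - e)))%R.
    by rewrite lez_nat leq_exp2l //; lia.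
  by case: beta h4 => h4; apply: Order.POrderTheory.le_trans h4; apply: Num.Theory.ler_wpM2r.
case c1: ((v < n) || (2 < nargs w (v - n))).
  rewrite -[ET1 d e true v](_ : ET d e true v = _); last first.
    by rewrite -lift; apply: eq_ev => y; rewrite [RHS]/= /gi nnE c1.
  rewrite -[ET1 d e false v](_ : ET d e false v = _); last first.
    by rewrite -lift; apply: eq_ev => y; rewrite [RHS]/= /gi nnE c1.
  by apply: weak; apply: IH => //; [lia | rewrite orbA c1].
move: cond; rewrite orbA c1 /= => de.
case: (node_case lt) => [vn|[j lj [vE nv gv]]]; first by rewrite vn in c1.
have sm : (2 < nargs w j) = false by move: c1; rewrite nv vE addKn.
have IHu u : u \in gate_args (nth g0 gs j) ->
    dominates (3 * 3 ^ (d.+2 - e.+1)) (ET d e true u) (ET d e false u) (nval u).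
  move=> /(arg_below lj)[h1 h2 h3]; rewrite -expnS (_ : (_ - _).+1 = d.+2 - e); last by lia.
  by rewrite vE in dv wv de; apply: IH => //; try lia; rewrite (_ : dep u <= e) ?orbT //; lia.
have c0 : 0 < 3 ^ (d.+2 - e.+1) by rewrite expn_gt0.
have TFE s q : (forall y, TF d e.+1 s w (n + j) y = q y) -> ET1 d e s v = EV (d + e).+1 q.
  by rewrite vE; apply: eq_ev.
have c2 : ((n + j < n) || (2 < nargs w j)) = false by rewrite sm orbF; lia.
rewrite vE in gv.
case E: (kind w j) / (smallP lj sm) => [u ga vu ua|u1 u2 ga gb vu ua ub|u1 u2 ga gb vu ua ub].
- have TFE' s : ET1 d e s v = ET d e (~~ s) u.
    by rewrite -lift; apply: TFE => y; rewrite [LHS]/= nnE gv c2 E ga.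
  rewrite !TFE' vE vu; apply: dominates_neg; apply: weak.
  by have := IHu _ ua; rewrite -expnS (_ : (_ - _).+1 = d.+2 - e) //; lia.
- have -> : ET1 d e true v = (ET d e true u1 * ET d e true u2)%R.
    by rewrite -EV_mul; apply: TFE => y; rewrite [LHS]/= nnE gv c2 E ga gb.
  have -> : ET1 d e false v = (ET d e false u1 * ET d e true u2
      + ET d e true u1 * ET d e false u2
      + ET d e false u1 * ET d e false u2)%R.
    by rewrite -!EV_mul /EV -!ev_add; apply: TFE => y; rewrite [LHS]/= nnE gv c2 E ga gb.
  by rewrite vE vu; apply: dominates_and => //; apply: IHu.
have -> : ET1 d e false v = (ET d e false u1 * ET d e false u2)%R.
  by rewrite -EV_mul; apply: TFE => y; rewrite [LHS]/= nnE gv c2 E ga gb.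
have -> : ET1 d e true v = (ET d e true u1 * ET d e false u2
    + ET d e false u1 * ET d e true u2
    + ET d e true u1 * ET d e true u2)%R.
  by rewrite -!EV_mul /EV -!ev_add; apply: TFE => y; rewrite [LHS]/= nnE gv c2 E ga gb.
rewrite vE vu [X in dominates _ (X + _)%R]addrC; apply: dominates_or => //; exact: IHu.
Qed.

(** After [d.+1] levels a gap of 3 is left, enough to decide the sign of [T - F]. *)
Lemma EV_qf d : dep (n + size gs).-1 <= d -> wft (n + size gs).-1 <= 1 ->
  (0 < EV (d + d.+1) (qf d w))%R = nval (n + size gs).-1.
Proof.
set o := (n + size gs).-1 => doo wo.
have lt : o < n + size gs by rewrite /o; lia.
have -> : EV (d + d.+1) (qf d w) = (EV (d + d.+1) (TF d d.+1 true w o) - EV (d + d.+1) (TF d d.+1 false w o))%R.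
  by rewrite /EV -ev_opp -ev_add; apply: eq_ev => y; rewrite /qf /outn nnE ngE.
have [] : dominates (3 ^ (d.+2 - d.+1)) (EV (d + d.+1) (TF d d.+1 true w o)) (EV (d + d.+1) (TF d d.+1 false w o)) (nval o).
  by apply: TF_dominates => //; try lia; apply/or3P; apply: Or33; lia.
by rewrite subSnn expn1; case: (nval o); lia.
Qed.

End Semantics.

(** * Exact packing into few bins *)

Lemma sum_expn_recl m B (f : nat -> nat) :
  \sum_(i < m.+1) f i * B ^ i = (\sum_(i < m) f i.+1 * B ^ i) * B + f 0.
Proof.
rewrite big_ord_recl expn0 muln1 addnC big_distrl; congr (_ + _).
by apply: eq_bigr => i _; rewrite /= /bump /= add1n expnS mulnCA mulnC.
Qed.

Lemma dig_sum m B (f : nat -> nat) i : (forall i, i < m -> f i < B) -> i < m ->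
  (\sum_(t < m) f t * B ^ t) %/ B ^ i %% B = f i.
Proof.
elim: m f i => // m IH f i fB lt; rewrite sum_expn_recl.
have B0 : 0 < B by apply: leq_ltn_trans (fB 0 isT).
case: i lt => [|i] lt; first by rewrite expn0 divn1 modnMDl modn_small ?fB.
rewrite expnS divnMA divnMDl // (divn_small (fB 0 isT)) addn0.
by rewrite (IH (fun i => f i.+1)) // => j lj; apply: fB.
Qed.

Lemma digits_inj m B (f g : nat -> nat) :
  (forall i, i < m -> f i < B) -> (forall i, i < m -> g i < B) ->
  \sum_(i < m) f i * B ^ i = \sum_(i < m) g i * B ^ i -> forall i, i < m -> f i = g i.
Proof. by move=> fB gB e i li; rewrite -(dig_sum fB li) e dig_sum. Qed.

Lemma sum_nat_eq0P (T : finType) (F : T -> nat) :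
  \sum_t F t = 0 -> forall t, F t = 0.
Proof. by move=> /eqP; rewrite sum_nat_eq0 => /forallP h t; have /eqP := h t. Qed.

(* The weighted variance of [p] around [c] vanishes.                          *)
Lemma variance0 (T : finType) (f p : T -> nat) c :
  \sum_t f t * p t = c * \sum_t f t -> \sum_t f t * p t ^ 2 = c ^ 2 * \sum_t f t ->
  forall t, 0 < f t -> p t = c.
Proof.
move=> e1 e2 t ft.
pose z t' := (Posz (f t') * ((Posz (p t') - Posz c) * (Posz (p t') - Posz c)))%R.
have z_ge0 t' : true -> (0 <= z t')%R.
  by move=> _; apply: Num.Theory.mulr_ge0 => //; rewrite -expr2 Num.Theory.sqr_ge0.
have : (\sum_t z t = 0)%R.
  have zE t' : z t' = (Posz (f t' * p t' ^ 2) - Posz (2 * c) * Posz (f t' * p t')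
      + Posz (c ^ 2) * Posz (f t'))%R.
    by rewrite /z -!mulnn !PoszM; ring.
  rewrite (eq_bigr _ (fun t' _ => zE t')) !big_split /= sumrN -!mulr_sumr.
  rewrite -!(big_morph Posz PoszD (erefl (Posz 0))) e1 e2 -mulnn !PoszM.
  by ring.
move/(Num.Theory.psumr_eq0P z_ge0)/(_ t isT)/eqP; rewrite !mulf_eq0 subr_eq0.
by case/orP => [|/orP[] /eqP[]] //; lia.
Qed.

Lemma sum_pred1 m (F : nat -> nat) a : a < m ->
  \sum_(u < m) (u == a :> nat) * F u = F a.
Proof.
move=> lt; rewrite (bigD1 (Ordinal lt)) //= eqxx mul1n big1 ?addn0 // => i.
by rewrite -val_eqE /= => /negbTE ->.
Qed.

Lemma sum_predC1 m (F : nat -> nat) a : a < m ->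
  \sum_(u < m) (u != a :> nat) * F u + F a = \sum_(u < m) F u.
Proof.
move=> lt; rewrite -[X in _ + X](sum_pred1 F lt) -big_split /=; apply: eq_bigr => i _.
by case: eqP => _; rewrite /= ?mul1n ?mul0n ?addn0.
Qed.

Lemma unique_miss m (p : nat -> bool) : 0 < m -> \sum_(u < m) (p u : nat) = m.-1 ->
  exists2 a, a < m & forall u, u < m -> p u = (u != a).
Proof.
move=> m0 e.
have e1 : \sum_(u < m) (~~ p u : nat) = 1.
  have : \sum_(u < m) (~~ p u : nat) + \sum_(u < m) (p u : nat) = m.
    rewrite -big_split /= -[RHS]card_ord -sum1_card; apply: eq_bigr => i _.
    by case: (p i).
  by rewrite e; lia.
have /existsP[a na] : [exists a : 'I_m, ~~ p a].
  apply: contra_eqT e1 => /existsPn h; rewrite big1 // => i _.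
  by have := h i; case: (p i).
exists (nat_of_ord a) => // u lt.
move: e1; rewrite (bigD1 a) //= na /= add1n => -[/eqP]; rewrite sum_nat_eq0 => /forallP.
case: eqP => [->|/eqP ua] h; first exact: negbTE.
by have := h (Ordinal lt); rewrite -val_eqE /= ua /=; case: (p u).
Qed.

Lemma sum_nat_block m K (G : nat -> nat) :
  \sum_(J < m * K) G J = \sum_(c < m) \sum_(a < K) G (c * K + a).
Proof. exact: (big_divmod K m G). Qed.

(** Capping the exponent at a constant keeps this function polynomially bounded. *)
Definition pw c B i := B ^ minn i c.

Lemma pwE c B i : i <= c -> pw c B i = B ^ i.
Proof. by move=> le; rewrite /pw (minn_idPl le). Qed.

(** * The packing instance *)

Section Packing.
Variables (K1 b D : nat).
Hypothesis K0 : 0 < K1.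
Hypothesis b1 : 1 < b.
Hypothesis D0 : 0 < D.

Definition pKD := K1 ^ D.
Definition pbD := b ^ D.
Let KD := pKD.
Let bD := pbD.
Definition pZ := KD + K1.
Let Z := pZ.

Definition dg1 J i := J %/ pw D K1 i %% K1.
(** Block [J * D.+1 + i] belongs to coordinate [i < D] of [J], or to the whole tuple if [i = D];
    block [KD * D.+1 + j] belongs to [x_j]. The bins are [J] for U_J, [KD + j] for X_j, and [Z]. *)
Definition isv blk := KD * D.+1 <= blk.
Definition bj blk := blk - KD * D.+1.
Definition bJ blk := blk %/ D.+1.
Definition bi blk := blk %% D.+1.

(** Intended destination of all items of a block but the selected one, which goes to [sel]. *)
Definition uns blk := if isv blk then Z else bJ blk.
Definition sel blk :=
  if isv blk then KD + bj blk else
  if bi blk == D then Z else KD + dg1 (bJ blk) (bi blk).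

(** The base [bD.+1] exceeds the number of items in a block, so the weight of a bin shows how many
    items each block contributes. *)
Definition tau blk := if isv blk then 1 else pw D.+1 bD.+1 (bi blk).+1.
(** Labels: [pcl] tells the bins U_J apart, [qcl] the bins X_j; [KD] and [K1] mark blocks that
    belong to none of them. *)
Definition pcl blk := if isv blk then KD else bJ blk.
Definition qcl blk :=
  if isv blk then bj blk else
  if bi blk == D then K1 else dg1 (bJ blk) (bi blk).

(** The total weight of the coordinates with index [j]: with this factor the single item for [x_j]
    balances all their items in X_j. *)
Definition Rw j := sumf KD (fun J => sumf D (fun i => (dg1 J i == j) * pw D b i)).

(** Coordinate items carry the complement [bD - u]. In X_j it balances [Rw j * u]; in U_J, where
    exactly the selected items are missing, the factors [b ^ i] make it balance the number of the
    tuple. *)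
Definition v1 blk u :=
  if isv blk then Rw (bj blk) * u else
  if bi blk == D then u else (bD - u) * pw D b (bi blk).

(** Second moments. A tuple takes the squares of its digits, so that U_J stays balanced. *)
Definition v2 blk u :=
  if isv blk then Rw (bj blk) * u ^ 2 else
  if bi blk == D then sumf D (fun i => (u %/ pw D b i %% b) ^ 2 * pw D b i)
  else (bD ^ 2 - u ^ 2) * pw D b (bi blk).

Definition dg c blk u : nat :=
  nth 0 [:: tau blk; tau blk * pcl blk; tau blk * pcl blk ^ 2;
            tau blk * qcl blk; tau blk * qcl blk ^ 2; v1 blk u; v2 blk u] c.

Definition NB := KD * D.+1 + K1.
(** The reference filling, with all selected values 0; its loads become the capacities. *)
Definition phi0 blk u := if u == 0 then sel blk else uns blk.

Definition binsum (phi : nat -> nat -> nat) (F : nat -> nat -> nat) bin :=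
  \sum_(blk < NB) \sum_(u < bD) (phi blk u == bin) * F blk u.

Definition dsum (phi : nat -> nat -> nat) c bin :=
  \sum_(blk < NB) \sum_(u < bD) (phi blk u == bin) * dg c blk u.

Definition jb J i := J * D.+1 + i.
Definition vb j := KD * D.+1 + j.

Lemma bD1 : 1 < bD. Proof. by rewrite -(expn0 b) ltn_exp2l. Qed.

Lemma jbE J i : J < KD -> i <= D -> [/\ isv (jb J i) = false, bJ (jb J i) = J & bi (jb J i) = i].
Proof.
move=> lJ li; rewrite /isv /bJ /bi /jb; split.
- have le : J.+1 * D.+1 <= KD * D.+1 by rewrite leq_mul2r lJ orbT.
  by apply/negbTE; rewrite -ltnNge; apply: leq_trans le; rewrite mulSn addnC ltn_add2r ltnS.
- by rewrite divnMDl // divn_small // addn0.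
by rewrite modnMDl modn_small.
Qed.

Lemma vbE j : isv (vb j) /\ bj (vb j) = j.
Proof. by rewrite /isv /bj /vb leq_addr addKn. Qed.

Lemma sum_NB (F : nat -> nat) : \sum_(blk < NB) F blk =
  \sum_(J < KD) \sum_(i < D.+1) F (jb J i) + \sum_(j < K1) F (vb j).
Proof. by rewrite /NB big_split_ord /= sum_nat_block. Qed.

Lemma NB_ind (P : nat -> Prop) : (forall J i, J < KD -> i <= D -> P (jb J i)) ->
  (forall j, j < K1 -> P (vb j)) -> forall blk, blk < NB -> P blk.
Proof.
move=> hJ hv blk lt; case: (ltnP blk (KD * D.+1)) => h.
  rewrite (divn_eq blk D.+1); apply: hJ; first by rewrite ltn_divLR.
  by rewrite -ltnS ltn_pmod.
by rewrite -(subnKC h); apply: hv; rewrite /NB in lt; lia.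
Qed.

Lemma dg1_lt J i : dg1 J i < K1. Proof. by rewrite ltn_mod. Qed.

Lemma phi0_J J i u : J < KD -> i <= D ->
  phi0 (jb J i) u = if u == 0 then (if i == D then Z else KD + dg1 J i) else J.
Proof. by move=> lJ li; rewrite /phi0 /sel /uns; have [-> -> ->] := jbE lJ li. Qed.

Lemma phi0_v j u : phi0 (vb j) u = if u == 0 then KD + j else Z.
Proof. by rewrite /phi0 /sel /uns; have [-> ->] := vbE j. Qed.

Lemma tau_gt0 blk : 0 < tau blk.
Proof. by rewrite /tau; case: ifP => // _; rewrite expn_gt0. Qed.

(** In the reference filling the label is constantly [c] on this bin. Equal weight and moments
    transfer mean [c] and variance 0 to [phi]. *)
Lemma variance_bin phi bin c (cl : nat -> nat) a :
  (forall blk u, dg a blk u = tau blk * cl blk) ->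
  (forall blk u, dg a.+1 blk u = tau blk * cl blk ^ 2) ->
  dsum phi 0 bin = dsum phi0 0 bin -> dsum phi a bin = dsum phi0 a bin ->
  dsum phi a.+1 bin = dsum phi0 a.+1 bin ->
  (forall blk u, blk < NB -> u < bD -> phi0 blk u = bin -> cl blk = c) ->
  forall blk u, blk < NB -> u < bD -> phi blk u = bin -> cl blk = c.
Proof.
move=> d1 d2 e0 e1 e2 h0 blk u lb lu pb.
pose f (t : 'I_NB * 'I_bD) := (phi t.1 t.2 == bin) * tau t.1.
have SE g k : (forall blk u, dg k blk u = tau blk * g blk) ->
    dsum phi k bin = \sum_t f t * g t.1.
  move=> dk; rewrite /dsum pair_bigA /=; apply: eq_bigr => -[B U] _ /=.
  by rewrite dk mulnA.
have S0 g k : (forall blk u, dg k blk u = tau blk * g (cl blk)) ->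
    dsum phi0 k bin = g c * dsum phi0 0 bin.
  move=> dk; rewrite /dsum big_distrr /=; apply: eq_bigr => B _.
  rewrite big_distrr /=; apply: eq_bigr => U _; rewrite dk.
  case: eqP => [e|_]; last by rewrite muln0.
  by rewrite (h0 _ _ _ _ e) // /dg /= !mul1n mulnC.
have sf : \sum_t f t = dsum phi 0 bin.
  by rewrite (SE (fun _ => 1)) => [|B U]; [apply: eq_bigr => t _; rewrite muln1 | rewrite muln1].
apply: (@variance0 _ f (fun t => cl t.1) c _ _ (Ordinal lb, Ordinal lu)).
- by rewrite -(SE cl a) // e1 sf e0 (S0 id).
- by rewrite -(SE (fun B => cl B ^ 2) a.+1) // e2 sf e0 (S0 (fun x => x ^ 2)).
by rewrite /f /= pb eqxx mul1n tau_gt0.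
Qed.

Definition struct phi h x :=
  (forall J i u, J < KD -> i <= D -> u < bD ->
     phi (jb J i) u = if u == h J i then (if i == D then Z else KD + dg1 J i) else J) /\
  (forall j u, j < K1 -> u < bD -> phi (vb j) u = if u == x j then KD + j else Z).

Lemma struct0 : struct phi0 (fun _ _ => 0) (fun _ => 0).
Proof. by split=> [J i u lJ li lu|j u lj lu]; [apply: phi0_J | apply: phi0_v]. Qed.

Definition inr_h (h : nat -> nat -> nat) (x : nat -> nat) :=
  (forall J i, J < KD -> i <= D -> h J i < bD) /\ (forall j, j < K1 -> x j < bD).

Lemma inr_h0 : inr_h (fun _ _ => 0) (fun=> 0).
Proof. by split=> *; apply: ltnW bD1. Qed.

(** U_J receives from the blocks of [J] everything but the selected items, and nothing from
    elsewhere. *)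
Lemma struct_U phi h x c J : struct phi h x -> inr_h h x -> J < KD ->
  dsum phi c J + \sum_(i < D.+1) dg c (jb J i) (h J i) = \sum_(i < D.+1) \sum_(u < bD) dg c (jb J i) u.
Proof.
move=> [sJ sv] [hb xb] lJ.
rewrite /dsum (sum_NB (fun blk => \sum_(u < bD) (phi blk u == J) * dg c blk u)) [X in _ + X + _]big1 ?addn0; last first.
  move=> j _; rewrite big1 // => u _; rewrite sv // (_ : (_ == J) = false) //.
  by case: ifP => _; rewrite /Z /pZ; lia.
rewrite (bigD1 (Ordinal lJ)) //= [X in _ + X + _]big1 ?addn0; last first.
  move=> J' /eqP nJ; rewrite big1 // => i _; rewrite big1 // => u _.
  rewrite sJ // -1?ltnS // (_ : (_ == J) = false) //.
  case: ifP => _; first by case: ifP => _; rewrite /Z /pZ; lia.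
  by apply/eqP => e; apply: nJ; apply: ord_inj.
rewrite -big_split /=; apply: eq_bigr => i _.
have li : i <= D by rewrite -ltnS.
rewrite -(sum_predC1 (dg c (jb J i)) (hb _ _ lJ li)); congr (_ + _); apply: eq_bigr => u _.
rewrite sJ //; case: (u == h J i :> nat) => /=; last by rewrite eqxx.
rewrite (_ : (_ == J) = false) //.
by case: ifP => _; rewrite /Z /pZ; lia.
Qed.

Lemma struct_X phi h x c j : struct phi h x -> inr_h h x -> j < K1 ->
  dsum phi c (KD + j) =
  \sum_(J < KD) \sum_(i < D) (dg1 J i == j) * dg c (jb J i) (h J i) + dg c (vb j) (x j).
Proof.
move=> [sJ sv] [hb xb] lj.
rewrite /dsum (sum_NB (fun blk => \sum_(u < bD) (phi blk u == KD + j) * dg c blk u)); congr (_ + _); last first.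
  rewrite (bigD1 (Ordinal lj)) //= [X in _ + X]big1 ?addn0; last first.
    move=> j' /eqP nj; rewrite big1 // => u _; rewrite sv // (_ : (_ == KD + j) = false) //.
    case: ifP => _; last by rewrite /Z /pZ; lia.
    by apply/eqP => /addnI e; apply: nj; apply: ord_inj.
  rewrite -[RHS](sum_pred1 (dg c (vb j)) (xb _ lj)); apply: eq_bigr => u _; rewrite sv //.
  by case: (u == x j :> nat); rewrite ?eqxx //= (_ : (_ == _) = false) // /Z /pZ; lia.
apply: eq_bigr => J _; rewrite big_ord_recr /= [X in _ + X]big1 ?addn0; last first.
  move=> u _; rewrite sJ // eqxx (_ : (_ == KD + j) = false) //.
  by case: ifP => _; [rewrite /Z /pZ; lia | case: J => J /= lJ; lia].
apply: eq_bigr => i _; have li := ltnW (ltn_ord i).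
transitivity (\sum_(u < bD) (u == h J i :> nat) * ((dg1 J i == j) * dg c (jb J i) u)).
  apply: eq_bigr => u _; rewrite sJ // (ltn_eqF (ltn_ord i)).
  case: (u == h J i :> nat); last by rewrite (_ : (_ == _) = false) //; case: J {u} => J /= lJ; lia.
  by rewrite eqn_add2l mul1n.
by rewrite (sum_pred1 (fun u => (dg1 J i == j) * dg c (jb J i) u)) // hb.
Qed.

Lemma binsum_total phi F : (forall blk u, blk < NB -> u < bD -> phi blk u < Z.+1) ->
  \sum_(bin < Z.+1) binsum phi F bin = \sum_(blk < NB) \sum_(u < bD) F blk u.
Proof.
move=> lt; rewrite /binsum exchange_big /=; apply: eq_bigr => blk _.
rewrite exchange_big /=; apply: eq_bigr => u _.
rewrite -big_distrl /= -[RHS]mul1n; congr (_ * _).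
rewrite -(sum_pred1 (fun=> 1) (lt _ _ (ltn_ord blk) (ltn_ord u))).
by apply: eq_bigr => i _; rewrite muln1 eq_sym.
Qed.

Lemma tau_jb J i : J < KD -> i <= D -> tau (jb J i) = bD.+1 ^ i.+1.
Proof. by move=> lJ li; rewrite /tau; have [-> _ ->] := jbE lJ li; rewrite pwE. Qed.

Lemma v1_jb J i u : J < KD -> i < D -> v1 (jb J i) u = (bD - u) * b ^ i.
Proof.
move=> lJ li; rewrite /v1; have [-> _ ->] := jbE lJ (ltnW li).
by rewrite (ltn_eqF li) pwE // ltnW.
Qed.

Lemma v2_jb J i u : J < KD -> i < D -> v2 (jb J i) u = (bD ^ 2 - u ^ 2) * b ^ i.
Proof.
move=> lJ li; rewrite /v2; have [-> _ ->] := jbE lJ (ltnW li).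
by rewrite (ltn_eqF li) pwE // ltnW.
Qed.

Lemma v1_tuple J u : J < KD -> v1 (jb J D) u = u.
Proof. by move=> lJ; rewrite /v1; have [-> _ ->] := jbE lJ (leqnn D); rewrite eqxx. Qed.

Lemma v1_vb j u : v1 (vb j) u = Rw j * u.
Proof. by rewrite /v1; have [-> ->] := vbE j. Qed.

Lemma v2_vb j u : v2 (vb j) u = Rw j * u ^ 2.
Proof. by rewrite /v2; have [-> ->] := vbE j. Qed.

Lemma RwE j : Rw j = \sum_(J < KD) \sum_(i < D) (dg1 J i == j) * b ^ i.
Proof.
by apply: eq_bigr => J _; apply: eq_bigr => i _; rewrite pwE // ltnW.
Qed.

Definition exact_fill (phi : nat -> nat -> nat) :=
  forall c bin, c < 7 -> bin < Z.+1 -> dsum phi c bin = dsum phi0 c bin.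

(** * Rigidity of exact fillings *)

Section Exact.
Variable phi : nat -> nat -> nat.
Hypothesis phiZ : forall blk u, blk < NB -> u < bD -> phi blk u < Z.+1.
Hypothesis phiE : exact_fill phi.

Lemma class_U J blk u : J < KD -> blk < NB -> u < bD -> phi blk u = J -> pcl blk = J.
Proof.
move=> lJ; have lZ : J < Z.+1 by rewrite /Z /pZ; lia.
apply: (@variance_bin phi J J pcl 1) => //; try exact: phiE.
move=> B U lB _; apply: (NB_ind (P := fun B => phi0 B U = J -> pcl B = J)) lB => [J' i lJ' li|j lj].
  rewrite phi0_J // /pcl; have [-> -> _] := jbE lJ' li.
  by do 2?case: ifP => _; rewrite /Z /pZ; lia.
by rewrite phi0_v; case: ifP => _; rewrite /Z /pZ; lia.
Qed.

Lemma class_X j blk u : j < K1 -> blk < NB -> u < bD -> phi blk u = KD + j -> qcl blk = j.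
Proof.
move=> lj; have lZ : KD + j < Z.+1 by rewrite /Z /pZ; lia.
apply: (@variance_bin phi (KD + j) j qcl 3) => //; try exact: phiE.
move=> B U lB _; apply: (NB_ind (P := fun B => phi0 B U = KD + j -> qcl B = j)) lB => [J' i lJ' li|j' lj'].
  rewrite phi0_J // /qcl; have [-> -> ->] := jbE lJ' li.
  by do 2?case: ifP => _; rewrite /Z /pZ; lia.
rewrite phi0_v /qcl; have [-> ->] := vbE j'.
by case: ifP => _; rewrite /Z /pZ; lia.
Qed.

Lemma jb_lt J i : J < KD -> i <= D -> jb J i < NB.
Proof.
move=> lJ li; rewrite /NB /jb; apply: ltn_addr.
apply: (@leq_trans (J.+1 * D.+1)); first by rewrite mulSn addnC ltn_add2r ltnS.
by rewrite leq_mul2r lJ orbT.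
Qed.

Lemma vb_lt j : j < K1 -> vb j < NB.
Proof. by move=> lj; rewrite /NB /vb ltn_add2l. Qed.

Lemma pcl_jb J i : J < KD -> i <= D -> pcl (jb J i) = J.
Proof. by move=> lJ li; rewrite /pcl; have [-> -> _] := jbE lJ li. Qed.

Lemma qcl_jb J i : J < KD -> i <= D -> qcl (jb J i) = if i == D then K1 else dg1 J i.
Proof. by move=> lJ li; rewrite /qcl; have [-> -> ->] := jbE lJ li. Qed.

Lemma pcl_vb j : pcl (vb j) = KD.
Proof. by rewrite /pcl; have [-> _] := vbE j. Qed.

Lemma qcl_vb j : qcl (vb j) = j.
Proof. by rewrite /qcl; have [-> ->] := vbE j. Qed.

(** By [class_U] only blocks of [J] contribute to bin [J], so the digits of its weight in base
    [bD.+1] count their items. The reference filling has [bD.-1] of each. *)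
Lemma block_miss J i : J < KD -> i <= D ->
  exists2 a, a < bD & forall u, u < bD -> (phi (jb J i) u == J) = (u != a).
Proof.
move=> lJ li; apply: unique_miss; first by rewrite ltnW // bD1.
have lZ : J < Z.+1 by rewrite /Z /pZ; lia.
have e1 : dsum phi 0 J = \sum_(i < D.+1) \sum_(u < bD) (phi (jb J i) u == J) * tau (jb J i).
  rewrite /dsum (sum_NB (fun blk => \sum_(u < bD) (phi blk u == J) * dg 0 blk u)).
  rewrite [X in _ + X]big1 ?addn0; last first.
    move=> j _; rewrite big1 // => u _; case: eqP => // /(class_U lJ (vb_lt (ltn_ord j)) (ltn_ord u)).
    by rewrite pcl_vb; lia.
  rewrite (bigD1 (Ordinal lJ)) //= [X in _ + X]big1 ?addn0 // => J' /eqP nJ.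
  rewrite big1 // => t _; rewrite big1 // => u _; have lt : t <= D by rewrite -ltnS.
  case: eqP => // /(class_U lJ (jb_lt (ltn_ord J') lt) (ltn_ord u)).
  by rewrite pcl_jb // => e; case: nJ; apply: ord_inj.
have e2 := struct_U 0 struct0 inr_h0 lJ.
have := phiE (isT : 0 < 7) lZ; rewrite e1 => e3.
pose cn t := \sum_(u < bD) (phi (jb J t) u == J : nat).
have cn_le t : cn t < bD.+1.
  rewrite ltnS -[X in _ <= X]card_ord -sum1_card; apply: leq_sum => u _.
  by case: (_ == _).
suff : forall t, t < D.+1 -> cn t = bD.-1 by apply; rewrite ltnS.
apply: (@digits_inj _ bD.+1 cn (fun _ => bD.-1)) => //; first by move=> t _; lia.
apply/eqP; rewrite -(eqn_pmul2l (ltn0Sn bD)) -(eqn_add2r (\sum_(t < D.+1) tau (jb J t))).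
apply/eqP.
have -> : bD.+1 * (\sum_(t < D.+1) cn t * bD.+1 ^ t) = dsum phi0 0 J.
  rewrite -e3 big_distrr; apply: eq_bigr => t _ /=.
  by rewrite -big_distrl /= -/(cn t) tau_jb -1?ltnS // expnS mulnCA.
rewrite [LHS]e2 big_distrr -big_split /=; apply: eq_bigr => t _.
rewrite tau_jb -1?ltnS // sum_nat_const card_ord /dg /= tau_jb -1?ltnS //.
by rewrite mulnCA -expnS -[X in _ = _ + X]mul1n -mulnDl; congr (_ * _); have := bD1; lia.
Qed.

Definition hsel J i := odflt 0 (omap (@nat_of_ord bD) [pick a : 'I_bD | phi (jb J i) a != J]).

Lemma hselP J i : J < KD -> i <= D ->
  hsel J i < bD /\ forall u, u < bD -> (phi (jb J i) u == J) = (u != hsel J i).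
Proof.
move=> lJ li; have [a la ha] := block_miss lJ li.
rewrite /hsel; case: pickP => [a' /=|/(_ (Ordinal la)) /=]; last by rewrite ha // eqxx.
by rewrite ha // negbK => /eqP ->.
Qed.

(** Each coordinate block has one item outside its U bin, so the weight of X_j consists of some of
    the reference powers and the number [c] of items from [vb j]. As [c <= bD], comparison in base
    [bD.+1] leaves no power out and gives [c = 1]. *)
Lemma bin_X j : j < K1 ->
  (exists2 a, a < bD & forall u, u < bD -> (phi (vb j) u == KD + j) = (u == a)) /\
  (forall J i, J < KD -> i < D -> dg1 J i = j -> phi (jb J i) (hsel J i) = KD + j).
Proof.
move=> lj; have lZ : KD + j < Z.+1 by rewrite /Z /pZ; lia.
pose e J i : bool := phi (jb J i) (hsel J i) == KD + j.
pose c := \sum_(u < bD) (phi (vb j) u == KD + j : nat).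
have e1 : dsum phi 0 (KD + j) = \sum_(J < KD) \sum_(i < D) (dg1 J i == j) * e J i * bD.+1 ^ i.+1 + c.
  rewrite /dsum (sum_NB (fun blk => \sum_(u < bD) (phi blk u == KD + j) * dg 0 blk u)); congr (_ + _); last first.
    rewrite (bigD1 (Ordinal lj)) //= [X in _ + X]big1 ?addn0.
      by apply: eq_bigr => u _; rewrite /dg /= /tau; have [-> _] := vbE j; rewrite muln1.
    move=> j' /eqP nj; rewrite big1 // => u _.
    case: eqP => // /(class_X lj (vb_lt (ltn_ord j')) (ltn_ord u)).
    by rewrite qcl_vb => e'; case: nj; apply: ord_inj.
  apply: eq_bigr => J _; rewrite big_ord_recr /= [X in _ + X]big1 ?addn0; last first.
    move=> u _; case: eqP => // /(class_X lj (jb_lt (ltn_ord J) (leqnn D)) (ltn_ord u)).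
    by rewrite qcl_jb // eqxx; lia.
  apply: eq_bigr => i _; have li := ltnW (ltn_ord i).
  have [hl hP] := hselP (ltn_ord J) li.
  transitivity (\sum_(u < bD) (u == hsel J i :> nat) * ((dg1 J i == j) * e J i * bD.+1 ^ i.+1)).
    apply: eq_bigr => u _; rewrite /dg /= tau_jb //.
    case: (u =P hsel J i :> nat) => [uE|/eqP uE].
      rewrite mul1n /e -uE; case: eqP => [pE|_]; last by rewrite muln0.
      have := class_X lj (jb_lt (ltn_ord J) li) (ltn_ord u) pE.
      by rewrite qcl_jb // (ltn_eqF (ltn_ord i)) => ->; rewrite eqxx.
    have := hP _ (ltn_ord u); rewrite uE => /eqP ->.
    by rewrite (_ : (_ == _) = false) //; case: J {hl hP u uE} => J /= lJ; lia.
  by rewrite (sum_pred1 (fun=> (dg1 J i == j) * e J i * bD.+1 ^ i.+1)).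
have := phiE (isT : 0 < 7) lZ; rewrite e1.
rewrite (struct_X 0 struct0 inr_h0 lj).
have -> : dg 0 (vb j) 0 = 1 by rewrite /dg /= /tau; have [-> _] := vbE j.
pose P := \sum_(J < KD) \sum_(i < D) (dg1 J i == j) * e J i * bD.+1 ^ i.
pose N := \sum_(J < KD) \sum_(i < D) (dg1 J i == j) * ~~ e J i * bD.+1 ^ i.
have -> : \sum_(J < KD) \sum_(i < D) (dg1 J i == j) * e J i * bD.+1 ^ i.+1 = bD.+1 * P.
  rewrite /P big_distrr; apply: eq_bigr => J _; rewrite big_distrr; apply: eq_bigr => i _.
  by rewrite /= expnS mulnCA.
have -> : \sum_(J < KD) \sum_(i < D) (dg1 J i == j) * dg 0 (jb J i) 0 = bD.+1 * (P + N).
  rewrite /P /N -big_split big_distrr; apply: eq_bigr => J _.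
  rewrite -big_split big_distrr; apply: eq_bigr => i _ /=.
  rewrite /dg /= tau_jb ?(ltnW (ltn_ord i)) // expnS.
  by case: (dg1 J i == j); case: (e J i); rewrite /= ?mul1n ?mul0n ?muln0 ?addn0 ?add0n.
have cle : c <= bD.
  rewrite -[X in _ <= X]card_ord -sum1_card; apply: leq_sum => u _.
  by case: (_ == _).
move=> eq.
have N0 : N = 0 by rewrite mulnDr in eq; case: (N) eq => // m; rewrite mulnS; lia.
have c1 : c = 1 by rewrite N0 addn0 in eq; lia.
split.
  have [a la ha] : exists2 a, a < bD & forall u, u < bD -> ~~ (phi (vb j) u == KD + j) = (u != a).
    apply: unique_miss; first by rewrite ltnW // bD1.
    have : \sum_(u < bD) (~~ (phi (vb j) u == KD + j) : nat) + c = bD.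
      rewrite /c -big_split /= -[RHS]card_ord -sum1_card; apply: eq_bigr => u _.
      by case: (_ == _).
    by rewrite c1; lia.
  by exists a => // u lu; apply: negb_inj; apply: ha.
move=> J i lJ li dE; apply/eqP.
move/eqP: N0; rewrite sum_nat_eq0 => /forallP/(_ (Ordinal lJ)) /=.
rewrite sum_nat_eq0 => /forallP/(_ (Ordinal li)) /=.
rewrite dE eqxx mul1n muln_eq0 expn_eq0 /= orbF /e.
by case: (phi _ _ == _).
Qed.

Definition xsel j := odflt 0 (omap (@nat_of_ord bD) [pick a : 'I_bD | phi (vb j) a == KD + j]).

Lemma xselP j : j < K1 ->
  xsel j < bD /\ forall u, u < bD -> (phi (vb j) u == KD + j) = (u == xsel j).
Proof.
move=> lj; have [[a la ha] _] := bin_X lj.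
rewrite /xsel; case: pickP => [a' /=|/(_ (Ordinal la)) /=]; last by rewrite ha // eqxx.
by rewrite ha // => /eqP ->.
Qed.

Lemma phi_other blk u : blk < NB -> u < bD ->
  (pcl blk < KD -> phi blk u != pcl blk) -> (qcl blk < K1 -> phi blk u != KD + qcl blk) ->
  phi blk u = Z.
Proof.
move=> lb lu hp hq; have lt := phiZ lb lu.
case: (ltnP (phi blk u) KD) => h1.
  by have e := class_U h1 lb lu erefl; have := hp; rewrite e h1 eqxx => /(_ isT).
case: (ltnP (phi blk u) (KD + K1)) => h2; last by rewrite /Z /pZ in lt *; lia.
have lj : phi blk u - KD < K1 by lia.
have pE : phi blk u = KD + (phi blk u - KD) by lia.
by have e := class_X lj lb lu pE; have := hq; rewrite e lj -pE eqxx => /(_ isT).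
Qed.

Lemma exact_struct : inr_h hsel xsel /\ struct phi hsel xsel.
Proof.
split; first by split=> [J i lJ li|j lj]; [have [] := hselP lJ li | have [] := xselP lj].
split=> [J i u lJ li lu|j u lj lu].
  have [hl hP] := hselP lJ li; have := hP u lu; case: eqP => [pE|pE]; last first.
    move/esym/negbFE => uE; rewrite uE; case: eqP => [iE|/eqP iE].
      apply: phi_other; rewrite ?jb_lt ?pcl_jb ?qcl_jb // ?iE ?eqxx ?ltnn // => _.
      by rewrite -iE; apply/eqP.
    have li' : i < D by rewrite ltn_neqAle iE.
    by rewrite (eqP uE); apply: (bin_X (dg1_lt J i)).2.
  by move/esym/negbTE => ->.
have [xl xP] := xselP lj; have := xP u lu; case: eqP => [pE <- //|pE <-].
apply: phi_other; rewrite ?vb_lt ?pcl_vb ?qcl_vb ?ltnn // => _.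
exact/eqP.
Qed.

(** The value digits of X_j say that the selected values at coordinates with index [j] have weighted
    mean [xsel j] and variance 0. *)
Lemma exact_hsel J i : J < KD -> i < D -> hsel J i = xsel (dg1 J i).
Proof.
move=> lJ li; have [ir st] := exact_struct; set j := dg1 J i.
have lj : j < K1 := dg1_lt J i.
have lZ : KD + j < Z.+1 by rewrite /Z /pZ; lia.
have ir0 := inr_h0.
pose f (t : 'I_KD * 'I_D) := (dg1 t.1 t.2 == j) * b ^ t.2.
have fR : \sum_t f t = Rw j by rewrite RwE pair_bigA.
have key c k (vE : forall J i u, J < KD -> i < D -> dg c (jb J i) u = (bD ^ k - u ^ k) * b ^ i)
    (vvE : forall u, dg c (vb j) u = Rw j * u ^ k) : 0 < k -> c < 7 ->
    \sum_t f t * hsel t.1 t.2 ^ k = xsel j ^ k * \sum_t f t.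
  move=> k0 lc; have := phiE lc lZ; rewrite (struct_X _ st ir lj) (struct_X _ struct0 ir0 lj).
  rewrite !pair_bigA /= !vvE exp0n // muln0 addn0 fR [_ * Rw j]mulnC => e.
  apply/eqP; rewrite -(eqn_add2l (\sum_(t : 'I_KD * 'I_D) (dg1 t.1 t.2 == j) * dg c (jb t.1 t.2) (hsel t.1 t.2))).
  rewrite [X in _ == X]e -big_split /=; apply/eqP; apply: eq_bigr => -[J' i'] _ /=.
  rewrite !vE // exp0n // subn0 -!mulnA -mulnDr mulnC [b ^ i' * _]mulnC -mulnDl mulnC subnK //.
  by apply: leq_exp; apply: ltnW; case: ir => + _; apply; rewrite // ltnW.
apply: (@variance0 _ f (fun t => hsel t.1 t.2) (xsel j) _ _ (Ordinal lJ, Ordinal li)).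
- have := key 5 1; rewrite expn1; under eq_bigr do rewrite expn1.
  apply=> // [J' i' u lJ' li'|u]; rewrite /dg /= ?expn1; first exact: v1_jb.
  exact: v1_vb.
- by apply: (key 6 2) => // [J' i' u lJ' li'|u]; rewrite /dg /=; [exact: v2_jb | exact: v2_vb].
by rewrite /f /= eqxx mul1n expn_gt0 ltnW.
Qed.

(** In U_J the missing coordinate items and the missing tuple have to balance in digit 5. *)
Lemma exact_tuple J : J < KD -> hsel J D = \sum_(i < D) xsel (dg1 J i) * b ^ i.
Proof.
move=> lJ; have [ir st] := exact_struct.
have lZ : J < Z.+1 by rewrite /Z /pZ; lia.
have ir0 := inr_h0.
have e1 := struct_U 5 st ir lJ; have := struct_U 5 struct0 ir0 lJ.
rewrite -(phiE (isT : 5 < 7) lZ) -e1 => /addnI; rewrite !big_ord_recr /= /dg /= !v1_tuple // addn0 => e.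
apply/eqP; rewrite -(eqn_add2l (\sum_(i < D) v1 (jb J i) (hsel J i))) -[X in X == _]e -big_split /=.
apply/eqP; apply: eq_bigr => i _; rewrite !v1_jb // subn0 -exact_hsel // -mulnDl subnK //.
by apply: ltnW; case: ir => + _; apply; rewrite // ltnW.
Qed.

(** Candidates range up to [bD], but for a [J] with top digit [j] the tuple number is at least
    [xsel j * b ^ D.-1] and below [b ^ D]. *)
Lemma xsel_lt j : j < K1 -> xsel j < b.
Proof.
move=> lj; pose J := j * K1 ^ D.-1.
have DE : D = D.-1.+1 by rewrite prednK.
have lJ : J < KD by rewrite /KD /pKD DE expnS ltn_mul2r expn_gt0 K0 lj.
have dj : dg1 J D.-1 = j by rewrite /dg1 pwE ?leq_pred // mulnK ?expn_gt0 ?K0 // modn_small.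
have [hl _] := hselP lJ (leqnn D).
have lD : D.-1 < D by rewrite prednK.
move: hl; rewrite exact_tuple // (bigD1 (Ordinal lD)) //= dj => h.
rewrite -(ltn_pmul2r (_ : 0 < b ^ D.-1)) ?expn_gt0 ?(ltnW b1) //.
by rewrite -expnS prednK //; apply: leq_ltn_trans h; apply: leq_addr.
Qed.

Lemma exact_Z_tuple J u : J < KD -> u < bD ->
  (phi (jb J D) u == Z) = (u == \sum_(i < D) xsel (dg1 J i) * b ^ i).
Proof.
move=> lJ lu; have [_ [st _]] := exact_struct; rewrite st // -exact_tuple // eqxx.
by case: ifP => _; rewrite ?eqxx //; rewrite /Z /pZ; lia.
Qed.

End Exact.

Lemma sum_dg1 x J : \sum_(i < D) x (dg1 J i) * b ^ i = Xmap K1 b x D J.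
Proof. by apply: eq_bigr => i _; rewrite /dg1 /dig pwE // ltnW. Qed.

(** * The exact filling given by a point *)

Section Build.
Variable x : nat -> nat.
Hypothesis xb : forall j, j < K1 -> x j < b.

Definition Xt J := \sum_(i < D) x (dg1 J i) * b ^ i.
Definition hx J i := if i == D then Xt J else x (dg1 J i).
Definition phix blk u :=
  if u == (if isv blk then x (bj blk) else hx (bJ blk) (bi blk)) then sel blk else uns blk.

Lemma leq_bD : b <= bD.
Proof. by rewrite -{1}(expn1 b) leq_exp2l. Qed.

Lemma inr_hx : inr_h hx x.
Proof.
split=> [J i lJ li|j lj]; last by apply: leq_trans leq_bD; apply: xb.
rewrite /hx; case: ifP => _; first by rewrite /Xt sum_dg1 Xmap_lt.
by apply: leq_trans leq_bD; apply/xb/dg1_lt.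
Qed.

Lemma struct_phix : struct phix hx x.
Proof.
split=> [J i u lJ li lu|j u lj lu]; rewrite /phix /sel /uns.
  by have [-> -> ->] := jbE lJ li.
by have [-> ->] := vbE j.
Qed.

Lemma phix_lt blk u : blk < NB -> phix blk u < Z.+1.
Proof.
move=> lb; rewrite /phix /sel /uns.
apply: (NB_ind (P := fun blk => (if u == (if isv blk then x (bj blk) else hx (bJ blk) (bi blk))
  then _ else _) < Z.+1)) lb => [J i lJ li|j lj].
  by have [-> -> ->] := jbE lJ li; have := dg1_lt J i; do 2?case: ifP => _; rewrite /Z /pZ; lia.
by have [-> ->] := vbE j; case: ifP => _; rewrite /Z /pZ; lia.
Qed.

Lemma v2_tuple J u : J < KD ->
  v2 (jb J D) u = \sum_(i < D) (u %/ b ^ i %% b) ^ 2 * b ^ i.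
Proof.
move=> lJ; rewrite /v2; have [-> _ ->] := jbE lJ (leqnn D); rewrite eqxx.
by apply: eq_bigr => i _; rewrite pwE // ltnW.
Qed.

(** Only the two value digits depend on the selection; there the complements of the coordinates
    cancel the change in the tuple. *)
Lemma swap_U c J : J < KD ->
  \sum_(i < D.+1) dg c (jb J i) (hx J i) = \sum_(i < D.+1) dg c (jb J i) 0.
Proof.
have hxD i : i < D -> hx J i = x (dg1 J i) by move=> li; rewrite /hx (ltn_eqF li).
have xl i : x (dg1 J i) <= bD by apply: ltnW; apply: leq_trans leq_bD; apply/xb/dg1_lt.
move=> lJ; case: c => [|[|[|[|[|[|[|c]]]]]]] //; rewrite !big_ord_recr /dg /=.
- rewrite !v1_tuple // addn0 /hx eqxx -big_split /=; apply: eq_bigr => i _.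
  by rewrite -/(hx J i) hxD // !v1_jb // subn0 -mulnDl subnK.
- rewrite !v2_tuple // [X in _ = _ + X]big1 ?addn0; last first.
    by move=> i _; rewrite div0n mod0n.
  rewrite {2}/hx eqxx -big_split /=; apply: eq_bigr => i _.
  rewrite hxD // !v2_jb // exp0n // subn0 /Xt.
  rewrite (dig_sum (f := fun i => x (dg1 J i))) => [|t _|//]; last exact/xb/dg1_lt.
  by rewrite -mulnDl subnK // leq_exp.
Qed.

Lemma swap_X c j : j < K1 ->
  \sum_(J < KD) \sum_(i < D) (dg1 J i == j) * dg c (jb J i) (hx J i) + dg c (vb j) (x j) =
  \sum_(J < KD) \sum_(i < D) (dg1 J i == j) * dg c (jb J i) 0 + dg c (vb j) 0.
Proof.
have hxD J i : i < D -> hx J i = x (dg1 J i) by move=> li; rewrite /hx (ltn_eqF li).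
have xl j' : j' < K1 -> x j' <= bD by move=> lj; apply: ltnW; apply: leq_trans leq_bD; apply: xb.
move=> lj; case: c => [|[|[|[|[|[|[|c]]]]]]] //; rewrite /dg /=.
- rewrite !v1_vb muln0 addn0 RwE big_distrl -big_split /=; apply: eq_bigr => J _.
  rewrite big_distrl -big_split /=; apply: eq_bigr => i _.
  rewrite hxD // !v1_jb // subn0; case: eqP => [->|_]; rewrite ?mul0n // !mul1n.
  by rewrite [b ^ i * _]mulnC -mulnDl subnK // xl.
- rewrite !v2_vb muln0 addn0 RwE big_distrl -big_split /=; apply: eq_bigr => J _.
  rewrite big_distrl -big_split /=; apply: eq_bigr => i _.
  rewrite hxD // !v2_jb // exp0n // subn0; case: eqP => [->|_]; rewrite ?mul0n // !mul1n.
  by rewrite [b ^ i * _]mulnC -mulnDl subnK // leq_exp // xl.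
Qed.

Lemma phi0_lt blk u : blk < NB -> phi0 blk u < Z.+1.
Proof.
move=> lb; apply: (NB_ind (P := fun blk => phi0 blk u < Z.+1)) lb => [J i lJ li|j lj].
  by rewrite phi0_J //; have := dg1_lt J i; do 2?case: ifP => _; rewrite /Z /pZ; lia.
by rewrite phi0_v; case: ifP => _; rewrite /Z /pZ; lia.
Qed.

(** All bins but [Z] are settled by the swaps; [Z] follows because the totals over all bins
    agree. *)
Lemma phix_exact : exact_fill phix.
Proof.
move=> c bin lc.
have ir0 := inr_h0.
have eb bn : bn < Z -> dsum phix c bn = dsum phi0 c bn.
  move=> lt; case: (ltnP bn KD) => h.
    have := struct_U c struct_phix inr_hx h; rewrite -(struct_U c struct0 ir0 h) swap_U //.
    exact: addIn.
  have lj : bn - KD < K1 by rewrite /Z /pZ in lt; lia.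
  rewrite -(subnKC h) (struct_X c struct_phix inr_hx lj) (struct_X c struct0 ir0 lj).
  exact: swap_X.
rewrite ltnS leq_eqVlt => /orP[/eqP->|]; last exact: eb.
have := binsum_total (dg c) (fun blk u lb _ => phix_lt u lb).
rewrite -(binsum_total (dg c) (fun blk u lb _ => phi0_lt u lb)) !big_ord_recr /=.
by rewrite (eq_bigr (fun i : 'I_Z => dsum phi0 c i)) => [/addnI|i _] //; apply: eb.
Qed.

Lemma phix_Z J u : J < KD -> u < bD -> (phix (jb J D) u == Z) = (u == Xt J).
Proof.
move=> lJ lu; have [st _] := struct_phix; rewrite st // eqxx /hx eqxx.
by case: ifP => _; rewrite ?eqxx //; rewrite /Z /pZ; lia.
Qed.

End Build.

(** * Item sizes and bin capacities *)

Variables (Wf : nat -> nat -> nat) (thr : nat).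

Definition Wt blk u := if isv blk then 0 else if bi blk == D then Wf (bJ blk) u else 0.

(** Exceeds every possible digit total, so there are no carries in base [BB]; [Big] does the same
    for the low-order weights. *)
Definition BB := (\sum_(blk < NB) \sum_(u < bD) \sum_(c < 7) dg c blk u).+1.
Definition mainw blk u := \sum_(c < 7) dg c blk u * BB ^ c.
Definition Big := (\sum_(blk < NB) \sum_(u < bD) Wt blk u).+1.
Definition isize blk u := Big * mainw blk u + Wt blk u.
Definition cap bin := Big * binsum phi0 mainw bin + (if bin == Z then thr else 0).

Definition covers (phi : nat -> nat -> nat) :=
  (forall blk u, blk < NB -> u < bD -> phi blk u < Z.+1) /\
  (forall bin, bin < Z.+1 -> cap bin <= binsum phi isize bin).

Lemma binsum_isize phi bin :
  binsum phi isize bin = Big * binsum phi mainw bin + binsum phi Wt bin.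
Proof.
rewrite /binsum big_distrr -big_split /=; apply: eq_bigr => blk _.
rewrite big_distrr -big_split /=; apply: eq_bigr => u _.
by rewrite /isize mulnDr mulnCA.
Qed.

Lemma binsum_mainw phi bin : binsum phi mainw bin = \sum_(c < 7) dsum phi c bin * BB ^ c.
Proof.
rewrite /binsum /dsum; under [RHS]eq_bigr do rewrite big_distrl /=.
rewrite [RHS]exchange_big /=; apply: eq_bigr => blk _.
under [RHS]eq_bigr do rewrite big_distrl /=.
rewrite [RHS]exchange_big /=; apply: eq_bigr => u _.
by rewrite /mainw big_distrr /=; apply: eq_bigr => c _; rewrite /= mulnA.
Qed.

Lemma dsum_lt phi c bin : c < 7 -> dsum phi c bin < BB.
Proof.
move=> lc; rewrite ltnS; apply: leq_sum => blk _; apply: leq_sum => u _.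
rewrite (bigD1 (Ordinal lc)) //=; apply: leq_trans (leq_addr _ _).
by case: (_ == _); rewrite ?mul1n ?mul0n.
Qed.

Lemma eq_of_leq_sum m (f g : nat -> nat) : (forall i, i < m -> f i <= g i) ->
  \sum_(i < m) f i = \sum_(i < m) g i -> forall i, i < m -> f i = g i.
Proof.
move=> le e i li; apply/eqP; rewrite eqn_leq le //=.
have e' : \sum_(i < m) (g i - f i) = 0.
  apply/eqP; rewrite -(eqn_add2r (\sum_(i < m) f i)) -big_split /= add0n e.
  by apply/eqP; apply: eq_bigr => t _; rewrite subnK ?le.
have := sum_nat_eq0P e' (Ordinal li) => /= /eqP.
by rewrite subn_eq0.
Qed.

Lemma binsum_Wt phi y : (forall J, J < KD -> y J < bD) ->
  (forall J u, J < KD -> u < bD -> (phi (jb J D) u == Z) = (u == y J)) ->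
  binsum phi Wt Z = \sum_(J < KD) Wf J (y J).
Proof.
move=> yb pz; rewrite /binsum (sum_NB (fun blk => \sum_(u < bD) (phi blk u == Z) * Wt blk u)).
rewrite [X in _ + X]big1 ?addn0; last first.
  by move=> j _; rewrite big1 // => u _; rewrite /Wt; have [-> _] := vbE j; rewrite muln0.
apply: eq_bigr => J _; rewrite big_ord_recr /= [X in X + _]big1 ?add0n; last first.
  move=> i _; rewrite big1 // => u _; rewrite /Wt.
  have [-> _ ->] := jbE (ltn_ord J) (ltnW (ltn_ord i)).
  by rewrite (ltn_eqF (ltn_ord i)) muln0.
rewrite -[RHS](sum_pred1 (Wf J) (yb _ (ltn_ord J))); apply: eq_bigr => u _.
by rewrite pz // /Wt; have [-> -> ->] := jbE (ltn_ord J) (leqnn D); rewrite eqxx.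
Qed.

(** High-order capacities and items have equal totals, so covering forces equality in every bin and
    then in every digit. What is left is the low-order requirement of [Z]. *)
Theorem covers_iff : (exists phi, covers phi) <->
  (exists2 x, forall j, j < K1 -> x j < b & thr <= \sum_(J < KD) Wf J (Xmap K1 b x D J)).
Proof.
split=> [[phi [pl pc]]|[x xb tW]].
  have ge bin : bin < Z.+1 -> binsum phi0 mainw bin <= binsum phi mainw bin.
    move=> lb; have := pc bin lb; rewrite /cap binsum_isize => h.
    have wl : binsum phi Wt bin < Big.
      rewrite ltnS; apply: leq_sum => blk _; apply: leq_sum => u _.
      by case: (_ == _); rewrite ?mul1n ?mul0n.
    (* The low-order weights stay below [Big] and cannot replace a missing high-order unit. *)
    rewrite -ltnS -(ltn_pmul2l (ltn0Sn _ : 0 < Big)) mulnS.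
    by apply: leq_ltn_trans (leq_trans (leq_addr _ _) h) _; rewrite addnC ltn_add2r.
  have em bin : bin < Z.+1 -> binsum phi0 mainw bin = binsum phi mainw bin.
    apply: eq_of_leq_sum => //; rewrite !binsum_total // => blk u lb _.
    exact: phi0_lt.
  have ex : exact_fill phi.
    move=> c bin lc lb; have := em bin lb; rewrite !binsum_mainw => /esym e.
    apply: (@digits_inj 7 BB (fun c => dsum phi c bin) (fun c => dsum phi0 c bin)) => // i li; exact: dsum_lt.
  exists (xsel phi); first by move=> j lj; apply: xsel_lt.
  have := pc Z (ltnSn _); rewrite /cap eqxx binsum_isize em // leq_add2l.
  rewrite (binsum_Wt (y := fun J => Xmap K1 b (xsel phi) D J)) //.
    by move=> J lJ; apply: Xmap_lt => // j lj; apply: xsel_lt.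
  by move=> J u lJ lu; rewrite exact_Z_tuple // sum_dg1.
exists (phix x); split; first by move=> blk u lb _; apply: phix_lt.
move=> bin lb; rewrite /cap binsum_isize.
have -> : binsum phi0 mainw bin = binsum (phix x) mainw bin.
  by rewrite !binsum_mainw; apply: eq_bigr => c _; rewrite phix_exact.
rewrite leq_add2l; case: eqP => // ->.
rewrite (binsum_Wt (y := fun J => Xmap K1 b x D J)) // => [J lJ|J u lJ lu].
  exact: Xmap_lt.
by rewrite phix_Z // -sum_dg1.
Qed.

End Packing.

(** * Identifications onto linear forests *)

(** The fibres are arbitrary nonempty sets, since identified vertices may be non-adjacent. *)
Definition id_map (G H : sgraph) (f : G -> H) : Prop :=
  [/\ forall u v, adj u v -> f u = f v \/ adj (f u) (f v),
      forall a b, adj a b -> exists u v, [/\ adj u v, f u = a & f v = b]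
    & forall a, exists u, f u = a].

Lemma identifies_to_map (H G : sgraph) :
  identifies_to H G -> exists f : G -> H, id_map f.
Proof.
elim=> {G} [G [f [[g fK gK] fa]]|G u v uv _ [f [f1 f2 f3]]].
  exists f; split=> [x y xy|a b ab|a].
  - by right; rewrite fa.
  - by exists (g a), (g b); rewrite -fa !gK.
  by exists (g a).
(* The quotient map: [insub] returns [None] exactly at [u] and [v]. *)
pose pr (x : G) : identify u v := insub x.
have prP (y : identify u v) : exists x, pr x = y.
  by case: y => [[x px]|]; [exists x; rewrite /pr insubT | exists u; rewrite /pr insubF // eqxx].
have pr_adj x y : adj x y -> pr x = pr y \/ adj (pr x) (pr y).
  move=> xy; have yx : adj y x by rewrite adj_sym.
  rewrite /pr.
  case: (boolP ((x != u) && (x != v))) => hx; case: (boolP ((y != u) && (y != v))) => hy.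
  - by rewrite !insubT; right.
  - rewrite insubT insubN //; right=> /=; move: hy; rewrite negb_and !negbK.
    by case/orP=> /eqP yE; rewrite -yE yx ?orbT.
  - rewrite insubN // insubT; right=> /=; move: hx; rewrite negb_and !negbK.
    by case/orP=> /eqP xE; rewrite -xE xy ?orbT.
  by rewrite !insubN //; left.
exists (fun x => f (pr x)); split=> [x y /pr_adj[->|/f1]|a b|a]; [by left|by []| |].
  move=> /f2[x [y [xy <- <-]]].
  suff [x' [y' [ax ex ey]]] : exists x' y', [/\ adj x' y', pr x' = x & pr y' = y].
    by exists x', y'; rewrite ex ey.
  have prval (z : {w : G | (w != u) && (w != v)}) : pr (val z) = Some z.
    by case: z => z pz; rewrite /pr /= insubT.
  have pru : pr u = None by rewrite /pr insubF // eqxx.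
  have prv : pr v = None by rewrite /pr insubF // eqxx andbF.
  case: x y xy => [x|] [y|] //=.
  - by move=> xy; exists (val x), (val y).
  - by case/orP=> h; [exists (val x), u | exists (val x), v]; rewrite adj_sym.
  by case/orP=> h; [exists u, (val y) | exists v, (val y)].
by have [y <-] := f3 a; have [x <-] := prP y; exists x.
Qed.

(** Two vertices in one fibre can be identified and the map descends; an injective map of this kind
    is an isomorphism. *)
Lemma map_identifies_to (H G : sgraph) (f : G -> H) : id_map f -> identifies_to H G.
Proof.
suff h m (G' : sgraph) (f' : G' -> H) : #|G'| < m -> id_map f' -> identifies_to H G'.
  exact: h (ltnSn _).
elim: m G' f' => // m IH {f}G f lt [f1 f2 f3].
case: (boolP (injectiveb f)) => [/injectiveP inj|/injectivePn[u [v uv fuv]]].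
  apply: id_done; exists f; split.
    apply: inj_card_bij => //.
    have -> : #|H| = #|[seq f x | x : G]|.
      by apply: eq_card => a; have [u <-] := f3 a; rewrite codom_f.
    by rewrite (leq_trans (card_size _)) // size_map -cardE.
  move=> x y; apply/idP/idP => [/f2[x' [y' [a /inj <- /inj <-]]] //|xy].
  by case: (f1 _ _ xy) => // /inj xE; rewrite xE adj_irrefl in xy.
apply: (id_step uv); pose g (y : identify u v) := if y is Some x then f (val x) else f u.
have gP x : exists y, g y = f x.
  case: (boolP ((x != u) && (x != v))) => [hx|]; first by exists (Some (Sub x hx)).
  by rewrite negb_and !negbK => /orP[] /eqP->; exists None; rewrite /= ?fuv.
apply: (IH _ g).
  move: lt; rewrite !ltnS; apply: leq_trans.
  rewrite card_option card_sig [X in _ < X](cardD1 u) [#|predD1 _ _|](cardD1 v) !inE.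
  rewrite [v == u]eq_sym uv /= !add1n !ltnS.
  by apply/subset_leq_card/subsetP => w; rewrite !inE andbT andbC.
split=> [[x|] [y|] //=|a b ab|a].
- exact: f1.
- by case/orP; rewrite adj_sym => /f1 //; rewrite fuv.
- by case/orP=> /f1 //; rewrite fuv.
- have [x [y [xy xa yb]]] := f2 a b ab; subst a b.
  have yx : adj y x by rewrite adj_sym.
  have pE w : (w != u) && (w != v) \/ f w = f u /\ (w = u \/ w = v).
    case: (boolP (_ && _)) => h; [by left | right; move: h; rewrite negb_and !negbK].
    by case/orP=> /eqP->; split; auto.
  case: (pE x) => [hx|[ex xx]]; case: (pE y) => [hy|[ey yy]].
  + by exists (Some (Sub x hx)), (Some (Sub y hy)).
  + by exists (Some (Sub x hx)), None; rewrite ey /=; split=> //; case: yy => <-; rewrite yx ?orbT.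
  + by exists None, (Some (Sub y hy)); rewrite ex /=; split=> //; case: xx => <-; rewrite xy ?orbT.
  by rewrite ex ey adj_irrefl in ab.
by have [x <-] := f3 a; apply: gP.
Qed.

(** * Disjoint unions of paths *)

Section PathForest.
Variables (l : nat -> nat) (T : nat).

(** Path [t] has [l t] edges and occupies consecutive vertices from [poff t] on; [pcmp] finds the
    path of a vertex by counting the paths that end before it. *)
Definition poff t := sumf t (fun s => (l s).+1).
Definition pcmp u := sumf T (fun t => poff t.+1 <= u).
Definition padj u v := ((u.+1 == v) || (v.+1 == u)) && (pcmp u == pcmp v).
Definition pN := poff T.

Lemma poffS t : poff t.+1 = poff t + (l t).+1.
Proof. by rewrite /poff /sumf big_ord_recr. Qed.

Lemma poff_mono t t' : t <= t' -> poff t <= poff t'.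
Proof.
move/subnKC <-; elim: (t' - t) => [|m IH]; first by rewrite addn0.
by rewrite addnS poffS; apply: leq_trans IH (leq_addr _ _).
Qed.

Lemma poff_ex m u : u < poff m -> exists2 t, t < m & poff t <= u < poff t.+1.
Proof.
elim: m => [|m IH]; first by rewrite /poff /sumf big_ord0.
case: (ltnP u (poff m)) => [/IH[t lt h] _|h lt]; first by exists t => //; lia.
by exists m => //; rewrite h lt.
Qed.

Lemma pcmpE t u : t < T -> poff t <= u < poff t.+1 -> pcmp u = t.
Proof.
move=> lt /andP[h1 h2]; rewrite /pcmp -(subnKC (ltnW lt)) sumfD.
rewrite (eq_sumf (G := fun _ => 1)) ?sumf_const ?muln1 => [|s ls]; last first.
  by rewrite (leq_trans (poff_mono ls)).
rewrite sumf0 ?addn0 // => s _; apply/eqP; rewrite eqb0 -ltnNge.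
by apply: leq_trans h2 _; apply: poff_mono; lia.
Qed.

Lemma pcmpP u : u < pN -> pcmp u < T /\ poff (pcmp u) <= u < poff (pcmp u).+1.
Proof. by case/poff_ex => t lt h; rewrite (pcmpE lt h). Qed.

Lemma pcmp_vtx t i : t < T -> i <= l t -> pcmp (poff t + i) = t /\ poff t + i < pN.
Proof.
move=> lt li; split; first by apply: pcmpE => //; rewrite poffS; lia.
by apply: leq_trans (poff_mono lt); rewrite poffS; lia.
Qed.

Lemma pgraph_ok (mx := (\matrix_(i < pN, j < pN) padj i j)%R) :
  [forall i, forall j, mx i j == mx j i] && [forall i, ~~ mx i i].
Proof.
apply/andP; split; last by apply/forallP => i; rewrite mxE /padj; lia.
apply/forallP => i; apply/forallP => j; rewrite !mxE /padj; apply/eqP.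
by rewrite orbC [pcmp j == _]eq_sym.
Qed.

Definition pgraph : ograph := OGraph pgraph_ok.

Lemma pgraph_adj (i j : pgraph) : adj i j = padj i j.
Proof. by rewrite /= mxE. Qed.

Lemma connect_comp (x y : pgraph) : connect (@adj pgraph) x y -> pcmp x = pcmp y.
Proof.
case/connectP => p; elim: p x => [|z p IH] x /=; first by move=> _ ->.
by case/andP; rewrite mxE => /andP[_ /eqP->] /IH h /h.
Qed.

Lemma comp_connect (x y : pgraph) : pcmp x = pcmp y -> connect (@adj pgraph) x y.
Proof.
have sym : connect_sym (@adj pgraph) by apply: sym_connect_sym; apply: adj_sym.
wlog le : x y / x <= y.
  move=> h e; case: (leqP x y) => [|/ltnW] le; first exact: h.
  by rewrite sym; apply: h.
move=> e; have [m] := ubnP (y - x); elim: m => // m IH in x le e *; rewrite ltnS => lm.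
case: (ltngtP x y) le => // [lt _|/ord_inj -> _]; last exact: connect0.
have lx : x.+1 < pN by apply: leq_ltn_trans (ltn_ord y).
have [cl ch] := pcmpP (ltn_ord x); have [_ chy] := pcmpP (ltn_ord y).
have e' : pcmp x.+1 = pcmp x by apply: pcmpE => //; rewrite -e in chy; lia.
apply: connect_trans (_ : connect _ (Ordinal lx : pgraph) y).
  by apply: connect1; rewrite pgraph_adj /padj /= eqxx e' eqxx.
have ar (p q r : nat) : p < q -> q - p <= r -> q - p.+1 < r by lia.
by apply: IH; rewrite /= ?e' //; apply: ar lt lm.
Qed.

Lemma components_pgraph :
  components pgraph \subset [set [set v : pgraph | pcmp v == t] | t : 'I_T].
Proof.
apply/subsetP => X /imsetP[x _ ->].
have [lt _] := pcmpP (ltn_ord x); apply/imsetP; exists (Ordinal lt) => //.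
apply/setP => y; rewrite !inE /=; apply/idP/eqP => [/connect_comp -> //|e].
exact: comp_connect.
Qed.

Lemma card_components : #|components pgraph| <= T.
Proof.
apply: leq_trans (subset_leq_card components_pgraph) _.
by apply: leq_trans (leq_imset_card _ _) _; rewrite card_ord.
Qed.

Lemma linear_forest_pgraph : linear_forest pgraph.
Proof.
apply/forallP => X; apply/implyP => /(subsetP components_pgraph)/imsetP[[t lt] _ ->] /=.
set Y := [set _ | _].
pose vt (i : nat) : pgraph := insubd (Ordinal (pcmp_vtx lt (leq0n _)).2) (poff t + i).
have vtE i : i <= l t -> vt i = poff t + i :> nat.
  by move=> li; rewrite val_insubd (pcmp_vtx lt li).2.
have inY (y : pgraph) : (y \in Y) = (poff t <= y < poff t.+1).
  rewrite inE; apply/eqP/idP => [<-|h]; first by have [] := pcmpP (ltn_ord y).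
  exact: pcmpE.
have YE : Y = [set vt i | i : 'I_(l t).+1].
  apply/setP => y; rewrite inY; apply/idP/imsetP => [h|[i _ ->]]; last first.
    by rewrite (vtE _ (leq_ord i)) poffS; have := ltn_ord i; lia.
  have ar (p q r : nat) : p <= q < p + r.+1 -> q - p < r.+1 /\ q = p + (q - p) by lia.
  rewrite poffS in h; have [li yE] := ar _ _ _ h.
  by exists (Ordinal li) => //; apply: ord_inj; rewrite vtE.
have mY y : (y \in Y) = (y \in [set vt i | i : 'I_(l t).+1]) by rewrite YE.
have cY : #|Y| = (l t).+1.
  rewrite YE card_imset ?card_ord // => i j /(congr1 (@nat_of_ord _)).
  by rewrite (vtE _ (leq_ord i)) (vtE _ (leq_ord j)) => /addnI/ord_inj.
apply/existsP; exists [tuple vt i | i < #|Y|]; apply/andP; split.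
  apply/eqP/setP => y; rewrite inE; apply/idP/idP.
    case/mapP=> i _ ->; rewrite mY; apply/imsetP.
    have li : i < (l t).+1 by rewrite -cY.
    by exists (Ordinal li).
  rewrite mY => /imsetP[i _ ->]; apply/mapP.
  have li : i < #|Y| by rewrite cY.
  by exists (Ordinal li); rewrite ?mem_enum.
apply/forallP => i; apply/forallP => j; rewrite !tnth_mktuple pgraph_adj /padj.
have li : i <= l t by rewrite -ltnS -cY.
have lj : j <= l t by rewrite -ltnS -cY.
rewrite !vtE // (pcmp_vtx lt li).1 (pcmp_vtx lt lj).1 eqxx andbT.
by rewrite -!addnS !eqn_add2l.
Qed.

End PathForest.

(** * Identification of paths as bin covering *)

Section Cover.
Variables (a : nat -> nat) (TG : nat) (c : nat -> nat) (TL : nat).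
Hypothesis c0 : forall b, b < TL -> 0 < c b.

Definition item_cover (phi : nat -> nat) :=
  (forall t, t < TG -> phi t < TL) /\
  (forall b, b < TL -> c b <= \sum_(t < TG) (phi t == b) * a t).

Local Notation G := (pgraph a TG).
Local Notation L := (pgraph c TL).

(** A path of [G] stays in one component of [L], and each of its edges covers at most one edge
    there; counting edges gives the capacities. *)
Lemma identifies_cover : identifies_to L G -> exists phi, item_cover phi.
Proof.
case/identifies_to_map => f [f1 f2 f3].
pose g u := if insub u is Some x then nat_of_ord (f x : 'I_(pN c TL)) else 0.
have gE (x : G) : g x = f x by rewrite /g valK.
pose phi t := pcmp c TL (g (poff a t)).
have gN u : u < pN a TG -> g u < pN c TL.
  by move=> lu; rewrite -[u]/(nat_of_ord (Ordinal lu)) gE ltn_ord.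
have g1 u : u.+1 < pN a TG -> pcmp a TG u = pcmp a TG u.+1 ->
    g u = g u.+1 \/ padj c TL (g u) (g u.+1).
  move=> lu e; have lu' := ltnW lu.
  have := f1 (Ordinal lu' : G) (Ordinal lu : G); rewrite !pgraph_adj /padj /= eqxx e eqxx => /(_ isT).
  rewrite -[u.+1]/(nat_of_ord (Ordinal lu)) -[u in g u]/(nat_of_ord (Ordinal lu')) !gE.
  by case=> [-> |h]; [left | right; rewrite -/(padj _ _ _ _)].
have phiE t r : t < TG -> r <= a t -> pcmp c TL (g (poff a t + r)) = phi t.
  move=> lt; elim: r => [|r IH] lr; first by rewrite addn0.
  rewrite -IH ?(ltnW lr) // addnS.
  have [e1 l1] := pcmp_vtx lt lr; rewrite addnS in e1 l1.
  have [e2 _] := pcmp_vtx lt (ltnW lr).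
  have := g1 (poff a t + r) l1; rewrite e1 e2 => /(_ erefl)[-> //|].
  by case/andP => _ /eqP.
exists phi; split=> [t lt|b lb].
  have [_ l1] := pcmp_vtx lt (leq0n (a t)); rewrite addn0 in l1.
  by have [] := pcmpP (gN _ l1).
(* Edge [r] of path [t] is sent onto edge [i] of path [b], in either direction. *)
pose P t r i := ((g (poff a t + r) == poff c b + i) && (g (poff a t + r.+1) == poff c b + i.+1))
   || ((g (poff a t + r) == poff c b + i.+1) && (g (poff a t + r.+1) == poff c b + i)).
have Pex i : i < c b -> exists t r, [/\ t < TG, r < a t & P t r i].
  move=> li; have [p1 l1] := pcmp_vtx lb (ltnW li); have [p2 l2] := pcmp_vtx lb li.
  have [|u [v]] := f2 (Ordinal l1 : L) (Ordinal l2 : L).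
    by rewrite pgraph_adj /padj /= p1 p2 eqxx addnS eqxx.
  rewrite pgraph_adj => -[uv fu fv].
  have gu : g u = poff c b + i by rewrite gE fu.
  have gv : g v = poff c b + i.+1 by rewrite gE fv.
  have [cu hu] := pcmpP (ltn_ord u); have [cv hv] := pcmpP (ltn_ord v).
  have ceq : pcmp a TG u = pcmp a TG v by case/andP: uv => _ /eqP.
  move: hv; rewrite -ceq => hv; rewrite poffS in hu hv.
  case/andP: uv => /orP[] /eqP e _.
    exists (pcmp a TG u), (u - poff a (pcmp a TG u)); split=> //; first by lia.
    rewrite /P addnS subnKC; last by lia.
    by rewrite e gu gv !eqxx.
  exists (pcmp a TG u), (v - poff a (pcmp a TG u)); split=> //; first by lia.
  rewrite /P addnS subnKC; last by lia.
  by rewrite e gu gv !eqxx orbT.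
have P1 t r : t < TG -> r < a t -> \sum_(i < c b) (P t r i : nat) <= (phi t == b).
  move=> lt lr; case: (boolP [exists i : 'I_(c b), P t r i]) => [/existsP[i Pi]|/existsPn h].
    rewrite (bigD1 i) //= big1 => [|j /eqP ji].
      have -> : phi t = b; last by rewrite eqxx addn0; case: (P t r i).
      rewrite -(phiE t r) //; last exact: ltnW.
      case/orP: Pi => /andP[/eqP -> _]; first by case: (pcmp_vtx lb (ltnW (ltn_ord i))).
      by case: (pcmp_vtx lb (ltn_ord i)).
    apply/eqP; rewrite eqb0; apply/negP => Pj; apply: ji; apply: ord_inj.
    by move: Pi Pj; rewrite /P; lia.
  by rewrite big1 // => i _; apply/eqP; rewrite eqb0 h.
apply: leq_trans (_ : \sum_(i < c b) \sum_(t < TG) \sum_(r < a t) (P t r i : nat) <= _).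
  rewrite -{1}[c b]card_ord -sum1_card; apply: leq_sum => i _.
  have [t [r [lt lr Pt]]] := Pex i (ltn_ord i).
  by rewrite (bigD1 (Ordinal lt)) //= (bigD1 (Ordinal lr)) //= Pt.
rewrite exchange_big /=; apply: leq_sum => t _.
rewrite exchange_big /=; apply: leq_trans (_ : \sum_(r < a t) (phi t == b : nat) <= _).
  by apply: leq_sum => r _; apply: P1.
by rewrite sum_nat_const card_ord mulnC.
Qed.

(** The paths assigned to a component are laid end to end along it, and surplus length is collapsed
    onto its last vertex. *)
Lemma cover_identifies phi : item_cover phi -> identifies_to L G.
Proof.
case=> phiL phiC.
(* Starting point of path [t]: the total length of the earlier paths in its bin. *)
pose st t := \sum_(s < t) (phi s == phi t) * a s.
pose g u := let t := pcmp a TG u in poff c (phi t) + minn (st t + (u - poff a t)) (c (phi t)).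
have gE t r : t < TG -> r <= a t -> g (poff a t + r) = poff c (phi t) + minn (st t + r) (c (phi t)).
  by move=> lt lr; rewrite /g (pcmp_vtx lt lr).1 addKn.
have gN u : u < pN a TG -> g u < pN c TL.
  move=> lu; have [ct hu] := pcmpP lu.
  by apply: (pcmp_vtx (phiL _ ct) _).2; rewrite geq_minr.
have gcomp u : u < pN a TG -> pcmp c TL (g u) = phi (pcmp a TG u).
  move=> lu; have [ct hu] := pcmpP lu.
  by apply: (pcmp_vtx (phiL _ ct) _).1; rewrite geq_minr.
pose f (x : G) : L := Ordinal (gN x (ltn_ord x)).
apply: (map_identifies_to (f := f)).
have step u : u.+1 < pN a TG -> pcmp a TG u = pcmp a TG u.+1 ->
   g u.+1 = g u \/ g u.+1 = (g u).+1.
  move=> lu e; have [ct hu] := pcmpP (ltnW lu); rewrite /g -e subSn; last by lia.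
  by rewrite addnS; move: (st _ + _) (c _) => p q; rewrite /minn; do 2?case: ltnP => ?; lia.
have edges b i : b < TL -> i < c b -> exists t r, [/\ t < TG, r < a t,
   g (poff a t + r) = poff c b + i & g (poff a t + r.+1) = poff c b + i.+1].
  move=> lb li; pose pre m := \sum_(s < m) (phi s == b) * a s.
  have [t [lt pt pt']] : exists t, [/\ t < TG, pre t <= i & i < pre t.+1].
    have : i < pre TG by apply: leq_trans li (phiC b lb).
    elim: (TG) => [|m IH]; first by rewrite /pre big_ord0.
    case: (ltnP i (pre m)) => [/IH[t [lt h1 h2]] _|h lt]; last by exists m.
    by exists t; split=> //; apply: ltnW.
  have pb : phi t = b.
    by move: pt'; rewrite /pre big_ord_recr /= -/(pre t); case: eqP => // _; rewrite mul0n addn0; lia.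
  move: pt'; rewrite /pre big_ord_recr /= -/(pre t) pb eqxx mul1n => pt'.
  have sE : st t = pre t by rewrite /st pb.
  exists t, (i - pre t); split=> //; first by lia.
    by rewrite gE ?pb ?sE //; [congr (_ + _); rewrite /minn; case: ltnP; lia | lia].
  by rewrite gE ?pb ?sE //; [congr (_ + _); rewrite /minn; case: ltnP; lia | lia].
split.
- move=> x y; rewrite !pgraph_adj => /andP[/orP[] /eqP xy /eqP e].
    have lu : x.+1 < pN a TG by rewrite xy.
    have := step x lu; rewrite xy => /(_ e)[h|h]; [left | right]; first exact: ord_inj.
    by rewrite /padj /= h eqxx /= -h !gcomp // e.
  have lu : y.+1 < pN a TG by rewrite xy.
  have := step y lu; rewrite xy => /(_ (esym e))[h|h]; [left | right]; first exact: ord_inj.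
  by rewrite /padj /= h eqxx orbT /= -h !gcomp // e.
- have main (x y : L) : x.+1 = y -> pcmp c TL x = pcmp c TL y ->
      exists u v : G, [/\ adj u v, f u = x & f v = y].
    move=> xy e; have [ct hx] := pcmpP (ltn_ord x); have [_ hy] := pcmpP (ltn_ord y).
    rewrite -e -xy poffS in hy.
    have ar (p q r : nat) : p <= q -> p <= q.+1 < p + r.+1 -> q - p < r by lia.
    have /andP[hx1 _] := hx.
    have [|t [r [lt lr g1 g2]]] := edges (pcmp c TL x) (x - poff c (pcmp c TL x)) ct.
      exact: ar hy.
    have [p1 l1] := pcmp_vtx lt (ltnW lr); have [p2 l2] := pcmp_vtx lt lr.
    exists (Ordinal l1), (Ordinal l2); split.
    + by rewrite pgraph_adj /padj /= p1 p2 addnS !eqxx.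
    + by apply: ord_inj; rewrite /= g1 subnKC.
    by apply: ord_inj; rewrite /= g2 addnS subnKC.
  move=> x y; rewrite pgraph_adj => /andP[/orP[] /eqP xy /eqP e]; first exact: main.
  have [v [u [uv fv fu]]] := main _ _ xy (esym e).
  by exists u, v; rewrite adj_sym.
move=> x; have [ct hx] := pcmpP (ltn_ord x); rewrite poffS in hx.
have cpos := c0 ct; set b := pcmp c TL x in ct hx cpos.
case: (ltnP (x - poff c b) (c b)) => h.
  have [t [r [lt lr g1 g2]]] := edges b (x - poff c b) ct h.
  have [_ l1] := pcmp_vtx lt (ltnW lr); exists (Ordinal l1).
  by apply: ord_inj; rewrite /= g1 subnKC //; case/andP: hx.
(* The last vertex of a component is reached as the far end of its last edge, which exists because
   [c b] is positive. *)
have h' : (c b).-1 < c b by lia.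
have [t [r [lt lr g1 g2]]] := edges b (c b).-1 ct h'.
have [_ l1] := pcmp_vtx lt lr; exists (Ordinal l1).
have ar (p q m : nat) : p <= q < p + m.+1 -> m <= q - p -> q = p + m by lia.
by apply: ord_inj; rewrite /= g2 prednK // -(ar _ _ _ hx h).
Qed.

End Cover.

(** * The reduction is polynomial *)

Lemma pw_poly c x y : polyf x -> polyf y -> polyf (fun w e => pw c (x w e) (y w e)).
Proof.
apply: (polyf_app2 (F := fun _ B i => pw c B i)).
have pE B i : pw c B i = iteri (minn i c) (fun _ a => B * a) 1.
  by rewrite /pw; elim: (minn i c) => //= m <-; rewrite expnS.
apply: (polyf_ext (f := fun _ e => iteri (head 0 (behead e) - (head 0 (behead e) - c))
   (fun _ a => head 0 e * a) 1)); last first.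
  by move=> w e; rewrite pE minnE.
apply: (polyf_iteri (N := fun _ e => head 0 (behead e) - (head 0 (behead e) - c)) (Z := fun _ _ => 1)
  (S := fun _ e _ a => head 0 e * a) (B := fun w e => mz w e ^ c)).
- by pf.
- by pf.
- by pf.
- by pb.
move=> w e i le; have -> : iteri i (fun _ a => head 0 e * a) 1 = head 0 e ^ i.
  by elim: i {le} => //= i ->; rewrite expnS.
apply: leq_trans (_ : mz w e ^ i <= _); last by rewrite leq_exp2l //; lia.
by apply: leq_exp; rewrite /mz; case: (e) => [|a s] /=; lia.
Qed.

Ltac pf_base := first [apply: pw_poly | pf_circuit].

Ltac pf_named ::= pf_base.

Definition K1 w := (kk w).+1.
Definition bb w := (nn w).+1.

Lemma K1_poly : polyf (fun w _ => K1 w). Proof. by rewrite /K1; pf. Qed.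
Lemma bb_poly : polyf (fun w _ => bb w). Proof. by rewrite /bb; pf. Qed.
Lemma KD_poly D : polyf (fun w _ => pKD (K1 w) D).
Proof. by rewrite /pKD; apply: polyf_exp; apply: K1_poly. Qed.
Lemma bD_poly D : polyf (fun w _ => pbD (bb w) D).
Proof. by rewrite /pbD; apply: polyf_exp; apply: bb_poly. Qed.

Ltac pf_named ::= first [exact: K1_poly | exact: bb_poly | exact: KD_poly | exact: bD_poly | pf_base].

Section Polys.
Variables (D : nat) (x y : seq bool -> seq nat -> nat).
Hypotheses (px : polyf x) (py : polyf y).

Lemma pZ_poly : polyf (fun w _ => pZ (K1 w) D).
Proof. by rewrite /pZ; pf. Qed.

Lemma dg1_poly : polyf (fun w e => dg1 (K1 w) D (x w e) (y w e)).
Proof. by apply: (polyf_app2 (F := fun w J i => dg1 (K1 w) D J i)) => //; rewrite /dg1; pf. Qed.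

Lemma isv_poly : polyf (fun w e => isv (K1 w) D (x w e)).
Proof. by apply: (polyf_app1 (F := fun w u => isv (K1 w) D u)) => //; rewrite /isv; pf. Qed.

Lemma bj_poly : polyf (fun w e => bj (K1 w) D (x w e)).
Proof. by apply: (polyf_app1 (F := fun w u => bj (K1 w) D u)) => //; rewrite /bj; pf. Qed.

Lemma bJ_poly : polyf (fun w e => bJ D (x w e)).
Proof. by apply: (polyf_app1 (F := fun w u => bJ D u)) => //; rewrite /bJ; pf. Qed.

Lemma bi_poly : polyf (fun w e => bi D (x w e)).
Proof. by apply: (polyf_app1 (F := fun w u => bi D u)) => //; rewrite /bi; pf. Qed.

End Polys.

Ltac pf_block := first [exact: K1_poly | exact: bb_poly | exact: KD_poly | exact: bD_poly
  | exact: pZ_poly | apply: dg1_poly | apply: isv_poly | apply: bj_poly | apply: bJ_poly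
  | apply: bi_poly].

Ltac pf_named ::= first [pf_block | pf_base].

Section Polys2.
Variables (D : nat) (x y : seq bool -> seq nat -> nat).
Hypotheses (px : polyf x) (py : polyf y).

Lemma uns_poly : polyf (fun w e => uns (K1 w) D (x w e)).
Proof. by apply: (polyf_app1 (F := fun w u => uns (K1 w) D u)) => //; rewrite /uns; pf. Qed.

Lemma sel_poly : polyf (fun w e => sel (K1 w) D (x w e)).
Proof. by apply: (polyf_app1 (F := fun w u => sel (K1 w) D u)) => //; rewrite /sel; pf. Qed.

Lemma tau_poly : polyf (fun w e => tau (K1 w) (bb w) D (x w e)).
Proof. by apply: (polyf_app1 (F := fun w u => tau (K1 w) (bb w) D u)) => //; rewrite /tau; pf. Qed.

Lemma pcl_poly : polyf (fun w e => pcl (K1 w) D (x w e)).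
Proof. by apply: (polyf_app1 (F := fun w u => pcl (K1 w) D u)) => //; rewrite /pcl; pf. Qed.

Lemma qcl_poly : polyf (fun w e => qcl (K1 w) D (x w e)).
Proof. by apply: (polyf_app1 (F := fun w u => qcl (K1 w) D u)) => //; rewrite /qcl; pf. Qed.

Lemma Rw_poly : polyf (fun w e => Rw (K1 w) (bb w) D (x w e)).
Proof. by apply: (polyf_app1 (F := fun w u => Rw (K1 w) (bb w) D u)) => //; rewrite /Rw; pf. Qed.

Lemma NB_poly : polyf (fun w _ => NB (K1 w) D).
Proof. by rewrite /NB; pf. Qed.

End Polys2.

Ltac pf_block2 := first [apply: uns_poly | apply: sel_poly | apply: tau_poly | apply: pcl_poly
  | apply: qcl_poly | apply: Rw_poly | exact: NB_poly].

Ltac pf_named ::= first [pf_block | pf_block2 | pf_base].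

Section Polys3.
Variables (D : nat) (x y : seq bool -> seq nat -> nat).
Hypotheses (px : polyf x) (py : polyf y).

Lemma v1_poly : polyf (fun w e => v1 (K1 w) (bb w) D (x w e) (y w e)).
Proof.
by apply: (polyf_app2 (F := fun w u v => v1 (K1 w) (bb w) D u v)) => //; rewrite /v1; pf.
Qed.

Lemma v2_poly : polyf (fun w e => v2 (K1 w) (bb w) D (x w e) (y w e)).
Proof.
by apply: (polyf_app2 (F := fun w u v => v2 (K1 w) (bb w) D u v)) => //; rewrite /v2; pf.
Qed.

Lemma phi0_poly : polyf (fun w e => phi0 (K1 w) D (x w e) (y w e)).
Proof.
by apply: (polyf_app2 (F := fun w u v => phi0 (K1 w) D u v)) => //; rewrite /phi0; pf.
Qed.

End Polys3.

Ltac pf_block3 := first [apply: v1_poly | apply: v2_poly | apply: phi0_poly].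
Ltac pf_named ::= first [pf_block | pf_block2 | pf_block3 | pf_base].

Lemma dg_poly D c x y : polyf x -> polyf y -> polyf (fun w e => dg (K1 w) (bb w) D c (x w e) (y w e)).
Proof.
move=> px py; apply: (polyf_app2 (F := fun w u v => dg (K1 w) (bb w) D c u v)) => // {x y px py}.
by rewrite /dg; case: c => [|[|[|[|[|[|[|c]]]]]]] /=; rewrite ?nth_nil; pf.
Qed.

Lemma polyf_sum_ord m (F : nat -> seq bool -> seq nat -> nat) :
  (forall c, polyf (F c)) -> polyf (fun w e => \sum_(c < m) F c w e).
Proof.
move=> pF; elim: m => [|m IH].
  by apply: (polyf_ext polyf_zero) => w e; rewrite big_ord0.
by apply: (polyf_ext (polyf_add IH (pF m))) => w e; rewrite big_ord_recr.
Qed.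

Lemma BB_poly D : polyf (fun w _ => BB (K1 w) (bb w) D).
Proof.
apply: polyf_succ.
apply: (polyf_sumf (N := fun w _ => NB (K1 w) D)
  (F := fun w _ blk => sumf (pbD (bb w) D) (fun u => \sum_(c < 7) dg (K1 w) (bb w) D c blk u))).
  exact: NB_poly.
apply: (polyf_sumf (N := fun w _ => pbD (bb w) D)
  (F := fun w e u => \sum_(c < 7) dg (K1 w) (bb w) D c (head 0 e) u)).
  exact: bD_poly.
apply: (polyf_sum_ord 7
  (F := fun c w e => dg (K1 w) (bb w) D c (head 0 (behead e)) (head 0 e))) => c.
by apply: dg_poly; pf.
Qed.

Lemma mainw_poly D x y : polyf x -> polyf y ->
  polyf (fun w e => mainw (K1 w) (bb w) D (x w e) (y w e)).
Proof.
move=> px py; apply: (polyf_sum_ord 7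
  (F := fun c w e => dg (K1 w) (bb w) D c (x w e) (y w e) * BB (K1 w) (bb w) D ^ c)) => c.
apply: polyf_mul; first exact: dg_poly.
by apply: polyf_exp; apply: BB_poly.
Qed.

(** * Weights of the candidate tuples *)

Section Weights.
Variable d : nat.
(** The level of [qf d]: [d] doublings of the degree for weft 0, and [d.+1] for the pairs [T],
    [F]. *)
Definition EE := d + d.+1.
Definition DD := 2 ^ EE.

Definition digb w y i := y %/ pw DD (bb w) i %% bb w.

(** What [y = x o J] has to satisfy if [x] is increasing and ends in [n], as far as a single tuple
    shows it. *)
Definition valid w J y : bool :=
  allf DD (fun i => ((dg1 (K1 w) DD J i != kk w) || (digb w y i == nn w)) &&
    allf DD (fun j => ~~ (dg1 (K1 w) DD J i < dg1 (K1 w) DD J j) || (digb w y i < digb w y j))).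

Definition qsum w := sumf (pbD (bb w) DD) (fun y => `|qf d w y|%N).
Definition AA w := pKD (K1 w) DD * qsum w.

(** The offset [AA] makes the weights of valid tuples nonnegative, and losing it for one invalid
    tuple already keeps the sum below [thr]. *)
Definition Wf w J y := if valid w J y then absz ((AA w)%:Z + qf d w y)%R else 0.
Definition thr w := pKD (K1 w) DD * AA w + 1.

Lemma digb_poly x y : polyf x -> polyf y -> polyf (fun w e => digb w (x w e) (y w e)).
Proof.
by move=> px py; apply: (polyf_app2 (F := fun w u v => digb w u v)) => //; rewrite /digb; pf.
Qed.

Ltac pf_named ::= first [apply: digb_poly | pf_block | pf_block2 | pf_block3 | pf_base].

Lemma valid_poly x y : polyf x -> polyf y -> polyf (fun w e => valid w (x w e) (y w e)).
Proof.
by move=> px py; apply: (polyf_app2 (F := fun w u v => valid w u v)) => //; rewrite /valid; pf.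
Qed.

Lemma AA_poly : polyf (fun w _ => AA w).
Proof.
rewrite /AA; apply: polyf_mul; first by pf.
apply: (polyf_sumf (N := fun w _ => pbD (bb w) DD) (F := fun w _ y => `|qf d w y|%N)); first by pf.
by apply: polyf_absz; apply: qf_poly; pf.
Qed.

Lemma Wf_poly x y : polyf x -> polyf y -> polyf (fun w e => Wf w (x w e) (y w e)).
Proof.
move=> px py; rewrite /Wf; apply: polyf_if; [exact: valid_poly | | exact: polyf_zero].
apply: polyf_absz; apply: polyz_add; last exact: qf_poly.
exact: polyz_nat AA_poly.
Qed.

Lemma Wt_poly x y : polyf x -> polyf y ->
  polyf (fun w e => Wt (K1 w) DD (Wf w) (x w e) (y w e)).
Proof.
move=> px py; rewrite /Wt; apply: polyf_if; [exact: isv_poly | exact: polyf_zero |].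
apply: polyf_if; [| by apply: Wf_poly => //; apply: bJ_poly | exact: polyf_zero].
by apply: polyf_eq; [apply: bi_poly | apply: polyf_const].
Qed.

Definition Bigw w := Big (K1 w) (bb w) DD (Wf w).

Lemma Big_poly : polyf (fun w _ => Bigw w).
Proof.
apply: polyf_succ.
apply: (polyf_sumf (N := fun w _ => NB (K1 w) DD)
  (F := fun w _ blk => sumf (pbD (bb w) DD) (fun u => Wt (K1 w) DD (Wf w) blk u))); first by pf.
apply: (polyf_sumf (N := fun w _ => pbD (bb w) DD)
  (F := fun w e u => Wt (K1 w) DD (Wf w) (head 0 e) u)); first by pf.
by apply: Wt_poly; pf.
Qed.

Definition isz w blk u := isize (K1 w) (bb w) DD (Wf w) blk u.
Definition lG w t := isz w (t %/ pbD (bb w) DD) (t %% pbD (bb w) DD).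
Definition lL w bin := cap (K1 w) (bb w) DD (Wf w) (thr w) bin.
Definition TG w := NB (K1 w) DD * pbD (bb w) DD.
Definition TL w := (pZ (K1 w) DD).+1.

Lemma lG_poly x : polyf x -> polyf (fun w e => lG w (x w e)).
Proof.
move=> px; apply: (polyf_app1 (F := lG)) => //.
rewrite /lG /isz /isize; apply: polyf_add.
  by apply: polyf_mul; [exact: Big_poly | apply: mainw_poly; pf].
by apply: Wt_poly; pf.
Qed.

Lemma lL_poly x : polyf x -> polyf (fun w e => lL w (x w e)).
Proof.
move=> px; apply: (polyf_app1 (F := lL)) => //.
rewrite /lL /cap; apply: polyf_add; last first.
  apply: polyf_if; [by pf | | exact: polyf_zero].
  by rewrite /thr; apply: polyf_add; [apply: polyf_mul AA_poly; pf | exact: polyf_const].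
apply: polyf_mul; first exact: Big_poly.
apply: (polyf_sumf (N := fun w _ => NB (K1 w) DD)
  (F := fun w e blk => sumf (pbD (bb w) DD) (fun u => (phi0 (K1 w) DD blk u == head 0 e) * mainw (K1 w) (bb w) DD blk u))); first by pf.
apply: (polyf_sumf (N := fun w _ => pbD (bb w) DD)
  (F := fun w e u => (phi0 (K1 w) DD (head 0 e) u == head 0 (behead e)) * mainw (K1 w) (bb w) DD (head 0 e) u)); first by pf.
by apply: polyf_mul; [pf | apply: mainw_poly; pf].
Qed.

Lemma TG_poly : polyf (fun w _ => TG w). Proof. by rewrite /TG; pf. Qed.
Lemma TL_poly : polyf (fun w _ => TL w). Proof. by rewrite /TL; pf. Qed.

End Weights.

Section GraphPoly.
Variables (l : seq bool -> nat -> nat) (T : seq bool -> nat).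
Hypothesis pl : forall x, polyf x -> polyf (fun w e => l w (x w e)).
Hypothesis pT : polyf (fun w _ => T w).

Lemma poff_poly x : polyf x -> polyf (fun w e => poff (l w) (x w e)).
Proof.
move=> px; apply: (polyf_app1 (F := fun w u => poff (l w) u)) => //.
apply: (polyf_sumf (F := fun w e s => (l w s).+1)); first by pf.
by apply: polyf_succ; apply: pl; pf.
Qed.

Lemma pcmp_poly x : polyf x -> polyf (fun w e => pcmp (l w) (T w) (x w e)).
Proof.
move=> px; apply: (polyf_app1 (F := fun w u => pcmp (l w) (T w) u)) => //.
apply: (polyf_sumf (N := fun w _ => T w) (F := fun w e t => poff (l w) t.+1 <= head 0 e)) => //.
by apply: polyf_leq; [apply: poff_poly; pf | pf].
Qed.

Lemma padj_poly x y : polyf x -> polyf y ->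
  polyf (fun w e => padj (l w) (T w) (x w e) (y w e)).
Proof.
move=> px py; rewrite /padj; apply: polyf_andb; last first.
  by apply: polyf_eq; apply: pcmp_poly.
by apply: polyf_orb; apply: polyf_eq => //; apply: polyf_succ.
Qed.

Lemma pN_poly : polyf (fun w _ => pN (l w) (T w)).
Proof. exact: poff_poly. Qed.

End GraphPoly.

(** * Correctness of the reduction *)

Section Correct.
Variables (d : nat) (C : circuit) (k : nat).
Hypothesis weftC : weft C <= 1.
Hypothesis depthC : depth C <= d.

Let n := cinputs C.
Let gs := cgates C.
Let w := bits_of (k :: circuit_code C).
Let D := DD d.
Let KD := pKD k.+1 D.
Let bD := pbD n.+1 D.

Local Notation Xm x J := (Xmap k.+1 n.+1 x D J).

Lemma K1E : K1 w = k.+1. Proof. by rewrite /K1 kkE. Qed.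
Lemma bbE : bb w = n.+1. Proof. by rewrite /bb nnE. Qed.

Lemma n_gt0 : 0 < n. Proof. by rewrite /n; case: (C) => ? ? /= /andP[]. Qed.
Lemma wf_gs : wf_gates n gs. Proof. by rewrite /n /gs; case: (C) => ? ? /= /andP[]. Qed.

Lemma D_gt1 : 1 < D. Proof. by rewrite -(expn0 2) ltn_exp2l // /EE; lia. Qed.

Lemma KD_gt0 : 0 < KD. Proof. by rewrite expn_gt0. Qed.

Lemma qf_le y : y < bD -> absz (qf d w y) <= qsum d w.
Proof.
by move=> lt; rewrite /qsum bbE -/D -/bD /sumf (bigD1 (Ordinal lt)) //=; apply: leq_addr.
Qed.

Lemma AAE : AA d w = KD * qsum d w. Proof. by rewrite /AA K1E. Qed.

Lemma qsum_AA : qsum d w <= AA d w.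
Proof. by rewrite AAE leq_pmull // KD_gt0. Qed.

Section Point.
Variable x : nat -> nat.
Hypothesis xb : forall j, j < k.+1 -> x j < n.+1.

Lemma digb_Xmap J i : i < D ->
  digb d w (Xm x J) i = x (dg1 k.+1 D J i).
Proof.
move=> li; rewrite /digb bbE pwE ?(ltnW li) // (dig_sum (f := fun i => x (dig k.+1 J i))) //.
  by rewrite /dg1 /dig pwE // ltnW.
by move=> t _; apply: xb; rewrite ltn_mod.
Qed.

Lemma validP J : reflect
  (forall i, i < D -> (dg1 k.+1 D J i = k -> x k = n) /\
     (forall j, j < D -> dg1 k.+1 D J i < dg1 k.+1 D J j ->
        x (dg1 k.+1 D J i) < x (dg1 k.+1 D J j)))
  (valid d w J (Xm x J)).
Proof.
apply: (iffP (allfP _ _)) => h i li.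
  have /andP[h1 /allfP h2] := h i li; rewrite kkE nnE K1E -/D digb_Xmap // in h1.
  split=> [e|j lj lt]; first by move: h1; rewrite e eqxx /= => /eqP.
  by have := h2 j lj; rewrite K1E -/D !digb_Xmap // lt.
have [h1 h2] := h i li; apply/andP; split.
  rewrite kkE nnE K1E -/D digb_Xmap //; case: eqP => // e /=.
  by rewrite e h1.
apply/allfP => j lj; rewrite K1E -/D !digb_Xmap //.
by case: ltnP => //= lt; apply: h2.
Qed.

(** As [D] is at least 2, any two indices occur together in some [J], whose validity compares their
    values; a [J] containing [k] gives [x k = n]. *)
Lemma all_valid_inc : (forall J, J < KD -> valid d w J (Xm x J)) ->
  (forall i j, i < j -> j <= k -> x i < x j) /\ x k = n.
Proof.
move=> h.
have D1 := D_gt1; have D0 := ltnW D1.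
have K2 : k.+1 * k.+1 <= KD.
  by rewrite mulnn /KD /pKD leq_pexp2l.
split=> [i j ij jk|].
  have lJ : i + j * k.+1 < KD by apply: leq_trans K2; nia.
  have li : i < k.+1 by lia.
  have d0 : dg1 k.+1 D (i + j * k.+1) 0 = i.
    by rewrite /dg1 pwE // expn0 divn1 addnC modnMDl modn_small.
  have d1 : dg1 k.+1 D (i + j * k.+1) 1 = j.
    by rewrite /dg1 pwE // expn1 addnC divnMDl // divn_small // addn0 modn_small.
  by have /validP/(_ 0 D0)[_ /(_ 1 D1)] := h _ lJ; rewrite d0 d1; apply.
have lJ : k < KD by apply: leq_trans K2; nia.
have /validP/(_ 0 D0)[h1 _] := h _ lJ; apply: h1.
by rewrite /dg1 pwE // expn0 divn1 modn_small.
Qed.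

Lemma Wf_sum : (forall J, J < KD -> valid d w J (Xm x J)) ->
  Posz (\sum_(J < KD) Wf d w J (Xm x J)) =
  (Posz (KD * AA d w) + ev k.+1 n.+1 x (d + d.+1) (qf d w))%R.
Proof.
move=> h; rewrite (big_morph Posz PoszD (erefl (Posz 0))).
rewrite (eq_bigr (fun J : 'I_KD => (Posz (AA d w) + qf d w (Xm x J))%R)).
  rewrite big_split /= sumr_const card_ord; congr (_ + _)%R.
  by rewrite -mulr_natl natz PoszM.
move=> J _; rewrite /Wf h //.
have lt := @Xmap_lt k.+1 n.+1 x (ltn0Sn k) xb D J.
have := qf_le lt; have := qsum_AA; lia.
Qed.

Lemma Wf_le J : Wf d w J (Xm x J) <= AA d w + qsum d w.
Proof.
rewrite /Wf; case: ifP => // _.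
have lt := @Xmap_lt k.+1 n.+1 x (ltn0Sn k) xb D J.
by have := qf_le lt; lia.
Qed.

(** With an invalid tuple the sum is at most [(KD - 1) (AA + qsum)], which is below [KD * AA + 1]
    because [AA = KD * qsum]. *)
Lemma thr_valid : thr d w <= \sum_(J < KD) Wf d w J (Xm x J) ->
  forall J, J < KD -> valid d w J (Xm x J).
Proof.
move=> le J lJ; apply: contraLR le => nv.
rewrite -ltnNge (bigD1 (Ordinal lJ)) //= {1}/Wf (negbTE nv) add0n.
apply: (@leq_ltn_trans (\sum_(J' < KD | J' != Ordinal lJ) (AA d w + qsum d w))).
  by apply: leq_sum => J' _; apply: Wf_le.
rewrite sum_nat_const cardC1 card_ord /thr K1E -/KD AAE.
by have := KD_gt0; move: (KD) (qsum d w) => K q K0; nia.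
Qed.

Lemma sat_iff : (forall i j, i < j -> j <= k -> x i < x j) -> x k = n ->
  (0 < ev k.+1 n.+1 x (d + d.+1) (qf d w))%R = circuit_val C (asg n k x).
Proof.
move=> x_inc x_last; rewrite (EV_qf n_gt0 wf_gs x_inc x_last).
- by rewrite /circuit_val propagateE ?size_asg ?n_gt0.
- by move: depthC; rewrite /depth propagateE ?size_nseq ?n_gt0.
by move: weftC; rewrite /weft propagateE ?size_nseq ?n_gt0.
Qed.

End Point.

Lemma count_asg x : (forall i j, i < j -> j <= k -> x i < x j) -> x k = n ->
  count id (asg n k x) = k.
Proof.
move=> x_inc x_last; rewrite /asg /mkseq count_map -size_filter.
rewrite -[RHS](size_iota 0 k) -[RHS](size_map x).
apply: perm_size; apply: uniq_perm.
- by rewrite filter_uniq // iota_uniq.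
- rewrite map_inj_in_uniq ?iota_uniq // => i j; rewrite !mem_iota !add0n => /andP[_ li] /andP[_ lj].
  by apply: (x_inj x_inc); apply: ltnW.
move=> v; rewrite mem_filter mem_iota /= add0n; apply/andP/mapP => [[/hasP[j jk /eqP <-] _]|[j jk ->]].
  by exists j.
split; first by apply/hasP; exists j.
by move: jk; rewrite mem_iota /= add0n -x_last => lt; apply: x_inc.
Qed.

Lemma weights_iff :
  (exists2 x, forall j, j < k.+1 -> x j < n.+1 &
     thr d w <= \sum_(J < KD) Wf d w J (Xm x J)) <->
  (exists a : seq bool, [/\ size a = n, count id a = k & circuit_val C a]).
Proof.
have thrE x : (forall j, j < k.+1 -> x j < n.+1) ->
   (forall J, J < KD -> valid d w J (Xm x J)) ->
   (thr d w <= \sum_(J < KD) Wf d w J (Xm x J)) =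
   (0 < ev k.+1 n.+1 x (d + d.+1) (qf d w))%R.
  move=> xb va; rewrite -lez_nat Wf_sum // /thr K1E -/KD PoszD.
  by rewrite Num.Theory.lerD2l.
split=> [[x xb le]|[a [sa ca va]]].
  have va := thr_valid xb le; have [x_inc x_last] := all_valid_inc xb va.
  exists (asg n k x); split; first exact: size_asg.
    exact: count_asg.
  by rewrite -sat_iff // -thrE.
pose lst := [seq v <- iota 0 n | nth false a v].
have slst : size lst = k.
  rewrite size_filter -ca -{2}(mkseq_nth false a) /mkseq count_map sa.
  exact: eq_count.
have srt : sorted ltn lst by apply: sorted_filter (iota_ltn_sorted 0 n); apply: ltn_trans.
(* The list has length [k], so the default of [nth] supplies [x k = n]. *)
pose x j := nth n lst j.
have x_lt j : j < k -> x j < n.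
  move=> lj; have : x j \in lst by rewrite mem_nth // slst.
  by rewrite mem_filter mem_iota => /andP[_].
have x_last : x k = n by rewrite /x nth_default // slst.
have x_inc i j : i < j -> j <= k -> x i < x j.
  move=> ij; rewrite leq_eqVlt => /orP[/eqP jk|jk].
    by rewrite jk x_last x_lt // -jk.
  by apply: (sorted_ltn_nth ltn_trans n srt); rewrite ?inE ?slst //; apply: ltn_trans jk.
have xb j : j < k.+1 -> x j < n.+1 by apply: (x_le x_inc x_last).
exists x => //; rewrite thrE //.
  rewrite sat_iff //; suff -> : asg n k x = a by [].
  apply: (@eq_from_nth _ false); first by rewrite size_asg sa.
  move=> v; rewrite size_asg => lv; rewrite /asg nth_mkseq //.
  apply/hasP/idP => [[j]|av].
    rewrite mem_iota /= add0n => lj /eqP <-.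
    have : x j \in lst by rewrite mem_nth // slst.
    by rewrite mem_filter => /andP[].
  have vl : v \in lst by rewrite mem_filter av mem_iota.
  exists (index v lst); first by rewrite mem_iota /= add0n -slst index_mem.
  by rewrite /x nth_index.
move=> J lJ; apply/validP => // i li; split=> // j lj lt; apply: x_inc => //.
by rewrite -ltnS ltn_mod.
Qed.

Let a := lG d w.
Let c := lL d w.

Lemma divmod_bD blk u : u < bD -> (blk * bD + u) %/ bD = blk /\ (blk * bD + u) %% bD = u.
Proof.
move=> lu; have b0 : 0 < bD by apply: leq_ltn_trans lu.
by rewrite divnMDl // modnMDl divn_small // modn_small // addn0.
Qed.

(** The reference filling puts an item of positive weight into every bin. *)
Lemma lL_gt0 b : b < TL d w -> 0 < c b.
Proof.
rewrite /TL K1E -/D => lb; rewrite /c /lL /cap; apply: ltn_addr; rewrite muln_gt0 /=.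
rewrite K1E bbE -/D.
have K0 : 0 < k.+1 by []; have b1 : 1 < n.+1 by rewrite ltnS n_gt0.
have D0 : 0 < D := ltnW D_gt1.
have bd1 := bD1 b1 D0.
have [blk [u [lk lu pE]]] : exists blk u, [/\ blk < NB k.+1 D, u < bD & phi0 k.+1 D blk u = b].
  case: (ltnP b KD) => h1.
    exists (jb D b 0), 1; split=> //; first exact: jb_lt.
    by rewrite phi0_J.
  case: (ltnP b (KD + k.+1)) => h2.
    exists (vb k.+1 D (b - KD)), 0; split=> //; [by apply: vb_lt; lia | exact: ltnW |].
    by rewrite phi0_v /= subnKC.
  exists (jb D 0 D), 0; split; [by apply: jb_lt; rewrite ?KD_gt0 | exact: ltnW |].
  by rewrite phi0_J ?KD_gt0 //= eqxx; rewrite /pZ -/KD in lb *; lia.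
rewrite /binsum (bigD1 (Ordinal lk)) //= (bigD1 (Ordinal lu)) //= pE eqxx mul1n.
do 2![apply: ltn_addr]; rewrite /mainw big_ord_recl; apply: ltn_addr.
by rewrite /= expn0 muln1 tau_gt0.
Qed.

Lemma cover_index (F : nat -> nat -> nat) (phi : nat -> nat -> nat) b :
  \sum_(t < NB k.+1 D * bD) (phi (t %/ bD) (t %% bD) == b) * F (t %/ bD) (t %% bD) =
  \sum_(blk < NB k.+1 D) \sum_(u < bD) (phi blk u == b) * F blk u.
Proof.
rewrite (sum_nat_block _ _ (fun t => (phi (t %/ bD) (t %% bD) == b) * F (t %/ bD) (t %% bD))).
apply: eq_bigr => blk _; apply: eq_bigr => u _.
by have [-> ->] := divmod_bD blk (ltn_ord u).
Qed.

Lemma cover_iff : (exists phi, item_cover a (TG d w) c (TL d w) phi) <->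
  (exists phi, covers k.+1 n.+1 D (Wf d w) (thr d w) phi).
Proof.
have b0 : 0 < bD by rewrite expn_gt0.
rewrite /a /c /TG /TL K1E bbE -/D -/bD; split=> [[phi [h1 h2]]|[phi [h1 h2]]].
  exists (fun blk u => phi (blk * bD + u)); split=> [blk u lk lu|b lb].
    apply: h1; apply: (@leq_trans (blk.+1 * bD)); first by rewrite mulSn addnC ltn_add2r.
    by rewrite leq_mul2r lk orbT.
  have := h2 b lb; rewrite /lL K1E bbE -/D => le; apply: leq_trans le _.
  have e := cover_index (isize k.+1 n.+1 D (Wf d w)) (fun blk u => phi (blk * bD + u)) b.
  apply: leq_trans (eq_leq _) (eq_leq e); apply: eq_bigr => t _.
  by rewrite -divn_eq /lG /isz K1E bbE.
exists (fun t => phi (t %/ bD) (t %% bD)); split=> [t lt|b lb].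
  by apply: h1; [rewrite ltn_divLR | rewrite ltn_mod].
rewrite /lL K1E bbE -/D; apply: leq_trans (h2 b lb) _.
have e := cover_index (isize k.+1 n.+1 D (Wf d w)) phi b.
apply: leq_trans (eq_leq (esym e)) (eq_leq _); apply: eq_bigr => t _.
by rewrite /lG /isz K1E bbE.
Qed.

Lemma reduction_correct :
  (exists a : seq bool, [/\ size a = n, count id a = k & circuit_val C a]) <->
  identifies_to (pgraph c (TL d w)) (pgraph a (TG d w)).
Proof.
rewrite -weights_iff -covers_iff ?ltnS ?n_gt0 ?(ltnW D_gt1) // -cover_iff.
split=> [[phi h]|]; last exact: identifies_cover.
by apply: cover_identifies h => b; apply: lL_gt0.
Qed.

End Correct.

(** * Composition with the given reduction *)

Lemma iota_block m N (T : Type) (F : nat -> nat -> T) :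
  [seq F i j | i <- iota 0 m, j <- iota 0 N] =
  [seq F (t %/ N) (t %% N) | t <- iota 0 (m * N)].
Proof.
elim: m => [|m IH]; first by rewrite mul0n.
rewrite mulSnr -{1}addn1 !iotaD allpairs_cat map_cat IH /= add0n cats0; congr (_ ++ _).
have -> : iota (m * N) N = [seq m * N + j | j <- iota 0 N] by rewrite -iotaDl addn0.
rewrite -map_comp; apply/eq_in_map => j; rewrite mem_iota add0n => /andP[_ lj] /=.
by rewrite divnMDl ?(leq_ltn_trans _ lj) // modnMDl divn_small // modn_small // addn0.
Qed.

Lemma pgraph_code l T : ograph_code (pgraph l T) =
  pN l T :: [seq (padj l T (t %/ pN l T) (t %% pN l T) : nat) | t <- iota 0 (pN l T * pN l T)].
Proof.
rewrite /ograph_code /=; congr cons; rewrite -(iota_block _ _ (fun i j => padj l T i j : nat)).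
rewrite -val_enum_ord allpairs_mapl allpairs_mapr.
by apply: eq_allpairs => i j; rewrite /= mxE.
Qed.

Definition out_len (N N' : nat) := N * N + (N' * N' + 2).

Definition out_num (N N' : nat) (F F' : nat -> nat -> nat) t :=
  if t == 0 then N else if t <= N * N then F (t.-1 %/ N) (t.-1 %% N)
  else if t == (N * N).+1 then N' else F' ((t - (N * N + 2)) %/ N') ((t - (N * N + 2)) %% N').

Lemma out_numE N N' F F' :
  (N :: [seq F (t %/ N) (t %% N) | t <- iota 0 (N * N)]) ++
  (N' :: [seq F' (t %/ N') (t %% N') | t <- iota 0 (N' * N')]) =
  [seq out_num N N' F F' t | t <- iota 0 (out_len N N')].
Proof.
have -> : out_len N N' = 1 + (N * N + (1 + N' * N')) by rewrite /out_len; lia.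
rewrite !iotaD !map_cat cat_cons /= !add0n; congr cons.
rewrite (iotaDl 1 0) -map_comp; congr (_ ++ _).
  apply/eq_in_map => t; rewrite mem_iota add0n => /andP[_ lt] /=.
  by rewrite /out_num /= add1n lt.
rewrite /out_num /= add1n ltnn eqxx; congr cons.
rewrite -[(_ + 1)]addn0 iotaDl -map_comp; apply/eq_in_map => t _ /=.
rewrite ifF; last by lia.
rewrite ifF; last by lia.
by rewrite addn1 addn2 addKn.
Qed.

Section Reduction.
Variable d : nat.

Definition red_graph w := pgraph (lG d w) (TG d w).
Definition red_forest w := pgraph (lL d w) (TL d w).

Definition reduction (x : inst (WCS 1 d)) : lf_instance :=
  exist _ (red_graph (enc x), red_forest (enc x))
    (linear_forest_pgraph (lL d (enc x)) (TL d (enc x))).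

Lemma reduction_yes (x : inst (WCS 1 d)) :
  yes x <-> yes (reduction x : inst Identification_linear_forest).
Proof.
case: x => [[C hC] k]; have /andP[wC dC] := hC.
exact: (reduction_correct k wC dC).
Qed.

Definition red_param p := p.+1 ^ DD d + p.+2.

Lemma reduction_param (x : inst (WCS 1 d)) :
  param (reduction x : inst Identification_linear_forest) <= red_param (param x).
Proof.
apply: leq_trans (card_components _ _) _.
case: x => [[C hC] k] /=; rewrite /TL /pZ /pKD.
by rewrite (K1E C k) -addnS.
Qed.

Lemma reduction_prog : exists p h, pbd h /\ forall w, exists2 s',
  wrun w p (Store (fun=> 0) [::]) s' (h w [::]) &
  outp s' = bits_of (ograph_code (red_graph w) ++ ograph_code (red_forest w)).
Proof.
pose NG w := pN (lG d w) (TG d w); pose NL w := pN (lL d w) (TL d w).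
have pNG : polyf (fun w _ => NG w) by apply: pN_poly; [apply: lG_poly | apply: TG_poly].
have pNL : polyf (fun w _ => NL w) by apply: pN_poly; [apply: lL_poly | apply: TL_poly].
pose on w := out_num (NG w) (NL w) (fun i j => padj (lG d w) (TG d w) i j)
   (fun i j => padj (lL d w) (TL d w) i j).
have pG x y : polyf x -> polyf y -> polyf (fun w e => padj (lG d w) (TG d w) (x w e) (y w e)).
  by apply: padj_poly; [apply: lG_poly | apply: TG_poly].
have pL x y : polyf x -> polyf y -> polyf (fun w e => padj (lL d w) (TL d w) (x w e) (y w e)).
  by apply: padj_poly; [apply: lL_poly | apply: TL_poly].
have p1 : polyf (fun w _ => out_len (NG w) (NL w)).
  by rewrite /out_len; do !first [exact: pNG | exact: pNL | exact: polyf_const | apply: polyf_add | apply: polyf_mul].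
have v0 := polyf_v0; have c0 := polyf_const.
have p2 : polyf (fun w e => on w (head 0 e)).
  apply: polyf_if; [exact: polyf_eq | exact: pNG |].
  have pNN : polyf (fun w _ => NG w * NG w) by apply: polyf_mul.
  apply: polyf_if; [exact: polyf_leq | |].
    by apply: pG; [apply: polyf_div => // | apply: polyf_mod => //]; apply: polyf_pred.
  apply: polyf_if; [by apply: polyf_eq => //; apply: polyf_succ | exact: pNL |].
  have p3 : polyf (fun w e => head 0 e - (NG w * NG w + 2)).
    by apply: polyf_sub => //; apply: polyf_add.
  by apply: pL; [apply: polyf_div | apply: polyf_mod].
have [p [h [ph re]]] := emit_runs true p1 p2; exists p, h; split=> // w.
have [s' run out] := re w; exists s' => //; rewrite out !pgraph_code.
rewrite (out_numE (pN (lG d w) (TG d w)) (pN (lL d w) (TL d w))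
  (fun i j => padj (lG d w) (TG d w) i j) (fun i j => padj (lL d w) (TL d w) i j)).
by rewrite /bits_of -map_comp; congr flatten; apply: eq_map => t; rewrite /= /unary -cats1.
Qed.

End Reduction.

Lemma runs_outp w p s s' n : runs w p s s' n -> size (outp s') <= size (outp s) + n.
Proof.
elim=> {p s s' n} /=.
- by move=> s; rewrite addn0.
- by move=> t r s; rewrite leq_addr.
- by move=> b s; rewrite size_rcons addn1.
- by move=> p q s s1 s2 n m _ IH1 _ IH2; lia.
- by move=> c p q s s' n _ _ IH; lia.
- by move=> c p q s s' n _ _ IH; lia.
- by move=> c p s _; lia.
- by move=> c p s s1 s2 n m _ _ IH1 _ IH2; lia.
Qed.

(** The program for [h] runs after the machine for [f], whose unary output is its input word. *)
Lemma computable_post (f : nat -> nat) (h : seq bool -> seq nat -> nat) :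
  computable f -> polyf h ->
  computable (fun n => h (nseq (f n) true) [:: 0]).
Proof.
move=> [M cM] ph.
have [p [b [_ re]]] := emit_runs false (polyf_const 1) ph.
have [M' cM'] := run_after M p; exists M' => n.
have [t ct] := cM n; have [s' [m _ rm] out] := re (nseq (f n) true).
eexists; have := cM' _ _ _ _ _ ct rm; rewrite out /= !cats0; exact.
Qed.

(** All terms are bounded by powers of [Y = (F + 3) * X ^ c1.+1], and a power of [Y] separates into
    a function of the parameter and a polynomial in the size. *)
Lemma time_bound F X c c1 n m v : 0 < X ->
  n = F * X ^ c1 -> v <= X.-1 + n + 1 -> m <= (2 + v) ^ c ->
  n + 2 * v + m + m + 5 <= (F + 3) ^ c.+3 * X ^ (c1.+1 * c.+3).
Proof.
move=> X0 nE le lm; rewrite expnM -expnMn; set Y := (F + 3) * X ^ c1.+1.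
have XX : X <= X ^ c1.+1 by rewrite -{1}(expn1 X) leq_pexp2l.
have n1 : n <= F * X ^ c1.+1 by rewrite nE leq_mul2l leq_pexp2l ?orbT.
have Y3 : 3 <= Y by rewrite /Y; nia.
have v2 : 2 + v <= Y by rewrite /Y mulnDl; lia.
have nY : n <= Y by rewrite /Y mulnDl; lia.
have mY : m <= Y ^ c by apply: leq_trans lm (leq_exp c v2).
have Yc : 0 < Y ^ c by rewrite expn_gt0; lia.
have := leq_mul (leqnn (Y ^ c)) (leq_mul (leq_mul Y3 Y3) (leqnn Y)).
rewrite (_ : Y ^ c * (Y * Y * Y) = Y ^ c.+3); last by rewrite !expnS; lia.
have := leq_mul Yc (leqnn Y); have := leq_mul (leqnn (Y ^ c)) Y3.
lia.
Qed.

Theorem theorem3p3 : W1_hard Identification_linear_forest.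
Proof.
move=> A [d [r [M [f [g [c [[cf cg] ry rp rt]]]]]]].
have [p [h [[e he] re]]] := reduction_prog d.
have [M' cM'] := run_after M p.
exists (fun x => reduction (r x) : inst Identification_linear_forest), M'.
exists (fun k => (f k + 3) ^ e.+3), (fun k => red_param d (g k)), (c.+1 * e.+3).
split.
- split.
    have ph : polyf (fun w _ => (size w + 3) ^ e.+3) by pf.
    have [M1 cM1] := computable_post cf ph; exists M1 => n.
    by have [t] := cM1 n; rewrite size_nseq => ct; exists t.
  have ph : polyf (fun w _ => (size w).+1 ^ DD d + (size w).+2) by pf.
  have [M1 cM1] := computable_post cg ph; exists M1 => n.
  by have [t] := cM1 n; rewrite size_nseq => ct; exists t.
- by move=> x; rewrite ry; apply: reduction_yes.
- move=> x; apply: leq_trans (reduction_param _) _; rewrite /red_param.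
  by apply: leq_add; [apply: leq_exp |]; rewrite !ltnS.
move=> x; have [s' [m mh rm] out] := re (enc (r x)).
have := cM' _ _ _ _ _ (rt x) rm; rewrite out.
apply: computes_within_mono.
have so := runs_outp rm; rewrite add0n in so.
apply: leq_trans (time_bound (ltn0Sn (size (enc x))) erefl (v := size (enc (r x))) (m := m) _ _); last first.
- by have := he (enc (r x)) [::]; rewrite /mz [sumn _]/= addn0; apply: leq_trans.
- by have := output_size (rt x).
by rewrite -out leq_add2r leq_add2l.
Qed.
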